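(* There exists a bounded balanced pseudoconvex domain $G\subset\mathbb{C}^2$ with continuous Minkowski function $h_G$ such that the metric space $(G,k_G)$ is not complete, where $k_G$ is the Kobayashi distance of $G$. In particular, $G$ is a bounded balanced domain of holomorphy in $\mathbb{C}^2$ with continuous Minkowski function which is not Kobayashi-finitely-compact.
   Context: A domain (nonempty connected open set) $G\subset\mathbb{C}^n$ is balanced if $\lambda G\subset G$ for every $\lambda\in\mathbb{C}$ with $|\lambda|\le 1$. Its Minkowski function is $h_G(z)=\inf\{t>0: z/t\in G\}$, $z\in\mathbb{C}^n$; one has $G=\{h_G<1\}$ and $h_G(\lambda z)=|\lambda|h_G(z)$. Let $\mathbb{D}=\{\lambda\in\mathbb{C}:|\lambda|<1\}$ and let $p_{\mathbb{D}}(\alpha,\beta)=\operatorname{arctanh}\left|\frac{\alpha-\beta}{1-\overline{\alpha}\beta}\right|$ be the Poincaré distance on $\mathbb{D}$. The Kobayashi (pseudo)distance of a domain $G$ is $k_G(x,y)=\inf\sum_{i=1}^N p_{\mathbb{D}}(\alpha_i,\beta_i)$, the infimum taken over all $N\ge1$, all points $x=x_0,x_1,\dots,x_N=y$ of $G$, all holomorphic maps $f_i:\mathbb{D}\to G$ and all $\alpha_i,\beta_i\in\mathbb{D}$ with $f_i(\alpha_i)=x_{i-1}$, $f_i(\beta_i)=x_i$. For bounded $G$ it is a distance. $(G,k_G)$ is complete if every $k_G$-Cauchy sequence in $G$ converges to a point of $G$. $G$ is Kobayashi-finitely-compact if every $k_G$-ball $\{y\in G:k_G(x,y)<r\}$ ($x\in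 G$, $0<r<\infty$) is relatively compact in $G$. *)

(* Defs.v *)
From Stdlib Require Import Reals List.
From Coquelicot Require Import Coquelicot.
Open Scope R_scope.

Definition set_connected {T : UniformSpace} (A : T -> Prop) : Prop :=
  forall U W : T -> Prop, open U -> open W ->
    (forall z, A z -> U z \/ W z) ->
    (exists z, A z /\ U z) -> (exists z, A z /\ W z) ->
    exists z, A z /\ U z /\ W z.

Definition set_compact {T : UniformSpace} (K : T -> Prop) : Prop :=
  forall (I : Type) (U : I -> T -> Prop), (forall i, open (U i)) ->
    (forall z, K z -> exists i, U i z) ->
    exists l : list I, forall z, K z -> exists i, In i l /\ U i z.

Definition relatively_compact_in {T : UniformSpace} (A G : T -> Prop) : Prop :=
  exists K : T -> Prop,
    set_compact K /\ (forall z, K z -> G z) /\ (forall z, A z -> K z).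

Definition is_domain {T : UniformSpace} (G : T -> Prop) : Prop :=
  (exists z, G z) /\ open G /\ set_connected G.

Definition disc (l : C) : Prop := Cmod l < 1.

Definition arctanh (t : R) : R := / 2 * ln ((1 + t) / (1 - t)).

Definition poincare_dist (a b : C) : R :=
  arctanh (Cmod ((a - b) / (1 - Cconj a * b))%C).

Section ComplexSpace.

Context {V : NormedModule C_AbsRing}.
Implicit Types (G U W : V -> Prop) (z w x y : V).

Definition bounded_set G : Prop := exists M : R, forall z, G z -> norm z <= M.

Definition balanced G : Prop :=
  forall (l : C) z, Cmod l <= 1 -> G z -> G (scal l z).

(* The infimum is finite, and [real] harmless, whenever [G] is a balanced
   domain: such a [G] is a neighbourhood of the origin. *)
Definition minkowski G z : R :=
  real (Glb_Rbar (fun t : R => 0 < t /\ G (scal (RtoC (/ t)) z))).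

(* Complex (Frechet) differentiability at every point of [U]. *)
Definition holomorphic_on U (f : V -> C) : Prop :=
  forall z, U z -> ex_filterdiff (K := C_AbsRing) (V := C_NormedModule) f (locally z).

(* Holomorphic maps from the unit disc to [G]; the values of [f] outside the
   disc are irrelevant. *)
Definition analytic_disc G (f : C -> V) : Prop :=
  forall l : C, disc l -> G (f l) /\ ex_derive (K := C_AbsRing) f l.

(* Continuous plurisubharmonic functions on [G]: the sub-mean value inequality
   on every closed affine disc [z + l w], [|l| <= 1], contained in [G]. The
   radius of the disc is absorbed in [w]. *)
Definition continuous_psh_on G (u : V -> R) : Prop :=
  (forall z, G z -> continuous u z) /\
  (forall z w, (forall l : C, Cmod l <= 1 -> G (plus z (scal l w))) ->
     u z <= / (2 * PI) *
       RInt (fun t : R => u (plus z (scal ((cos t, sin t) : C) w))) 0 (2 * PI)).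

Definition pseudoconvex G : Prop :=
  exists u : V -> R, continuous_psh_on G u /\
    forall c : R, relatively_compact_in (fun z => G z /\ u z < c) G.

Definition domain_of_holomorphy G : Prop :=
  is_domain G /\
  ~ exists U W : V -> Prop,
      open U /\ set_connected U /\ ~ (forall z, U z -> G z) /\
      open W /\ (exists z, W z) /\ (forall z, W z -> U z /\ G z) /\
      forall f : V -> C, holomorphic_on G f ->
        exists F : V -> C, holomorphic_on U F /\ forall z, W z -> F z = f z.

(* [r] is the length of a chain of [N] analytic discs from [x] to [y]. *)
Definition kobayashi_chain G x y (r : R) : Prop :=
  exists (N : nat) (p : nat -> V) (f : nat -> C -> V) (a b : nat -> C),
    (1 <= N)%nat /\ p 0%nat = x /\ p N = y /\
    (forall i : nat, (i <= N)%nat -> G (p i)) /\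
    (forall i : nat, (i < N)%nat ->
       analytic_disc G (f i) /\ disc (a i) /\ disc (b i) /\
       f i (a i) = p i /\ f i (b i) = p (S i)) /\
    r = sum_f_R0 (fun i => poincare_dist (a i) (b i)) (pred N).

(* Points of a domain are always joined by a chain, so that the infimum is
   finite for [x] and [y] in a domain [G]; it is only used there. *)
Definition kobayashi G x y : R := real (Glb_Rbar (kobayashi_chain G x y)).

Definition kobayashi_complete G : Prop :=
  forall s : nat -> V, (forall n, G (s n)) ->
    (forall eps : R, 0 < eps -> exists N : nat, forall m n : nat,
       (N <= m)%nat -> (N <= n)%nat -> kobayashi G (s m) (s n) < eps) ->
    exists z, G z /\ is_lim_seq (fun n => kobayashi G (s n) z) 0.

Definition kobayashi_finitely_compact G : Prop :=
  forall x (r : R), G x -> 0 < r ->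
    relatively_compact_in (fun y => G y /\ kobayashi G x y < r) G.

End ComplexSpace.

(* C^2 with its Euclidean norm. *)
Definition C2 : NormedModule C_AbsRing :=
  prod_NormedModule C_AbsRing C_NormedModule C_NormedModule.

(* Main.v *)
(** The domain consists of the points where the homogeneous polynomials [z2] and
    [P_N = c_N R_N (z1 - b_N z2)] have modulus less than 1, with [|z1| < 1] required on the axis [z2 = 0].
    Here [R_(N+1) = R_N^n z1^(n-2) (z1 - b_(N+1) z2)] and the slopes [b_N] grow very fast.
    Off the axis, [|z1|] is eventually small compared with [c_N b_N |z2|], and there the recursion
    gives [|P_(N+1)| <= |P_N|^n]; near points [(z1, 0)] with [|z1| < 1] the [P_N] are small as well.
    So the conditions are locally finite in the domain, and a supremum of convex functions of the
    [|P_N|] is a plurisubharmonic exhaustion.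

    All [P_N] with [N >= k] vanish on the line [z1 = b_k z2], which therefore meets the domain in a disc
    of radius slightly larger than that of the unit disc on the axis. Hence a point of this line with
    [|z1| = a_k < 1] can be moved to [|z1| = a_(k+1)] at small Kobayashi cost, and small vertical
    discs [z1 = const] join consecutive lines. The resulting zigzag has finite Kobayashi length and
    tends to the boundary point [(1, 0)]. Since the Kobayashi distance of a bounded domain dominates
    a multiple of the Euclidean one, this Cauchy sequence has no limit in the domain. *)
From Stdlib Require Import Reals Lra Lia Classical ClassicalEpsilon List.
From Coquelicot Require Import Coquelicot.
Require Import Defs.
Open Scope R_scope.

(** * Goursat's theorem for real closed forms *)


(** Two demands pull against each other. Continuity of [h_G] at the axis is obtained from the fact
    that the axis radius [2 ^ (x N / m N)] of the condition [|level_poly N| < 1] tends to 1, [m N]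
    being the degree. The path needs the disc on the line of slope [b_(j+1)] to exceed the unit disc
    by much more than [1 - a_j]. Both quantities are of order [1 / m j]: the excess is about
    [x j / (4 m j)], growth that the constant [c_j = 2 ^ (- x j)] can absorb, while [1 - a_j] is at
    most [(4 j + 6) / m j], the price of all linear forms on the vertical disc. The quotient is
    summable once [x j] outgrows [j 4 ^ j], and [x N / m N] still tends to 0 because the degrees
    grow superexponentially. The point [(1, 0)] satisfies every polynomial inequality; only the
    clause on the axis removes it, which is why the exhaustion needs weights and the domain of
    holomorphy needs a separate argument there. The one-variable analysis rests on a single fact,
    the mean value property on circles, derived from Goursat's theorem in logarithmic
    coordinates. *)

Definition closed_at (p q : R -> R -> R) (x y : R) : Prop :=
  exists al be ga : R, forall eps, 0 < eps -> exists del, 0 < del /\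
    forall u v, Rabs (u - x) < del -> Rabs (v - y) < del ->
      Rabs (p u v - p x y - al * (u - x) - be * (v - y)) <= eps * (Rabs (u - x) + Rabs (v - y)) /\
      Rabs (q u v - q x y - be * (u - x) - ga * (v - y)) <= eps * (Rabs (u - x) + Rabs (v - y)).

Lemma continuous_of_bound (g : R -> R) (x K del : R) : 0 < del ->
  (forall u, Rabs (u - x) < del -> Rabs (g u - g x) <= K * Rabs (u - x)) -> continuous g x.
Proof.
  intros Hd H. apply continuity_pt_filterlim. intros eps He.
  assert (HK : 0 < Rabs K + 1) by (pose proof (Rabs_pos K); lra).
  exists (Rmin del (eps / (Rabs K + 1))). split.
  - apply Rmin_pos; [lra|]. apply Rdiv_lt_0_compat; lra.
  - intros u [_ Hu]. simpl in *. unfold R_dist in *.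
    apply Rmin_Rgt_l in Hu. destruct Hu as [H1 H2].
    assert (H3 := H u H1).
    apply Rle_lt_trans with (1 := H3).
    apply Rle_lt_trans with ((Rabs K + 1) * Rabs (u - x)).
    + apply Rmult_le_compat_r; [apply Rabs_pos|]. pose proof (Rle_abs K). lra.
    + apply Rmult_lt_reg_r with (/ (Rabs K + 1)); [apply Rinv_0_lt_compat; lra|].
      replace ((Rabs K + 1) * Rabs (u - x) * / (Rabs K + 1)) with (Rabs (u - x)) by (field; lra).
      exact H2.
Qed.

Lemma closed_at_continuous p q x y : closed_at p q x y ->
  continuous (fun u => p u y) x /\ continuous (fun u => q u y) x /\
  continuous (fun v => p x v) y /\ continuous (fun v => q x v) y.
Proof.
  intros (al & be & ga & H). destruct (H 1 Rlt_0_1) as (del & Hd & H1).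
  set (K := 1 + Rabs al + Rabs be + Rabs ga).
  assert (B : forall f a b dx dy, Rabs (f - a * dx - b * dy) <= 1 * (Rabs dx + Rabs dy) ->
    1 + Rabs a <= K -> 1 + Rabs b <= K -> Rabs f <= K * (Rabs dx + Rabs dy)).
  { intros f a b dx dy A Ka Kb.
    assert (T1 := Rabs_triang (f - a * dx - b * dy) (a * dx + b * dy)).
    replace (f - a * dx - b * dy + (a * dx + b * dy)) with f in T1 by ring.
    assert (T2 := Rabs_triang (a * dx) (b * dy)). rewrite !Rabs_mult in T2.
    pose proof (Rabs_pos dx). pose proof (Rabs_pos dy). nra. }
  pose proof (Rabs_pos al). pose proof (Rabs_pos be). pose proof (Rabs_pos ga).
  assert (L : forall u v, Rabs (u - x) < del -> Rabs (v - y) < del ->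
    Rabs (p u v - p x y) <= K * (Rabs (u - x) + Rabs (v - y)) /\
    Rabs (q u v - q x y) <= K * (Rabs (u - x) + Rabs (v - y))).
  { intros u v Hu Hv. destruct (H1 u v Hu Hv).
    split; [apply (B _ al be)|apply (B _ be ga)]; unfold K; lra. }
  assert (X : forall u, Rabs (u - x) < del -> Rabs (p u y - p x y) <= K * Rabs (u - x) /\
    Rabs (q u y - q x y) <= K * Rabs (u - x)).
  { intros u Hu. assert (M := L u y Hu). rewrite Rminus_diag, Rabs_R0, Rplus_0_r in M. auto. }
  assert (Y : forall v, Rabs (v - y) < del -> Rabs (p x v - p x y) <= K * Rabs (v - y) /\
    Rabs (q x v - q x y) <= K * Rabs (v - y)).
  { intros v Hv. assert (M := L x v). rewrite Rminus_diag, Rabs_R0, Rplus_0_l in M. auto. }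
  repeat split; apply (continuous_of_bound _ _ K del Hd); intros u Hu; first [apply X|apply Y]; exact Hu.
Qed.

(** Counterclockwise boundary integral of [p dx + q dy], with opposite sides merged. In [closed_at]
    the shared coefficient [be] says that the mixed partials agree at the point; the partials need
    not be continuous, so the vanishing is proved by bisection and not by Green's formula. *)
Definition circulation (p q : R -> R -> R) (a b c d : R) : R :=
  RInt (fun x => p x c - p x d) a b + RInt (fun y => q b y - q a y) c d.

Lemma ex_RInt_continuous_le (f : R -> R) a b : a <= b ->
  (forall x, a <= x <= b -> continuous f x) -> ex_RInt f a b.
Proof.
  intros Hab H. apply (ex_RInt_continuous (V := R_CompleteNormedModule)).
  intros x Hx. apply H. rewrite Rmin_left, Rmax_right in Hx by lra. exact Hx.
Qed.

Section Goursat.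
Variables (p q : R -> R -> R) (a b c d : R).
Hypothesis Hcl : forall x y, a <= x <= b -> c <= y <= d -> closed_at p q x y.

Lemma goursat_ex x1 x2 y1 y2 y : a <= x1 <= x2 -> x2 <= b -> c <= y1 <= y2 -> y2 <= d -> c <= y <= d ->
  ex_RInt (fun x => p x y) x1 x2 /\ forall x, a <= x <= b -> ex_RInt (fun y => q x y) y1 y2.
Proof.
  intros. split.
  - apply ex_RInt_continuous_le; [lra|]. intros x Hx.
    apply (closed_at_continuous p q x y), Hcl; lra.
  - intros x Hx. apply ex_RInt_continuous_le; [lra|]. intros z Hz.
    apply (closed_at_continuous p q x z), Hcl; lra.
Qed.

Lemma circulation_split x1 x2 x3 y1 y2 y3 :
  a <= x1 <= x2 -> x2 <= x3 <= b -> c <= y1 <= y2 -> y2 <= y3 <= d ->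
  circulation p q x1 x3 y1 y3 =
  circulation p q x1 x2 y1 y2 + circulation p q x2 x3 y1 y2 +
  circulation p q x1 x2 y2 y3 + circulation p q x2 x3 y2 y3.
Proof.
  intros H1 H2 H3 H4. unfold circulation.
  assert (P : forall s t u v, a <= s <= t -> t <= b -> c <= u <= d -> c <= v <= d ->
    RInt (fun x => p x u - p x v) s t = RInt (fun x => p x u) s t - RInt (fun x => p x v) s t).
  { intros s t u v A B C0 D. apply (RInt_minus (V := R_CompleteNormedModule)).
    - apply (goursat_ex s t c c u); lra.
    - apply (goursat_ex s t c c v); lra. }
  assert (Q : forall s t u v, c <= s <= t -> t <= d -> a <= u <= b -> a <= v <= b ->
    RInt (fun y => q u y - q v y) s t = RInt (fun y => q u y) s t - RInt (fun y => q v y) s t).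
  { intros s t u v A B C0 D. apply (RInt_minus (V := R_CompleteNormedModule)).
    - apply (goursat_ex u u s t s); lra.
    - apply (goursat_ex v v s t s); lra. }
  rewrite !P, !Q by lra.
  assert (P3 : forall y, c <= y <= d -> RInt (fun x => p x y) x1 x3 =
     RInt (fun x => p x y) x1 x2 + RInt (fun x => p x y) x2 x3).
  { intros y Hy. symmetry. apply (RInt_Chasles (V := R_CompleteNormedModule)).
    - apply (goursat_ex x1 x2 c c y); lra.
    - apply (goursat_ex x2 x3 c c y); lra. }
  assert (Q3 : forall x, a <= x <= b -> RInt (fun y => q x y) y1 y3 =
     RInt (fun y => q x y) y1 y2 + RInt (fun y => q x y) y2 y3).
  { intros x Hx. symmetry. apply (RInt_Chasles (V := R_CompleteNormedModule)).
    - apply (goursat_ex x x y1 y2 y1); lra.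
    - apply (goursat_ex x x y2 y3 y2); lra. }
  rewrite !P3, !Q3 by lra. ring.
Qed.

(** The affine part of a closed form has no circulation: [al] and [ga] cancel between opposite
    sides, and the two [be] terms are opposite multiples of the area. What remains is a remainder of
    size [eps] times the side lengths, integrated over the boundary. *)
Lemma circulation_local x y : a <= x <= b -> c <= y <= d -> forall eps, 0 < eps ->
  exists del, 0 < del /\ forall x1 x2 y1 y2,
    a <= x1 <= x -> x <= x2 <= b -> c <= y1 <= y -> y <= y2 <= d ->
    x2 - x1 < del -> y2 - y1 < del ->
    Rabs (circulation p q x1 x2 y1 y2) <= eps * ((x2 - x1) + (y2 - y1)) * ((x2 - x1) + (y2 - y1)).
Proof.
  intros Hx Hy eps He.
  destruct (Hcl x y Hx Hy) as (al & be & ga & H).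
  destruct (H (eps / 2)) as (del & Hd & H1); [lra|].
  exists del. split; [exact Hd|]. intros x1 x2 y1 y2 X1 X2 Y1 Y2 Dx Dy.
  set (S := (x2 - x1) + (y2 - y1)).
  assert (HH : forall u v, x1 <= u <= x2 -> y1 <= v <= y2 ->
     Rabs (p u v - p x y - al * (u - x) - be * (v - y)) <= eps / 2 * S /\
     Rabs (q u v - q x y - be * (u - x) - ga * (v - y)) <= eps / 2 * S).
  { intros u v Hu Hv.
    assert (U : Rabs (u - x) <= x2 - x1) by (apply Rabs_le; lra).
    assert (W : Rabs (v - y) <= y2 - y1) by (apply Rabs_le; lra).
    destruct (H1 u v) as [A B]; try lra.
    assert (eps / 2 * (Rabs (u - x) + Rabs (v - y)) <= eps / 2 * S).
    { apply Rmult_le_compat_l; unfold S; lra. }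
    split; lra. }
  unfold circulation.
  assert (EP : ex_RInt (fun x => p x y1 - p x y2) x1 x2).
  { apply (ex_RInt_minus (V := R_NormedModule)); [apply (goursat_ex x1 x2 c c y1)|apply (goursat_ex x1 x2 c c y2)]; lra. }
  assert (EQ : ex_RInt (fun y => q x2 y - q x1 y) y1 y2).
  { apply (ex_RInt_minus (V := R_NormedModule)); [apply (goursat_ex x1 x2 y1 y2 y1)|apply (goursat_ex x1 x2 y1 y2 y1)]; lra. }
  replace (RInt (fun x => p x y1 - p x y2) x1 x2) with
     (RInt (fun x => (p x y1 - p x y2) - be * (y1 - y2)) x1 x2 + (x2 - x1) * (be * (y1 - y2))).
  2:{ rewrite (RInt_minus (V := R_CompleteNormedModule)), RInt_const; [|exact EP|apply ex_RInt_const].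
      unfold minus, plus, opp, scal; simpl. unfold mult; simpl. ring. }
  replace (RInt (fun y => q x2 y - q x1 y) y1 y2) with
     (RInt (fun y => (q x2 y - q x1 y) - be * (x2 - x1)) y1 y2 + (y2 - y1) * (be * (x2 - x1))).
  2:{ rewrite (RInt_minus (V := R_CompleteNormedModule)), RInt_const; [|exact EQ|apply ex_RInt_const].
      unfold minus, plus, opp, scal; simpl. unfold mult; simpl. ring. }
  assert (A : Rabs (RInt (fun x => (p x y1 - p x y2) - be * (y1 - y2)) x1 x2) <= (x2 - x1) * (eps * S)).
  { apply abs_RInt_le_const; [lra| |].
    - apply (ex_RInt_minus (V := R_NormedModule)); [exact EP|apply ex_RInt_const].
    - intros t Ht. destruct (HH t y1) as [A _]; [lra|lra|]. destruct (HH t y2) as [B _]; [lra|lra|].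
      apply Rabs_le_between in A. apply Rabs_le_between in B. apply Rabs_le. lra. }
  assert (B : Rabs (RInt (fun y => (q x2 y - q x1 y) - be * (x2 - x1)) y1 y2) <= (y2 - y1) * (eps * S)).
  { apply abs_RInt_le_const; [lra| |].
    - apply (ex_RInt_minus (V := R_NormedModule)); [exact EQ|apply ex_RInt_const].
    - intros t Ht. destruct (HH x1 t) as [_ A']; [lra|lra|]. destruct (HH x2 t) as [_ B']; [lra|lra|].
      apply Rabs_le_between in A'. apply Rabs_le_between in B'. apply Rabs_le. lra. }
  apply Rabs_le_between in A. apply Rabs_le_between in B. apply Rabs_le.
  fold S. replace (eps * S * S) with ((x2 - x1) * (eps * S) + (y2 - y1) * (eps * S)) by (unfold S; ring).
  lra.
Qed.

Lemma quarter_step eta w v x y : 0 <= w -> 0 <= v ->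
  a <= x -> x + w <= b -> c <= y -> y + v <= d ->
  eta < Rabs (circulation p q x (x + w) y (y + v)) ->
  exists x' y', x <= x' <= x + w / 2 /\ y <= y' <= y + v / 2 /\
    eta / 4 < Rabs (circulation p q x' (x' + w / 2) y' (y' + v / 2)).
Proof.
  intros Hw Hv X1 X2 Y1 Y2 H.
  rewrite (circulation_split x (x + w / 2) (x + w) y (y + v / 2) (y + v)) in H by lra.
  replace (x + w) with (x + w / 2 + w / 2) in H by field.
  replace (y + v) with (y + v / 2 + v / 2) in H by field.
  apply NNPP. intros N.
  assert (F : forall x' y', x <= x' <= x + w / 2 -> y <= y' <= y + v / 2 ->
    Rabs (circulation p q x' (x' + w / 2) y' (y' + v / 2)) <= eta / 4).
  { intros x' y' A B. apply Rnot_lt_le. intros L. apply N. now exists x', y'. }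
  assert (A1 := F x y ltac:(lra) ltac:(lra)).
  assert (A2 := F (x + w / 2) y ltac:(lra) ltac:(lra)).
  assert (A3 := F x (y + v / 2) ltac:(lra) ltac:(lra)).
  assert (A4 := F (x + w / 2) (y + v / 2) ltac:(lra) ltac:(lra)).
  assert (T := Rabs_triang (circulation p q x (x + w / 2) y (y + v / 2) +
     circulation p q (x + w / 2) (x + w / 2 + w / 2) y (y + v / 2) +
     circulation p q x (x + w / 2) (y + v / 2) (y + v / 2 + v / 2))
     (circulation p q (x + w / 2) (x + w / 2 + w / 2) (y + v / 2) (y + v / 2 + v / 2))).
  assert (T2 := Rabs_triang (circulation p q x (x + w / 2) y (y + v / 2) +
     circulation p q (x + w / 2) (x + w / 2 + w / 2) y (y + v / 2))
     (circulation p q x (x + w / 2) (y + v / 2) (y + v / 2 + v / 2))).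
  assert (T3 := Rabs_triang (circulation p q x (x + w / 2) y (y + v / 2))
     (circulation p q (x + w / 2) (x + w / 2 + w / 2) y (y + v / 2))).
  lra.
Qed.

Lemma nested_limit (u : nat -> R) w : (forall n, u n <= u (S n) <= u n + w / 2 ^ S n) ->
  exists l, forall n, u n <= l <= u n + w / 2 ^ n.
Proof.
  intros H.
  assert (P : forall n, 0 < 2 ^ n) by (intros; apply pow_lt; lra).
  assert (D : forall n k, u (n + k)%nat <= u n + w / 2 ^ n - w / 2 ^ (n + k) /\ u n <= u (n + k)%nat).
  { intros n. induction k as [|k [I J]].
    - rewrite Nat.add_0_r. lra.
    - rewrite Nat.add_succ_r. destruct (H (n + k)%nat) as [A B].
      assert (w / 2 ^ (n + k) = 2 * (w / 2 ^ S (n + k))) by (simpl; field; apply Rgt_not_eq, P).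
      lra. }
  assert (W0 : 0 <= w).
  { destruct (H O) as [A B]. simpl in B. lra. }
  assert (W : forall n, 0 <= w / 2 ^ n) by (intros; apply Rdiv_le_0_compat; auto).
  destruct (ex_finite_lim_seq_incr u (u O + w)) as [l Hl].
  - intros n. apply H.
  - intros n. destruct (D O n) as [A _]. simpl in A. pose proof (W n). lra.
  - exists l. intros n. split.
    + refine (is_lim_seq_incr_compare u l Hl _ n). intros m; apply H.
    + apply is_lim_seq_incr_n with (N := n) in Hl.
      refine (is_lim_seq_le (fun k => u (k + n)%nat) (fun _ => u n + w / 2 ^ n) l _ _ Hl (is_lim_seq_const _)).
      intros k. rewrite Nat.add_comm. destruct (D n k) as [A _]. pose proof (W (n + k)%nat). lra.
Qed.

(** Goursat's bisection: a nonzero circulation is passed on to nested rectangles, losing at most a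
    factor 4 each time, while near the limit point it is small compared with the square of the side
    lengths. Starting from half the modulus keeps all inequalities strict. *)
Lemma goursat_rectangle : a <= b -> c <= d -> circulation p q a b c d = 0.
Proof.
  intros Hab Hcd. apply NNPP. intros NZ.
  set (eta := Rabs (circulation p q a b c d) / 2).
  assert (He : 0 < eta) by (unfold eta; pose proof (Rabs_pos_lt _ NZ); lra).
  set (w := b - a). set (v := d - c).
  pose (good := fun n (z : R * R) => a <= fst z /\ fst z + w / 2 ^ n <= b /\ c <= snd z /\ snd z + v / 2 ^ n <= d /\
     eta / 4 ^ n < Rabs (circulation p q (fst z) (fst z + w / 2 ^ n) (snd z) (snd z + v / 2 ^ n))).
  assert (P2 : forall n, 0 < 2 ^ n) by (intros; apply pow_lt; lra).
  assert (P4 : forall n, 0 < 4 ^ n) by (intros; apply pow_lt; lra).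
  assert (W : forall n, 0 <= w / 2 ^ n) by (intros; apply Rdiv_le_0_compat; [unfold w; lra|auto]).
  assert (V : forall n, 0 <= v / 2 ^ n) by (intros; apply Rdiv_le_0_compat; [unfold v; lra|auto]).
  assert (step : forall n (z : {z | good n z}), {z' : R * R | good (S n) z' /\
      fst (proj1_sig z) <= fst z' <= fst (proj1_sig z) + w / 2 ^ S n /\
      snd (proj1_sig z) <= snd z' <= snd (proj1_sig z) + v / 2 ^ S n}).
  { intros n [[x y] Hz]. apply constructive_indefinite_description. simpl fst in *; simpl snd in *.
    destruct Hz as (A & B & C0 & D & F). simpl fst in *; simpl snd in *.
    destruct (quarter_step _ _ _ _ _ (W n) (V n) A B C0 D F) as (x' & y' & X & Y & Q).
    assert (EW : w / 2 ^ n / 2 = w / 2 ^ S n) by (simpl; field; apply Rgt_not_eq, P2).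
    assert (EV : v / 2 ^ n / 2 = v / 2 ^ S n) by (simpl; field; apply Rgt_not_eq, P2).
    assert (EE : eta / 4 ^ n / 4 = eta / 4 ^ S n) by (simpl; field; apply Rgt_not_eq, P4).
    rewrite EW, EV, EE in Q. rewrite EW in X. rewrite EV in Y.
    exists (x', y'). unfold good. simpl fst; simpl snd.
    repeat split; lra. }
  assert (g0 : good O (a, c)).
  { unfold good; simpl. unfold w, v. replace (a + (b - a) / 1) with b by field.
    replace (c + (d - c) / 1) with d by field. unfold Rdiv at 1. rewrite Rinv_1, Rmult_1_r.
    pose proof (Rabs_pos_lt _ NZ). repeat split; try lra. unfold eta. lra. }
  pose (z := fix z n : {z | good n z} := match n with O => exist _ (a, c) g0
     | S n => exist _ (proj1_sig (step n (z n))) (proj1 (proj2_sig (step n (z n)))) end).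
  destruct (nested_limit (fun n => fst (proj1_sig (z n))) w) as [x Hx].
  { intros n. simpl. apply (proj2_sig (step n (z n))). }
  destruct (nested_limit (fun n => snd (proj1_sig (z n))) v) as [y Hy].
  { intros n. simpl. apply (proj2_sig (step n (z n))). }
  assert (Hx0 := Hx O). assert (Hy0 := Hy O). simpl in Hx0, Hy0.
  unfold w in Hx0; unfold v in Hy0.
  assert (K : 0 < (w + v + 1) * (w + v + 1)) by (unfold w, v; nra).
  (* With this [eps] the local bound on the [n]-th rectangle is at most [eta / 4 ^ n]; the summand 1
     keeps the denominator positive for a degenerate rectangle. *)
  destruct (circulation_local x y ltac:(lra) ltac:(lra) (eta / ((w + v + 1) * (w + v + 1)))) as (del & Hd & L).
  { apply Rdiv_lt_0_compat; lra. }
  destruct (nfloor_ex ((w + v) / del)) as [m Hm].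
  { apply Rdiv_le_0_compat; [unfold w, v; lra|lra]. }
  assert (B2 : INR m + 1 <= 2 ^ S m).
  { clear. induction m as [|m IH]; [simpl; lra|]. rewrite S_INR. change (2 ^ S (S m)) with (2 * 2 ^ S m).
    pose proof (pos_INR m). lra. }
  set (n := S m) in *.
  assert (Hs : w / 2 ^ n < del /\ v / 2 ^ n < del).
  { assert (w + v < del * 2 ^ n).
    { apply Rlt_le_trans with (del * (INR m + 1)).
      - destruct Hm as [_ Hm]. apply Rmult_lt_compat_l with (r := del) in Hm; [|lra].
        replace (del * ((w + v) / del)) with (w + v) in Hm by (field; lra). exact Hm.
      - apply Rmult_le_compat_l; lra. }
    assert (0 <= w /\ 0 <= v) by (unfold w, v; lra).
    split; apply Rmult_lt_reg_r with (2 ^ n); auto.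
    - replace (w / 2 ^ n * 2 ^ n) with w by (field; apply Rgt_not_eq, P2). lra.
    - replace (v / 2 ^ n * 2 ^ n) with v by (field; apply Rgt_not_eq, P2). lra. }
  assert (G := proj2_sig (z n)). destruct G as (G1 & G2 & G3 & G4 & G5).
  set (zx := fst (proj1_sig (z n))) in *. set (zy := snd (proj1_sig (z n))) in *.
  assert (X := Hx n). assert (Y := Hy n). cbv beta in X, Y. fold zx in X. fold zy in Y.
  specialize (L zx (zx + w / 2 ^ n) zy (zy + v / 2 ^ n)).
  replace (zx + w / 2 ^ n - zx) with (w / 2 ^ n) in L by ring.
  replace (zy + v / 2 ^ n - zy) with (v / 2 ^ n) in L by ring.
  specialize (L ltac:(lra) ltac:(lra) ltac:(lra) ltac:(lra) ltac:(lra) ltac:(lra)).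
  assert (E : eta / ((w + v + 1) * (w + v + 1)) * (w / 2 ^ n + v / 2 ^ n) * (w / 2 ^ n + v / 2 ^ n) <= eta / 4 ^ n).
  { replace 4 with (2 * 2) by ring. rewrite Rpow_mult_distr.
    replace (eta / ((w + v + 1) * (w + v + 1)) * (w / 2 ^ n + v / 2 ^ n) * (w / 2 ^ n + v / 2 ^ n)) with
      (((w + v) * (w + v) / ((w + v + 1) * (w + v + 1))) * (eta / (2 ^ n * 2 ^ n))).
    2:{ field. split; [apply Rgt_not_eq, P2|unfold w, v; lra]. }
    rewrite <- (Rmult_1_l (eta / (2 ^ n * 2 ^ n))) at 2.
    apply Rmult_le_compat_r.
    - apply Rdiv_le_0_compat; [lra|]. apply Rmult_lt_0_compat; auto.
    - apply Rmult_le_reg_r with ((w + v + 1) * (w + v + 1)); [exact K|].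
      unfold Rdiv. rewrite Rmult_assoc, Rinv_l by lra. unfold w, v; nra. }
  lra.
Qed.
End Goursat.

(** * Complex differentiability and the mean value property *)

Definition cder (f : C -> C) (z d : C) : Prop :=
  forall eps, 0 < eps -> exists del, 0 < del /\
    forall w, Cmod (w - z) < del -> Cmod (f w - f z - d * (w - z)) <= eps * Cmod (w - z).

Definition cdiff (f : C -> C) (z : C) : Prop := exists d, cder f z d.

Definition ccont (f : C -> C) (z : C) : Prop :=
  forall eps, 0 < eps -> exists del, 0 < del /\
    forall w, Cmod (w - z) < del -> Cmod (f w - f z) < eps.

Lemma Cmod_minus_triangle (u v w : C) : Cmod (u - w) <= Cmod (u - v) + Cmod (v - w).
Proof. replace (u - w)%C with ((u - v) + (v - w))%C by ring. apply Cmod_triangle. Qed.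

Lemma Cmod_minus_sym (u v : C) : Cmod (u - v) = Cmod (v - u).
Proof. rewrite <- Cmod_opp. f_equal. ring. Qed.

Lemma Cmod_le_near (u v : C) : Cmod u <= Cmod (u - v) + Cmod v.
Proof. replace u with ((u - v) + v)%C at 1 by ring. apply Cmod_triangle. Qed.

Lemma Cmod_ge_near (u v : C) : Cmod v <= Cmod (u - v) + Cmod u.
Proof. rewrite Cmod_minus_sym. apply Cmod_le_near. Qed.

(** The epsilon form serves for estimates, [is_derive] for the rules of differentiation; this
    equivalence transfers between them. *)
Lemma cder_is_derive f z d :
  cder f z d <-> @is_derive C_AbsRing (AbsRing_NormedModule C_AbsRing) f z d.
Proof.
  split.
  - intros H. split; [apply is_linear_scal_l|].
    intros x Hx.
    apply (@is_filter_lim_locally_unique C_AbsRing (AbsRing_NormedModule C_AbsRing)) in Hx. subst x.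
    intros eps. destruct (H eps (cond_pos eps)) as (del & Hd & H1).
    exists (mkposreal del Hd). intros y Hy.
    assert (E := H1 y Hy).
    replace (Cmod (f y - f z - d * (y - z))) with (Cmod (f y - f z - (y - z) * d))%C in E by (f_equal; ring).
    exact E.
  - intros [_ H] eps He. specialize (H z (fun P H => H) (mkposreal eps He)).
    destruct H as [del H]. exists del. split; [apply cond_pos|]. intros w Hw.
    assert (E := H w Hw).
    replace (Cmod (f w - f z - d * (w - z))) with (Cmod (f w - f z - (w - z) * d))%C by (f_equal; ring).
    exact E.
Qed.

Lemma cdiff_plus f g z : cdiff f z -> cdiff g z -> cdiff (fun w => f w + g w)%C z.
Proof.
  intros [a A] [b B]. exists (a + b)%C. rewrite cder_is_derive in *.
  exact (@is_derive_plus C_AbsRing (AbsRing_NormedModule C_AbsRing) f g z a b A B).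
Qed.

Lemma cdiff_minus f g z : cdiff f z -> cdiff g z -> cdiff (fun w => f w - g w)%C z.
Proof.
  intros [a A] [b B]. exists (a - b)%C. rewrite cder_is_derive in *.
  exact (@is_derive_minus C_AbsRing (AbsRing_NormedModule C_AbsRing) f g z a b A B).
Qed.

Lemma cdiff_mult f g z : cdiff f z -> cdiff g z -> cdiff (fun w => f w * g w)%C z.
Proof.
  intros [a A] [b B]. exists (a * g z + f z * b)%C. rewrite cder_is_derive in *.
  exact (@is_derive_mult C_AbsRing f g z a b A B Cmult_comm).
Qed.

Lemma cdiff_const c z : cdiff (fun _ => c) z.
Proof.
  exists (RtoC 0). rewrite cder_is_derive.
  exact (@is_derive_const C_AbsRing (AbsRing_NormedModule C_AbsRing) c z).
Qed.

Lemma cdiff_id z : cdiff (fun w => w) z.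
Proof. exists (RtoC 1). rewrite cder_is_derive. exact (@is_derive_id C_AbsRing z). Qed.

Lemma cdiff_comp f g z : cdiff f (g z) -> cdiff g z -> cdiff (fun w => f (g w)) z.
Proof.
  intros [a A] [b B]. exists (b * a)%C. rewrite cder_is_derive in *.
  exact (@is_derive_comp C_AbsRing (AbsRing_NormedModule C_AbsRing) f g z a b A B).
Qed.

Lemma cdiff_pow f n z : cdiff f z -> cdiff (fun w => Cpow (f w) n) z.
Proof.
  intros H. induction n as [|n IH]; simpl; [apply cdiff_const|now apply cdiff_mult].
Qed.

Lemma cdiff_ext_loc f g z del : 0 < del -> (forall w, Cmod (w - z) < del -> f w = g w) ->
  cdiff f z -> cdiff g z.
Proof.
  intros Hd E [d D]. exists d. intros eps He. destruct (D eps He) as (e & Hee & D1).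
  exists (Rmin del e). split; [now apply Rmin_pos|]. intros w Hw. apply Rmin_Rgt_l in Hw.
  destruct Hw as [W1 W2].
  assert (Z : Cmod (z - z) < del) by (replace (z - z)%C with (RtoC 0) by ring; now rewrite Cmod_0).
  rewrite <- (E w W1), <- (E z Z). now apply D1.
Qed.

Lemma cdiff_ext f g z : (forall w, f w = g w) -> cdiff f z -> cdiff g z.
Proof. intros E. apply cdiff_ext_loc with (del := 1); [lra|auto]. Qed.

Lemma cdiff_ccont f z : cdiff f z -> ccont f z.
Proof.
  intros [d D] eps He. destruct (D 1 Rlt_0_1) as (del & Hd & H).
  assert (K : 0 < 1 + Cmod d) by (pose proof (Cmod_ge_0 d); lra).
  exists (Rmin del (eps / (1 + Cmod d))). split.
  - apply Rmin_pos; [lra|]. now apply Rdiv_lt_0_compat.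
  - intros w Hw. apply Rmin_Rgt_l in Hw. destruct Hw as [W1 W2].
    assert (E := H w W1).
    replace (f w - f z)%C with ((f w - f z - d * (w - z)) + d * (w - z))%C by ring.
    eapply Rle_lt_trans; [apply Cmod_triangle|]. rewrite Cmod_mult.
    apply Rmult_lt_compat_r with (r := 1 + Cmod d) in W2; [|exact K].
    replace (eps / (1 + Cmod d) * (1 + Cmod d)) with eps in W2 by (field; lra). lra.
Qed.

Lemma cdiff_inv z : z <> RtoC 0 -> cdiff Cinv z.
Proof.
  intros Hz. exists (- / (z * z))%C. intros eps He.
  assert (P := proj1 (Cmod_gt_0 z) Hz). set (r := Cmod z) in *.
  exists (Rmin (r / 2) (eps * (r * r * r) / 2)). split.
  - apply Rmin_pos; [lra|]. apply Rdiv_lt_0_compat; [|lra]. apply Rmult_lt_0_compat; [lra|].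
    apply Rmult_lt_0_compat; [|lra]. nra.
  - intros w Hw. apply Rmin_Rgt_l in Hw. destruct Hw as [W1 W2].
    assert (Q : r / 2 <= Cmod w).
    { assert (T := Cmod_ge_near w z). fold r in T. lra. }
    assert (Hw0 : w <> RtoC 0) by (intros ->; rewrite Cmod_0 in Q; lra).
    replace (/ w - / z - - / (z * z) * (w - z))%C with ((w - z) * ((w - z) / (z * z * w)))%C.
    2:{ field. now split. }
    rewrite Cmod_mult, Rmult_comm. apply Rmult_le_compat_r; [apply Cmod_ge_0|].
    rewrite Cmod_div, !Cmod_mult. 2:{ repeat apply Cmult_neq_0; auto. }
    fold r.
    assert (R2 : 0 < r * r) by now apply Rmult_lt_0_compat.
    assert (R3 : 0 < r * r * (r / 2)) by (apply Rmult_lt_0_compat; lra).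
    apply Rle_trans with (Cmod (w - z) / (r * r * (r / 2))).
    + apply Rmult_le_compat_l; [apply Cmod_ge_0|]. apply Rinv_le_contravar; [exact R3|].
      apply Rmult_le_compat_l; lra.
    + apply Rmult_le_reg_r with (r * r * (r / 2)); [exact R3|].
      unfold Rdiv at 1. rewrite Rmult_assoc, Rinv_l by lra. lra.
Qed.

Lemma cdiff_div f g z : cdiff f z -> cdiff g z -> g z <> RtoC 0 -> cdiff (fun w => f w / g w)%C z.
Proof.
  intros F G N. apply cdiff_mult; [exact F|].
  apply (cdiff_comp Cinv g); [now apply cdiff_inv|exact G].
Qed.

(** * The complex exponential *)

Definition cexp (z : C) : C := (exp (fst z) * cos (snd z), exp (fst z) * sin (snd z)).

Lemma cexp_plus z w : cexp (z + w) = (cexp z * cexp w)%C.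
Proof.
  unfold cexp, Cmult; simpl. rewrite exp_plus, cos_plus, sin_plus. f_equal; ring.
Qed.

Lemma Cmod_cexp z : Cmod (cexp z) = exp (fst z).
Proof.
  unfold Cmod, cexp; simpl.
  replace (exp (fst z) * cos (snd z) * (exp (fst z) * cos (snd z) * 1) +
    exp (fst z) * sin (snd z) * (exp (fst z) * sin (snd z) * 1)) with (Rsqr (exp (fst z)) * (Rsqr (sin (snd z)) + Rsqr (cos (snd z)))).
  2:{ unfold Rsqr; ring. }
  rewrite sin2_cos2, Rmult_1_r. apply sqrt_Rsqr. left; apply exp_pos.
Qed.

Lemma derive_pt0_eps (f : R -> R) l : is_derive f 0 l -> forall eps, 0 < eps -> exists del, 0 < del /\
   forall h, Rabs h < del -> Rabs (f h - f 0 - l * h) <= eps * Rabs h.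
Proof.
  intros H eps He. apply is_derive_Reals in H. destruct (H eps He) as [del D].
  exists del. split; [apply cond_pos|]. intros h Hh.
  destruct (Req_dec h 0) as [->|N].
  - rewrite Rabs_R0. replace (f 0 - f 0 - l * 0) with 0 by ring. rewrite Rabs_R0. lra.
  - assert (D1 := D h N Hh). rewrite Rplus_0_l in D1.
    replace (f h - f 0 - l * h) with (((f h - f 0) / h - l) * h) by (field; exact N).
    rewrite Rabs_mult. apply Rmult_le_compat_r; [apply Rabs_pos|lra].
Qed.

Lemma Cmod_le_sum z : Cmod z <= Rabs (fst z) + Rabs (snd z).
Proof.
  destruct z as [x y]. simpl.
  replace ((x, y) : C) with (RtoC x + RtoC y * Ci)%C by (unfold Cplus, Cmult, Ci, RtoC; simpl; f_equal; ring).
  eapply Rle_trans; [apply Cmod_triangle|]. rewrite Cmod_mult, !Cmod_R.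
  replace (Cmod Ci) with 1; [lra|]. unfold Cmod, Ci; simpl. replace (0 * (0 * 1) + 1 * (1 * 1)) with 1 by ring.
  symmetry; apply sqrt_1.
Qed.

Lemma Rabs_fst_le z : Rabs (fst z) <= Cmod z.
Proof. eapply Rle_trans; [apply Rmax_l|apply Rmax_Cmod]. Qed.

Lemma Rabs_snd_le z : Rabs (snd z) <= Cmod z.
Proof. eapply Rle_trans; [apply Rmax_r|apply Rmax_Cmod]. Qed.

(** Real part: [exp x cos y - 1 - x] is [(exp x - 1 - x) + (exp x - 1)(cos y - 1) + (cos y - 1)];
    imaginary part: [(sin y - y) + (exp x - 1) sin y]. Each summand is negligible against the
    modulus; the bound [eps / 16] on the radius handles the last product, whose factors are at most
    [2 * r]. *)
Lemma cder_cexp_0 : cder cexp (RtoC 0) (RtoC 1).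
Proof.
  intros eps He.
  destruct (derive_pt0_eps exp 1) with (eps := Rmin 1 (eps / 8)) as (d1 & P1 & D1).
  { auto_derive; [easy|rewrite exp_0; ring]. } { apply Rmin_pos; lra. }
  destruct (derive_pt0_eps cos 0) with (eps := eps / 8) as (d2 & P2 & D2).
  { auto_derive; [easy|rewrite sin_0; ring]. } { lra. }
  destruct (derive_pt0_eps sin 1) with (eps := Rmin 1 (eps / 8)) as (d3 & P3 & D3).
  { auto_derive; [easy|rewrite cos_0; ring]. } { apply Rmin_pos; lra. }
  rewrite exp_0 in D1. rewrite cos_0 in D2. rewrite sin_0 in D3.
  set (del := Rmin (Rmin d1 d2) (Rmin d3 (Rmin 1 (eps / 16)))).
  exists del. split.
  { unfold del. repeat apply Rmin_pos; lra. }
  intros w Hw. unfold del in Hw. apply Rmin_Rgt_l in Hw. destruct Hw as [Hw1 Hw2].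
  apply Rmin_Rgt_l in Hw1. apply Rmin_Rgt_l in Hw2. destruct Hw2 as [Hw2 Hw3].
  apply Rmin_Rgt_l in Hw3.
  replace (w - 0)%C with w in * by ring.
  destruct w as [x y]. assert (X := Rabs_fst_le (x, y)). assert (Y := Rabs_snd_le (x, y)). simpl in X, Y.
  set (r := Cmod (x, y)) in *.
  specialize (D1 x ltac:(lra)). specialize (D2 y ltac:(lra)). specialize (D3 y ltac:(lra)).
  eapply Rle_trans; [apply Cmod_le_sum|]. unfold cexp; simpl.
  rewrite exp_0, cos_0, sin_0.
  pose proof (Rmin_l 1 (eps / 8)). pose proof (Rmin_r 1 (eps / 8)).
  pose proof (Rabs_pos x). pose proof (Rabs_pos y).
  assert (E1 : Rabs (exp x - 1 - 1 * x) <= eps / 8 * r).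
  { eapply Rle_trans; [exact D1|]. apply Rmult_le_compat; try lra. apply Rmin_glb; lra. }
  assert (E1' : Rabs (exp x - 1) <= 2 * r).
  { replace (exp x - 1) with ((exp x - 1 - 1 * x) + x) by ring.
    eapply Rle_trans; [apply Rabs_triang|].
    assert (Rmin 1 (eps / 8) * Rabs x <= 1 * Rabs x) by (apply Rmult_le_compat_r; lra). lra. }
  assert (E2 : Rabs (cos y - 1) <= eps / 8 * r).
  { replace (cos y - 1) with (cos y - 1 - 0 * y) by ring. eapply Rle_trans; [exact D2|].
    apply Rmult_le_compat_l; lra. }
  assert (E3 : Rabs (sin y - y) <= eps / 8 * r).
  { replace (sin y - y) with (sin y - 0 - 1 * y) by ring. eapply Rle_trans; [exact D3|].
    apply Rmult_le_compat; try lra. apply Rmin_glb; lra. }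
  assert (E4 : Rabs (sin y) <= 2 * r).
  { replace (sin y) with ((sin y - 0 - 1 * y) + y) by ring.
    eapply Rle_trans; [apply Rabs_triang|].
    assert (Rmin 1 (eps / 8) * Rabs y <= 1 * Rabs y) by (apply Rmult_le_compat_r; lra). lra. }
  assert (r0 : 0 <= r) by lra.
  replace (exp x * cos y + - (1 * 1) + - (1 * x - 0 * y)) with
    ((exp x - 1 - 1 * x) + (exp x - 1) * (cos y - 1) + (cos y - 1)) by ring.
  replace (exp x * sin y + - (1 * 0) + - (1 * y + 0 * x)) with
    ((sin y - y) + (exp x - 1) * sin y) by ring.
  assert (A : Rabs ((exp x - 1) * (cos y - 1)) <= 2 * (eps / 8 * r)).
  { rewrite Rabs_mult. apply Rmult_le_compat; try apply Rabs_pos; lra. }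
  assert (B : Rabs ((exp x - 1) * sin y) <= eps / 4 * r).
  { rewrite Rabs_mult. apply Rle_trans with ((2 * r) * (2 * r)).
    - apply Rmult_le_compat; try apply Rabs_pos; lra.
    - replace (2 * r * (2 * r)) with (4 * r * r) by ring. apply Rmult_le_compat_r; lra. }
  assert (T1 := Rabs_triang ((exp x - 1 - 1 * x) + (exp x - 1) * (cos y - 1)) (cos y - 1)).
  assert (T2 := Rabs_triang (exp x - 1 - 1 * x) ((exp x - 1) * (cos y - 1))).
  assert (T3 := Rabs_triang (sin y - y) ((exp x - 1) * sin y)).
  nra.
Qed.

Lemma cdiff_cexp z : cdiff cexp z.
Proof.
  apply cdiff_ext with (f := fun w => (cexp z * cexp (w - z))%C).
  { intros w. rewrite <- cexp_plus. f_equal. ring. }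
  apply cdiff_mult; [apply cdiff_const|].
  apply (cdiff_comp cexp (fun w => w - z)%C).
  - replace (z - z)%C with (RtoC 0) by ring. exists (RtoC 1). apply cder_cexp_0.
  - apply cdiff_minus; [apply cdiff_id|apply cdiff_const].
Qed.

(* The real form [Im (h dz)] of a holomorphic [h] is closed. *)
Lemma cdiff_closed_at (h : C -> C) x y : cdiff h (x, y) ->
  closed_at (fun u v => snd (h (u, v))) (fun u v => fst (h (u, v))) x y.
Proof.
  intros [[A B] H]. exists B, A, (- B). intros eps He.
  destruct (H eps He) as (del & Hd & D). exists (del / 2). split; [lra|].
  intros u v Hu Hv.
  assert (E0 : ((u, v) - (x, y))%C = (u - x, v - y)) by (unfold Cminus, Cplus, Copp; simpl; f_equal; ring).
  assert (L := Cmod_le_sum (u - x, v - y)). simpl in L.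
  assert (E := D (u, v)). rewrite E0 in E. specialize (E ltac:(lra)).
  assert (E2 : Cmod (h (u, v) - h (x, y) - (A, B) * (u - x, v - y)) <= eps * (Rabs (u - x) + Rabs (v - y))).
  { eapply Rle_trans; [exact E|]. apply Rmult_le_compat_l; lra. }
  assert (F := Rabs_fst_le (h (u, v) - h (x, y) - (A, B) * ((u - x)%R, (v - y)%R))%C).
  assert (G := Rabs_snd_le (h (u, v) - h (x, y) - (A, B) * ((u - x)%R, (v - y)%R))%C).
  simpl in F, G. split.
  - eapply Rle_trans; [|exact E2]. eapply Rle_trans; [|exact G]. right. f_equal. ring.
  - eapply Rle_trans; [|exact E2]. eapply Rle_trans; [|exact F]. right. f_equal. ring.
Qed.

Definition cis (t : R) : C := (cos t, sin t).

Lemma Cmod_cis t : Cmod (cis t) = 1.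
Proof.
  replace (cis t) with (cexp (0, t)); [rewrite Cmod_cexp; apply exp_0|].
  unfold cexp, cis; simpl. rewrite exp_0, !Rmult_1_l. reflexivity.
Qed.

Lemma cexp_polar x y : cexp (x, y) = (RtoC (exp x) * cis y)%C.
Proof. unfold cexp, cis, Cmult, RtoC; simpl. f_equal; ring. Qed.

(* The circulation of [Im (k (a + exp w) dw)] along a rectangle of height [2 PI] in the [w]-plane
   is the difference of two circle means of [Re k]. *)
Section MeanValue.
Variables (k : C -> C) (a : C) (r : R).
Hypothesis k_diff : forall z, Cmod (z - a) <= r -> cdiff k z.

Lemma circle_continuous s t : 0 < s <= r ->
  continuous (fun t => fst (k (a + s * cis t)%C)) t.
Proof.
  intros Hs.
  assert (D : cdiff (fun w => k (a + cexp w)%C) (ln s, t)).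
  { apply (cdiff_comp k (fun w => a + cexp w)%C).
    - apply k_diff. replace (a + cexp (ln s, t) - a)%C with (cexp (ln s, t)) by ring.
      rewrite Cmod_cexp; simpl. rewrite exp_ln; lra.
    - apply cdiff_plus; [apply cdiff_const|apply cdiff_cexp]. }
  apply cdiff_closed_at, closed_at_continuous in D. destruct D as (_ & _ & _ & D).
  refine (continuous_ext _ _ _ _ D). intros y. simpl. rewrite cexp_polar, exp_ln; [reflexivity|lra].
Qed.

Lemma circle_means_agree s1 s2 : 0 < s1 <= s2 -> s2 <= r ->
  RInt (fun t => fst (k (a + s1 * cis t)%C)) 0 (2 * PI) =
  RInt (fun t => fst (k (a + s2 * cis t)%C)) 0 (2 * PI).
Proof.
  intros H1 H2. assert (PP := PI_RGT_0).
  pose (h := fun w => k (a + cexp w)%C).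
  assert (HG := goursat_rectangle (fun u v => snd (h (u, v))) (fun u v => fst (h (u, v))) (ln s1) (ln s2) 0 (2 * PI)).
  assert (L : ln s1 <= ln s2).
  { destruct (proj2 H1) as [l|e]; [left; apply ln_increasing; lra|rewrite e; lra]. }
  rewrite <- (exp_ln s1), <- (exp_ln s2) by lra.
  assert (HG' : circulation (fun u v => snd (h (u, v))) (fun u v => fst (h (u, v))) (ln s1) (ln s2) 0 (2 * PI) = 0).
  { apply HG; [|exact L|lra]. intros x y Hx Hy. apply cdiff_closed_at.
    apply (cdiff_comp k (fun w => a + cexp w)%C).
    - apply k_diff. replace (a + cexp (x, y) - a)%C with (cexp (x, y)) by ring.
      rewrite Cmod_cexp; simpl.
      apply Rle_trans with (exp (ln s2)); [|rewrite exp_ln; lra].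
      destruct (proj2 Hx) as [l|e]; [left; now apply exp_increasing|rewrite e; lra].
    - apply cdiff_plus; [apply cdiff_const|apply cdiff_cexp]. }
  unfold circulation in HG'.
  replace (RInt (fun x => snd (h (x, 0)) - snd (h (x, 2 * PI))) (ln s1) (ln s2)) with 0 in HG'.
  2:{ rewrite (RInt_ext _ (fun _ => 0)); [rewrite RInt_const; symmetry; apply Rmult_0_r|].
      intros x _. unfold h, cexp; simpl. rewrite cos_2PI, sin_2PI, cos_0, sin_0. apply Rminus_diag. }
  rewrite Rplus_0_l in HG'.
  assert (EX : forall s, 0 < s <= r -> ex_RInt (fun y => fst (h (ln s, y))) 0 (2 * PI)).
  { intros s Hs. apply ex_RInt_continuous_le; [lra|]. intros y _.
    refine (continuous_ext _ _ _ _ (circle_continuous s y Hs)).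
    intros t. unfold h. rewrite cexp_polar, exp_ln; [reflexivity|lra]. }
  rewrite (RInt_minus (V := R_CompleteNormedModule)) in HG'; [|apply EX; lra|apply EX; lra].
  unfold minus, plus, opp in HG'; simpl in HG'.
  rewrite (RInt_ext (fun t => fst (k (a + exp (ln s1) * cis t)%C)) (fun y => fst (h (ln s1, y)))).
  2:{ intros t _. unfold h. now rewrite cexp_polar. }
  rewrite (RInt_ext (fun t => fst (k (a + exp (ln s2) * cis t)%C)) (fun y => fst (h (ln s2, y)))).
  2:{ intros t _. unfold h. now rewrite cexp_polar. }
  lra.
Qed.

(** The circle means do not depend on the radius, and by continuity they approach the value at the
    center as the radius shrinks. *)
Lemma mean_value_re : 0 < r ->
  RInt (fun t => fst (k (a + r * cis t)%C)) 0 (2 * PI) = 2 * PI * fst (k a).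
Proof.
  intros Hr. assert (PP := PI_RGT_0).
  apply cond_eq. intros eps He.
  assert (k_cont : ccont k a).
  { apply cdiff_ccont, k_diff. replace (a - a)%C with (RtoC 0) by ring. rewrite Cmod_0. lra. }
  destruct (k_cont (eps / (4 * PI))) as (del & Hd & D); [apply Rdiv_lt_0_compat; lra|].
  set (s := Rmin (del / 2) r).
  assert (Hs : 0 < s <= r) by (split; [apply Rmin_pos; lra|apply Rmin_r]).
  assert (Hs2 : s <= del / 2) by apply Rmin_l.
  rewrite <- (circle_means_agree s r) by lra.
  replace (2 * PI * fst (k a)) with (RInt (fun _ => fst (k a)) 0 (2 * PI)).
  2:{ rewrite RInt_const. unfold scal; simpl. unfold mult; simpl. ring. }
  assert (EX : ex_RInt (fun t => fst (k (a + s * cis t)%C)) 0 (2 * PI)).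
  { apply ex_RInt_continuous_le; [lra|]. intros t _. now apply circle_continuous. }
  assert (M : RInt (fun t => fst (k (a + s * cis t)%C) - fst (k a)) 0 (2 * PI) =
     RInt (fun t => fst (k (a + s * cis t)%C)) 0 (2 * PI) - RInt (fun _ => fst (k a)) 0 (2 * PI)).
  { apply (RInt_minus (V := R_CompleteNormedModule)); [exact EX|apply ex_RInt_const]. }
  rewrite <- M.
  apply Rle_lt_trans with ((2 * PI - 0) * (eps / (4 * PI))).
  - apply abs_RInt_le_const; [lra| |].
    + apply (ex_RInt_minus (V := R_NormedModule)); [exact EX|apply ex_RInt_const].
    + intros t _. assert (Q := Rabs_fst_le (k (a + s * cis t) - k a)%C).
      assert (Q2 := D (a + s * cis t)%C).
      replace (a + s * cis t - a)%C with (s * cis t)%C in Q2 by ring.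
      rewrite Cmod_mult, Cmod_cis, Cmod_R, Rabs_pos_eq in Q2 by lra.
      simpl in Q. unfold Rminus. lra.
  - replace ((2 * PI - 0) * (eps / (4 * PI))) with (eps / 2) by (field; lra). lra.
Qed.
End MeanValue.

Lemma Cmod_sqr z : Cmod z * Cmod z = fst z * fst z + snd z * snd z.
Proof.
  unfold Cmod. rewrite sqrt_sqrt; [ring|]. nra.
Qed.

Lemma unit_rotation z : exists u, Cmod u = 1 /\ (u * z)%C = RtoC (Cmod z).
Proof.
  destruct (Ceq_dec z 0) as [->|N].
  - exists (RtoC 1). rewrite Cmod_0, Cmod_1. split; [reflexivity|ring].
  - exists (Cmod z / z)%C. assert (P := proj1 (Cmod_gt_0 z) N). split.
    + rewrite Cmod_div by exact N. rewrite Cmod_R, Rabs_pos_eq by lra. field. lra.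
    + field. exact N.
Qed.

Lemma ccont_Cmod_path (k : C -> C) (g : R -> C) t : (forall s, continuous (fun s => fst (g s)) s) ->
  (forall s, continuous (fun s => snd (g s)) s) -> ccont k (g t) -> continuous (fun s => Cmod (k (g s))) t.
Proof.
  intros G1 G2 K. apply continuity_pt_filterlim. intros eps He.
  destruct (K eps He) as (del & Hd & D).
  destruct (proj2 (continuity_pt_filterlim _ t) (G1 t) (del / 2)) as (d1 & P1 & Q1); [lra|].
  destruct (proj2 (continuity_pt_filterlim _ t) (G2 t) (del / 2)) as (d2 & P2 & Q2); [lra|].
  exists (Rmin d1 d2). split; [now apply Rmin_pos|].
  intros s [_ Hs]. simpl in *. unfold R_dist in *. apply Rmin_Rgt_l in Hs. destruct Hs as [S1 S2].
  destruct (Req_dec t s) as [<-|N]; [rewrite Rminus_diag, Rabs_R0; lra|].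
  assert (A := Q1 s (conj (conj I N) S1)). assert (B := Q2 s (conj (conj I N) S2)).
  assert (L := Cmod_le_sum (g s - g t)%C). simpl in L. unfold Rminus in A, B.
  assert (E := D (g s) ltac:(lra)).
  assert (T1 := Cmod_le_near (k (g s)) (k (g t))). assert (T2 := Cmod_ge_near (k (g s)) (k (g t))).
  apply Rabs_def1; lra.
Qed.

Lemma circle_fst_continuous a r s : continuous (fun s => fst (a + RtoC r * cis s)%C) s.
Proof.
  apply (ex_derive_continuous (K := R_AbsRing) (V := R_NormedModule)).
  unfold cis; simpl. auto_derive. easy.
Qed.

Lemma circle_snd_continuous a r s : continuous (fun s => snd (a + RtoC r * cis s)%C) s.
Proof.
  apply (ex_derive_continuous (K := R_AbsRing) (V := R_NormedModule)).
  unfold cis; simpl. auto_derive. easy.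
Qed.

Lemma circle_in_disc a r t : 0 < r -> Cmod (a + r * cis t - a) <= r.
Proof.
  intros Hr. replace (a + r * cis t - a)%C with (r * cis t)%C by ring.
  rewrite Cmod_mult, Cmod_cis, Cmod_R, Rabs_pos_eq; lra.
Qed.

Lemma circle_modulus_integrable (k : C -> C) a r : 0 < r ->
  (forall z, Cmod (z - a) <= r -> cdiff k z) ->
  ex_RInt (fun t => Cmod (k (a + r * cis t)%C)) 0 (2 * PI).
Proof.
  intros Hr Hk. pose proof PI_RGT_0. apply ex_RInt_continuous_le; [lra|]. intros t _.
  apply (ccont_Cmod_path k (fun t => a + r * cis t)%C).
  - intros s; apply circle_fst_continuous.
  - intros s; apply circle_snd_continuous.
  - now apply cdiff_ccont, Hk, circle_in_disc.
Qed.

(** After multiplication by a unit making the central value real and nonnegative, the mean value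
    property for real parts suffices, since a real part is at most the modulus. *)
Lemma sub_mean_value (k : C -> C) a r : 0 < r ->
  (forall z, Cmod (z - a) <= r -> cdiff k z) ->
  2 * PI * Cmod (k a) <= RInt (fun t => Cmod (k (a + r * cis t)%C)) 0 (2 * PI).
Proof.
  intros Hr Hk. assert (PP := PI_RGT_0).
  destruct (unit_rotation (k a)) as (u & Hu & Eu).
  assert (D : forall z, Cmod (z - a) <= r -> cdiff (fun z => u * k z)%C z).
  { intros z Hz. apply cdiff_mult; [apply cdiff_const|auto]. }
  assert (M := mean_value_re (fun z => u * k z)%C a r D Hr). cbv beta in M. rewrite Eu in M.
  change (fst (RtoC (Cmod (k a)))) with (Cmod (k a)) in M. rewrite <- M.
  apply RInt_le; [lra| |now apply circle_modulus_integrable|].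
  - apply ex_RInt_continuous_le; [lra|]. intros t _.
    exact (circle_continuous (fun z => u * k z)%C a r D r t (conj Hr (Rle_refl r))).
  - intros t _. eapply Rle_trans; [apply Rle_abs|]. eapply Rle_trans; [apply Rabs_fst_le|].
    rewrite Cmod_mult, Hu. lra.
Qed.

Lemma mean_value_bound (k : C -> C) a r M : 0 < r ->
  (forall z, Cmod (z - a) <= r -> cdiff k z) ->
  (forall t, 0 <= t <= 2 * PI -> Cmod (k (a + r * cis t)%C) <= M) -> Cmod (k a) <= M.
Proof.
  intros Hr Hk HM. assert (PP := PI_RGT_0).
  apply Rmult_le_reg_l with (2 * PI); [lra|].
  eapply Rle_trans; [exact (sub_mean_value k a r Hr Hk)|].
  replace (2 * PI * M) with (RInt (fun _ => M) 0 (2 * PI)).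
  2:{ rewrite RInt_const. unfold scal; simpl. unfold mult; simpl. ring. }
  apply RInt_le; [lra|now apply circle_modulus_integrable|apply ex_RInt_const|].
  intros t Ht. apply HM. lra.
Qed.

(** * Estimates on the unit disc *)

Definition moebius (c l : C) : C := ((l + c) / (1 + Cconj c * l))%C.

Lemma moebius_denominator c l : Cmod c < 1 -> Cmod l <= 1 ->
  (1 + Cconj c * l <> 0)%C /\ 1 - Cmod c <= Cmod (1 + Cconj c * l).
Proof.
  intros Hc Hl.
  assert (H : 1 - Cmod c <= Cmod (1 + Cconj c * l)).
  { assert (T := Cmod_triangle (1 + Cconj c * l) (- (Cconj c * l))).
    replace (1 + Cconj c * l + - (Cconj c * l))%C with (RtoC 1) in T by ring.
    rewrite Cmod_1, Cmod_opp, Cmod_mult, Cmod_conj in T.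
    pose proof (Cmod_ge_0 c). pose proof (Cmod_ge_0 l). nra. }
  split; [|exact H]. intros E. rewrite E, Cmod_0 in H. lra.
Qed.

(** The classical identity for [1 - |moebius c l|^2], cleared of denominators. It gives both the
    invariance of the disc and the behavior near the unit circle. *)
Lemma moebius_sqr c l : Cmod c < 1 -> Cmod l <= 1 ->
  (1 - Cmod (moebius c l) * Cmod (moebius c l)) * (Cmod (1 + Cconj c * l) * Cmod (1 + Cconj c * l)) =
  (1 - Cmod c * Cmod c) * (1 - Cmod l * Cmod l).
Proof.
  intros Hc Hl. destruct (moebius_denominator c l Hc Hl) as [N H].
  assert (P := proj1 (Cmod_gt_0 _) N).
  unfold moebius. rewrite Cmod_div by exact N.
  transitivity (Cmod (1 + Cconj c * l) * Cmod (1 + Cconj c * l) - Cmod (l + c) * Cmod (l + c)).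
  { field. lra. }
  rewrite !Cmod_sqr. destruct c, l; simpl. ring.
Qed.

Lemma moebius_disc c l : Cmod c < 1 -> Cmod l < 1 -> Cmod (moebius c l) < 1.
Proof.
  intros Hc Hl. assert (E := moebius_sqr c l Hc (Rlt_le _ _ Hl)).
  destruct (moebius_denominator c l Hc (Rlt_le _ _ Hl)) as [N _].
  assert (P := proj1 (Cmod_gt_0 _) N).
  pose proof (Cmod_ge_0 c). pose proof (Cmod_ge_0 l). pose proof (Cmod_ge_0 (moebius c l)).
  apply Rnot_le_lt. intros L.
  assert (0 < (1 - Cmod c * Cmod c) * (1 - Cmod l * Cmod l)) by (apply Rmult_lt_0_compat; nra).
  assert (0 < Cmod (1 + Cconj c * l) * Cmod (1 + Cconj c * l)) by now apply Rmult_lt_0_compat.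
  assert (0 <= (Cmod (moebius c l) * Cmod (moebius c l) - 1) * (Cmod (1 + Cconj c * l) * Cmod (1 + Cconj c * l)))
    by (apply Rmult_le_pos; nra).
  lra.
Qed.

Lemma moebius_cdiff c l : Cmod c < 1 -> Cmod l <= 1 -> cdiff (moebius c) l.
Proof.
  intros Hc Hl. apply (cdiff_div (fun l => l + c)%C (fun l => 1 + Cconj c * l)%C).
  - apply cdiff_plus; [apply cdiff_id|apply cdiff_const].
  - apply cdiff_plus; [apply cdiff_const|]. apply cdiff_mult; [apply cdiff_const|apply cdiff_id].
  - now apply moebius_denominator.
Qed.

Lemma moebius_0 c : moebius c 0 = c.
Proof.
  unfold moebius. replace (1 + Cconj c * 0)%C with (RtoC 1) by ring.
  replace (0 + c)%C with c by ring. field.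
Qed.

Lemma disc_denominator a b : Cmod a < 1 -> Cmod b < 1 -> (1 - Cconj a * b <> 0)%C.
Proof.
  intros Ha Hb. replace (1 - Cconj a * b)%C with (1 + Cconj (- a) * b)%C.
  - apply moebius_denominator; [rewrite Cmod_opp; exact Ha|lra].
  - destruct a, b; unfold Cconj, Cminus, Cplus, Copp, Cmult; simpl; f_equal; ring.
Qed.

Lemma moebius_inverse a b : Cmod a < 1 -> Cmod b < 1 ->
  moebius a ((b - a) / (1 - Cconj a * b))%C = b.
Proof.
  intros Ha Hb. assert (N := disc_denominator a b Ha Hb).
  assert (N2 : (1 - Cconj a * a <> 0)%C) by now apply disc_denominator.
  unfold moebius.
  replace ((b - a) / (1 - Cconj a * b) + a)%C with (b * ((1 - Cconj a * a) / (1 - Cconj a * b)))%C.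
  2:{ field. exact N. }
  replace (1 + Cconj a * ((b - a) / (1 - Cconj a * b)))%C with ((1 - Cconj a * a) / (1 - Cconj a * b))%C.
  2:{ field. exact N. }
  field. now split.
Qed.

Lemma pseudohyperbolic_lt_1 a b : Cmod a < 1 -> Cmod b < 1 -> Cmod ((b - a) / (1 - Cconj a * b)) < 1.
Proof.
  intros Ha Hb.
  replace ((b - a) / (1 - Cconj a * b))%C with (moebius (- a) b).
  - apply moebius_disc; [now rewrite Cmod_opp|exact Hb].
  - unfold moebius. replace (Cconj (- a)) with (- Cconj a)%C.
    + unfold Cdiv. f_equal. f_equal. ring.
    + destruct a; unfold Cconj, Copp; simpl; f_equal; ring.
Qed.

Lemma Cmod_pow (z : C) n : Cmod (Cpow z n) = Cmod z ^ n.
Proof. induction n as [|n IH]; simpl; [apply Cmod_1|now rewrite Cmod_mult, IH]. Qed.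

Lemma Cpow_neq_0 (z : C) n : z <> RtoC 0 -> Cpow z n <> RtoC 0.
Proof. intros Hz. induction n as [|n IH]; simpl; [apply C1_nz|now apply Cmult_neq_0]. Qed.

Lemma Cmod_circle s t : 0 < s -> Cmod (s * cis t) = s.
Proof. intros Hs. rewrite Cmod_mult, Cmod_cis, Cmod_R, Rabs_pos_eq; lra. Qed.

(* Applied with the Moebius map of center [c], the mean value property at [0] becomes a maximum
   principle at [c] for a curve that can be taken as close to the unit circle as desired. *)
Lemma moebius_circle c rho : Cmod c < 1 -> 0 < rho < 1 ->
  exists s, 0 < s < 1 /\ forall t, rho <= Cmod (moebius c (s * cis t)).
Proof.
  intros Hc Hrho. pose proof (Cmod_ge_0 c). set (x := Cmod c) in *.
  (* With [s * s = 1 - e], the right side of [moebius_sqr] is at most [e], while a modulus below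
     [rho] would make the left side exceed [(1 - rho * rho) * (1 - x) * (1 - x) = e]. *)
  set (e := (1 - x) * (1 - x) * (1 - rho * rho)).
  assert (X2 : 0 < (1 - x) * (1 - x) <= 1) by nra. assert (R2 : 0 < 1 - rho * rho < 1) by nra.
  assert (E : 0 < e < 1) by (unfold e; nra).
  assert (S2 : sqrt (1 - e) * sqrt (1 - e) = 1 - e) by (apply sqrt_sqrt; lra).
  assert (S0 : 0 < sqrt (1 - e)) by (apply sqrt_lt_R0; lra).
  exists (sqrt (1 - e)). set (s := sqrt (1 - e)) in *. split; [nra|]. intros t.
  assert (L : Cmod (s * cis t) <= 1) by (rewrite Cmod_circle; nra).
  assert (Q := moebius_sqr c (s * cis t) Hc L). destruct (moebius_denominator c (s * cis t) Hc L) as [_ D].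
  rewrite Cmod_circle, S2 in Q by exact S0. fold x in Q, D.
  set (y := Cmod (moebius c (s * cis t))) in *. set (w := Cmod (1 + Cconj c * (s * cis t))) in *.
  assert (y0 : 0 <= y) by apply Cmod_ge_0. apply Rnot_lt_le. intros Y.
  assert (A : 1 - rho * rho < 1 - y * y) by nra.
  assert (W : (1 - x) * (1 - x) <= w * w) by nra.
  assert (B : (1 - x * x) * (1 - (1 - e)) <= e) by nra.
  assert (e < (1 - y * y) * (w * w)); [|lra]. unfold e.
  apply Rlt_le_trans with ((1 - x) * (1 - x) * (1 - y * y)); [apply Rmult_lt_compat_l; lra|].
  rewrite Rmult_comm. apply Rmult_le_compat_l; lra.
Qed.

Lemma moebius_circle_bound (h : C -> C) c s M : Cmod c < 1 -> 0 < s < 1 ->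
  (forall z, Cmod z < 1 -> cdiff h z) ->
  (forall t, 0 <= t <= 2 * PI -> Cmod (h (moebius c (s * cis t))) <= M) -> Cmod (h c) <= M.
Proof.
  intros Hc Hs Hh HM. rewrite <- (moebius_0 c).
  apply (mean_value_bound (fun z => h (moebius c z)) 0 s); [lra| |].
  - intros z Hz. replace (z - 0)%C with z in Hz by ring.
    apply (cdiff_comp h (moebius c)); [apply Hh, moebius_disc|apply moebius_cdiff]; lra.
  - intros t Ht. replace (0 + s * cis t)%C with (s * cis t)%C by ring. now apply HM.
Qed.

Lemma geometric_lt x y A B : 0 <= x < y -> 0 < A -> exists n, B * x ^ n < A * y ^ n.
Proof.
  intros Hxy HA. destruct (pow_lt_1_zero (x / y)) with (y := A / (Rabs B + 1)) as [n Hn].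
  { rewrite Rabs_pos_eq by (apply Rdiv_le_0_compat; lra). apply Rlt_div_l; lra. }
  { pose proof (Rabs_pos B). apply Rdiv_lt_0_compat; lra. }
  exists n. specialize (Hn n (Nat.le_refl n)).
  assert (Y : 0 < y ^ n) by (apply pow_lt; lra). assert (X : 0 <= x ^ n) by (apply pow_le; lra).
  rewrite Rabs_pos_eq in Hn by (apply pow_le, Rdiv_le_0_compat; lra).
  unfold Rdiv in Hn at 1. rewrite Rpow_mult_distr, pow_inv in Hn. fold (x ^ n / y ^ n) in Hn.
  pose proof (Rabs_pos B). pose proof (Rle_abs B).
  apply (Rlt_div_l (x ^ n) _ (y ^ n) Y) in Hn. apply Rmult_lt_compat_l with (r := Rabs B + 1) in Hn; [|lra].
  replace ((Rabs B + 1) * (A / (Rabs B + 1) * y ^ n)) with (A * y ^ n) in Hn by (field; lra).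
  assert (B * x ^ n <= (Rabs B + 1) * x ^ n) by (apply Rmult_le_compat_r; lra). lra.
Qed.

(* [(g - g 0)^(n + 2) / z^n] is complex differentiable at [0] because it is [O(z^2)] there.
   Bounding it at [c] and letting [n] tend to infinity replaces the Schwarz lemma. *)
Lemma bounded_disc_lipschitz (g : C -> C) M c :
  (forall z, Cmod z < 1 -> cdiff g z /\ Cmod (g z) <= M) -> Cmod c < 1 ->
  Cmod (g c - g 0) <= 4 * M * Cmod c.
Proof.
  intros Hg Hc.
  assert (Z1 : Cmod (RtoC 0) < 1) by (rewrite Cmod_0; lra).
  assert (M0 : 0 <= M).
  { destruct (Hg c Hc) as [_ H]. pose proof (Cmod_ge_0 (g c)). lra. }
  destruct (Ceq_dec c 0) as [->|N].
  { replace (g 0 - g 0)%C with (RtoC 0) by ring. rewrite Cmod_0. lra. }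
  set (f := fun z => (g z - g 0)%C).
  assert (FD : forall z, Cmod z < 1 -> cdiff f z) by (intros z Hz; apply cdiff_minus; [now apply Hg|apply cdiff_const]).
  assert (FM : forall z, Cmod z < 1 -> Cmod (f z) <= 2 * M).
  { intros z Hz. assert (T := Cmod_triangle (g z) (- g 0)). rewrite Cmod_opp in T.
    assert (A := proj2 (Hg z Hz)). assert (B := proj2 (Hg _ Z1)). unfold f, Cminus. lra. }
  assert (F0 : f (RtoC 0) = RtoC 0) by (unfold f; ring).
  assert (HD : forall n z, Cmod z < 1 -> cdiff (fun z => Cpow (f z) (n + 2) / Cpow z n)%C z).
  { intros n z Hz. destruct (Ceq_dec z 0) as [->|Nz].
    2:{ apply cdiff_div; [now apply cdiff_pow, FD|apply cdiff_pow, cdiff_id|now apply Cpow_neq_0]. }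
    destruct (FD _ Z1) as [d Dd]. destruct (Dd 1 Rlt_0_1) as (del & Hdel & D1).
    set (K := 1 + Cmod d). assert (K1 : 1 <= K) by (unfold K; pose proof (Cmod_ge_0 d); lra).
    assert (KP : 0 < K ^ (n + 2)) by (apply pow_lt; lra).
    exists (RtoC 0). intros eps He. exists (Rmin del (eps / K ^ (n + 2))).
    split; [apply Rmin_pos; [exact Hdel|now apply Rdiv_lt_0_compat]|]. intros w Hw.
    apply Rmin_Rgt_l in Hw. destruct Hw as [W1 W2]. specialize (D1 w W1). rewrite F0 in *.
    replace (w - 0)%C with w in * by ring. replace (f w - 0 - d * w)%C with (f w - d * w)%C in D1 by ring.
    assert (FK : Cmod (f w) <= K * Cmod w).
    { assert (T := Cmod_le_near (f w) (d * w)). rewrite Cmod_mult in T. unfold K. lra. }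
    replace (Cpow 0 (n + 2) / Cpow 0 n)%C with (RtoC 0) by (rewrite Nat.add_comm; simpl; unfold Cdiv; ring).
    replace (Cpow (f w) (n + 2) / Cpow w n - 0 - 0 * w)%C with (Cpow (f w) (n + 2) / Cpow w n)%C by ring.
    destruct (Ceq_dec w 0) as [->|Nw].
    { rewrite F0, Nat.add_comm. simpl. unfold Cdiv. rewrite !Cmult_0_l, Cmod_0. lra. }
    assert (Wp := proj1 (Cmod_gt_0 w) Nw). rewrite Cmod_div, !Cmod_pow by now apply Cpow_neq_0.
    apply Rle_div_l; [now apply pow_lt|].
    apply Rle_trans with ((K * Cmod w) ^ (n + 2)); [apply pow_incr; split; [apply Cmod_ge_0|exact FK]|].
    rewrite Rpow_mult_distr, (pow_add (Cmod w)). apply (proj2 (Rlt_div_r _ _ _ KP)) in W2.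
    replace (K ^ (n + 2) * (Cmod w ^ n * Cmod w ^ 2)) with ((Cmod w * K ^ (n + 2)) * (Cmod w * Cmod w ^ n)) by (simpl; ring).
    rewrite (Rmult_assoc eps). apply Rmult_le_compat_r; [|lra].
    apply Rmult_le_pos; [lra|apply pow_le; lra]. }
  (* The constant 4 arises here: [|f| <= 2 * M] is divided by [|z| >= 1 / 2]. *)
  destruct (moebius_circle c (1 / 2) Hc) as (s & Hs & HR); [lra|].
  assert (HB : forall n, Cmod (f c) ^ (n + 2) <= (2 * M) ^ 2 * (4 * M * Cmod c) ^ n).
  { intros n. assert (Cp := proj1 (Cmod_gt_0 c) N). assert (Cn := pow_lt _ n Cp).
    assert (B : Cmod (Cpow (f c) (n + 2) / Cpow c n) <= (2 * M) ^ (n + 2) / (1 / 2) ^ n).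
    { apply (moebius_circle_bound (fun z => Cpow (f z) (n + 2) / Cpow z n)%C c s); [exact Hc|exact Hs|apply HD|].
      intros t _. specialize (HR t). set (z := moebius c (s * cis t)) in *.
      assert (Hz : Cmod z < 1) by (apply moebius_disc; [exact Hc|rewrite Cmod_circle; lra]).
      assert (Nz : z <> RtoC 0) by (intros E; rewrite E, Cmod_0 in HR; lra).
      rewrite Cmod_div, !Cmod_pow by now apply Cpow_neq_0.
      apply Rmult_le_compat; [apply pow_le, Cmod_ge_0|left; apply Rinv_0_lt_compat, pow_lt; lra| |].
      - apply pow_incr. split; [apply Cmod_ge_0|now apply FM].
      - apply Rinv_le_contravar; [apply pow_lt; lra|apply pow_incr; lra]. }
    rewrite Cmod_div, !Cmod_pow in B by now apply Cpow_neq_0. apply (proj1 (Rle_div_l _ _ _ Cn)) in B.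
    eapply Rle_trans; [exact B|]. right. unfold Rdiv at 1. rewrite <- pow_inv. replace (/ (1 / 2)) with 2 by field.
    rewrite pow_add. replace (4 * M * Cmod c) with (2 * M * 2 * Cmod c) by ring. rewrite !Rpow_mult_distr. ring. }
  change (Cmod (f c) <= 4 * M * Cmod c). apply Rnot_lt_le. intros L.
  assert (P0 : 0 <= 4 * M * Cmod c) by (apply Rmult_le_pos; [lra|apply Cmod_ge_0]).
  destruct (geometric_lt (4 * M * Cmod c) (Cmod (f c)) (Cmod (f c) ^ 2) ((2 * M) ^ 2)) as [n Hn];
    [lra|apply pow_lt; lra|].
  specialize (HB n). rewrite pow_add in HB. lra.
Qed.

Lemma arctanh_ge t : 0 <= t < 1 -> t / 2 <= arctanh t.
Proof.
  intros Ht. unfold arctanh.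
  assert (L : - ln ((1 - t) / (1 + t)) = ln ((1 + t) / (1 - t))).
  { rewrite <- ln_Rinv; [|apply Rdiv_lt_0_compat; lra]. f_equal. field. lra. }
  assert (B : ln ((1 - t) / (1 + t)) <= (1 - t) / (1 + t) - 1).
  { assert (P : 0 < (1 - t) / (1 + t)) by (apply Rdiv_lt_0_compat; lra).
    assert (E := exp_ineq1_le (ln ((1 - t) / (1 + t)))). rewrite exp_ln in E by exact P. lra. }
  assert (Q : (1 - t) / (1 + t) - 1 <= - t).
  { apply Rmult_le_reg_r with (1 + t); [lra|].
    replace (((1 - t) / (1 + t) - 1) * (1 + t)) with (- 2 * t) by (field; lra). nra. }
  lra.
Qed.

Lemma arctanh_le t : 0 <= t < 1 -> arctanh t <= t / (1 - t).
Proof.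
  intros Ht. unfold arctanh.
  assert (P : 0 < (1 + t) / (1 - t)) by (apply Rdiv_lt_0_compat; lra).
  assert (E := exp_ineq1_le (ln ((1 + t) / (1 - t)))). rewrite exp_ln in E by exact P.
  assert (Q : (1 + t) / (1 - t) - 1 = 2 * (t / (1 - t))) by (field; lra). lra.
Qed.

Lemma poincare_nonneg a b : Cmod a < 1 -> Cmod b < 1 ->
  0 <= Cmod ((a - b) / (1 - Cconj a * b)) < 1.
Proof.
  intros Ha Hb. split; [apply Cmod_ge_0|].
  assert (P := pseudohyperbolic_lt_1 a b Ha Hb).
  replace ((a - b) / (1 - Cconj a * b))%C with (- ((b - a) / (1 - Cconj a * b)))%C.
  - now rewrite Cmod_opp.
  - field. now apply disc_denominator.
Qed.

(** The Moebius map of center [a] moves the pair to [0] and a point of modulus equal to the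
    pseudohyperbolic distance. The 8 is the 4 of [bounded_disc_lipschitz] times the 2 given away in
    [arctanh_ge]. *)
Lemma poincare_lipschitz (g : C -> C) M a b :
  (forall z, Cmod z < 1 -> cdiff g z /\ Cmod (g z) <= M) -> Cmod a < 1 -> Cmod b < 1 ->
  Cmod (g a - g b) <= 8 * M * poincare_dist a b.
Proof.
  intros Hg Ha Hb.
  assert (M0 : 0 <= M).
  { destruct (Hg a Ha) as [_ H]. pose proof (Cmod_ge_0 (g a)). lra. }
  set (l := ((b - a) / (1 - Cconj a * b))%C).
  assert (L : Cmod l < 1) by now apply pseudohyperbolic_lt_1.
  assert (B := bounded_disc_lipschitz (fun z => g (moebius a z)) M l).
  cbv beta in B. rewrite moebius_0 in B. unfold l in B at 2. rewrite moebius_inverse in B by assumption.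
  assert (B' : Cmod (g b - g a) <= 4 * M * Cmod l).
  { apply B; [|exact L]. intros z Hz. split.
    - apply (cdiff_comp g (moebius a)); [apply Hg; now apply moebius_disc|apply moebius_cdiff; lra].
    - apply Hg. now apply moebius_disc. }
  replace (g a - g b)%C with (- (g b - g a))%C by ring. rewrite Cmod_opp.
  unfold poincare_dist.
  replace (Cmod ((a - b) / (1 - Cconj a * b))) with (Cmod l).
  - assert (A := arctanh_ge (Cmod l) (conj (Cmod_ge_0 l) L)).
    assert (4 * M * Cmod l <= 8 * M * arctanh (Cmod l)) by nra. lra.
  - rewrite <- Cmod_opp. f_equal. unfold l. field. now apply disc_denominator.
Qed.

(** Since [g] vanishes near 0, every quotient [g z / z ^ n] is holomorphic on the disc, being
    locally constant 0 at the origin. On a curve around [c] where [|z| >= rho > |c|] the function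
    [g] has a maximum [M] independent of [n], so [|g c| <= M * (|c| / rho) ^ n] for all [n]. *)
Lemma identity_disc (g : C -> C) del : 0 < del -> (forall z, Cmod z < 1 -> cdiff g z) ->
  (forall z, Cmod z < del -> g z = 0) -> forall c, Cmod c < 1 -> g c = 0.
Proof.
  intros Hd Hg H0 c Hc. destruct (Ceq_dec c 0) as [->|N].
  { apply H0. now rewrite Cmod_0. }
  assert (Pc := proj1 (Cmod_gt_0 c) N). set (rho := (1 + Cmod c) / 2).
  assert (Hrho : Cmod c < rho < 1) by (unfold rho; lra).
  destruct (moebius_circle c rho Hc) as (s & Hs & HR); [lra|].
  destruct (continuity_ab_maj (fun t => Cmod (g (moebius c (s * cis t)))) 0 (2 * PI)) as (tm & HM & _).
  { pose proof PI_RGT_0; lra. }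
  { intros t _. apply continuity_pt_filterlim.
    apply (ccont_Cmod_path (fun z => g (moebius c z)) (fun t => s * cis t)%C).
    - intros u. refine (continuous_ext _ _ _ _ (circle_fst_continuous 0 s u)). intros v. simpl. ring.
    - intros u. refine (continuous_ext _ _ _ _ (circle_snd_continuous 0 s u)). intros v. simpl. ring.
    - apply cdiff_ccont. apply (cdiff_comp g (moebius c)).
      + apply Hg, moebius_disc; [exact Hc|rewrite Cmod_circle; lra].
      + apply moebius_cdiff; [exact Hc|rewrite Cmod_circle; lra]. }
  set (M := Cmod (g (moebius c (s * cis tm)))) in *.
  assert (D : forall n z, Cmod z < 1 -> cdiff (fun z => g z / Cpow z n)%C z).
  { intros n z Hz. destruct (Ceq_dec z 0) as [->|Nz].
    - apply cdiff_ext_loc with (f := fun _ => RtoC 0) (del := del); [exact Hd| |apply cdiff_const].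
      intros w Hw. rewrite H0; [unfold Cdiv; ring|]. now replace (w - 0)%C with w in Hw by ring.
    - apply cdiff_div; [now apply Hg|apply cdiff_pow, cdiff_id|now apply Cpow_neq_0]. }
  assert (K : forall n, Cmod (g c) * rho ^ n <= M * Cmod c ^ n).
  { intros n. assert (Pn := pow_lt _ n Pc). assert (Pr : 0 < rho ^ n) by (apply pow_lt; lra).
    assert (B : Cmod (g c / Cpow c n) <= M / rho ^ n).
    { apply (moebius_circle_bound (fun z => g z / Cpow z n)%C c s); [exact Hc|exact Hs|apply D|].
      intros t Ht. specialize (HR t). specialize (HM t Ht). set (z := moebius c (s * cis t)) in *.
      assert (Nz : z <> RtoC 0) by (intros E; rewrite E, Cmod_0 in HR; lra).
      rewrite Cmod_div, Cmod_pow by now apply Cpow_neq_0.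
      apply Rmult_le_compat; [apply Cmod_ge_0|left; apply Rinv_0_lt_compat, pow_lt; lra|exact HM|].
      apply Rinv_le_contravar; [exact Pr|apply pow_incr; lra]. }
    rewrite Cmod_div, Cmod_pow in B by now apply Cpow_neq_0. apply (proj1 (Rle_div_l _ _ _ Pn)) in B.
    replace (M * Cmod c ^ n) with (M / rho ^ n * Cmod c ^ n * rho ^ n) by (field; lra).
    apply Rmult_le_compat_r; lra. }
  apply Cmod_eq_0. apply Rle_antisym; [|apply Cmod_ge_0]. apply Rnot_lt_le. intros L.
  destruct (geometric_lt (Cmod c) rho (Cmod (g c)) M) as [n Hn]; [lra|exact L|]. specialize (K n). lra.
Qed.

(** * Topology and holomorphic functions on C^2 *)

(** Neighborhoods measured by [Cmod]. The library's [ball] on [C] is a square in real coordinates,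
    whence the factors 2 in the comparison. *)
Definition bidisc (z : C2) (r : R) (w : C2) : Prop :=
  Cmod (fst w - fst z) < r /\ Cmod (snd w - snd z) < r.

Lemma C_ball_Cmod (x y : C) r : Cmod (y - x) < r -> @ball C_UniformSpace x r y.
Proof.
  intros H. assert (A := Rabs_fst_le (y - x)%C). assert (B := Rabs_snd_le (y - x)%C).
  split; [change (Rabs (fst y - fst x) < r)|change (Rabs (snd y - snd x) < r)];
  simpl in A, B; unfold Rminus; lra.
Qed.

Lemma C_ball_Cmod_half (x y : C) r : @ball C_UniformSpace x (r / 2) y -> Cmod (y - x) < r.
Proof.
  intros [A B]. change (Rabs (fst y - fst x) < r / 2) in A. change (Rabs (snd y - snd x) < r / 2) in B.
  assert (L := Cmod_le_sum (y - x)%C). simpl in L. unfold Rminus in A, B. lra.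
Qed.

Lemma bidisc_ball (z w : C2) r : bidisc z r w -> ball z r w.
Proof. intros [A B]. split; now apply C_ball_Cmod. Qed.

Lemma ball_bidisc (z w : C2) r : ball z (r / 2) w -> bidisc z r w.
Proof. intros [A B]. split; now apply C_ball_Cmod_half. Qed.

Lemma locally_C2 (z : C2) (P : C2 -> Prop) :
  locally z P <-> exists r, 0 < r /\ forall w, bidisc z r w -> P w.
Proof.
  split.
  - intros [r H]. exists r. split; [apply cond_pos|]. intros w Hw. apply H. now apply bidisc_ball.
  - intros (r & Hr & H). assert (H2 : 0 < r / 2) by lra. exists (mkposreal _ H2).
    intros w Hw. apply H. apply ball_bidisc. exact Hw.
Qed.

Lemma bidisc_center z r : 0 < r -> bidisc z r z.
Proof.
  intros Hr. unfold bidisc. replace (fst z - fst z)%C with (RtoC 0) by ring.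
  replace (snd z - snd z)%C with (RtoC 0) by ring. rewrite Cmod_0. now split.
Qed.

Lemma bidisc_triangle x y z r s : bidisc x r y -> bidisc y s z -> bidisc x (r + s) z.
Proof.
  intros [A1 A2] [B1 B2]. split.
  - eapply Rle_lt_trans; [apply (Cmod_minus_triangle _ (fst y))|lra].
  - eapply Rle_lt_trans; [apply (Cmod_minus_triangle _ (snd y))|lra].
Qed.

Lemma bidisc_sym x y r : bidisc x r y -> bidisc y r x.
Proof.
  intros [A B]. split.
  - now rewrite Cmod_minus_sym.
  - now rewrite Cmod_minus_sym.
Qed.

Lemma bidisc_le x y r s : r <= s -> bidisc x r y -> bidisc x s y.
Proof. intros L [A B]. split; lra. Qed.

Lemma continuous_C2 (u : C2 -> R) z : continuous u z <->
  forall eps, 0 < eps -> exists r, 0 < r /\ forall w, bidisc z r w -> Rabs (u w - u z) < eps.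
Proof.
  unfold continuous. rewrite filterlim_locally. split.
  - intros H eps He. apply locally_C2. exact (H (mkposreal eps He)).
  - intros H eps. apply (locally_C2 z (fun w => ball (u z) eps (u w))). exact (H eps (cond_pos eps)).
Qed.

Lemma prod_norm_le (z : C2) : norm z <= Cmod (fst z) + Cmod (snd z).
Proof.
  change (norm z) with (sqrt (Cmod (fst z) ^ 2 + Cmod (snd z) ^ 2)).
  pose proof (Cmod_ge_0 (fst z)). pose proof (Cmod_ge_0 (snd z)).
  rewrite <- (sqrt_Rsqr (Cmod (fst z) + Cmod (snd z))) by lra.
  apply sqrt_le_1_alt. unfold Rsqr. nra.
Qed.

Definition holomorphic_at (f : C2 -> C) (z : C2) : Prop :=
  ex_filterdiff (K := C_AbsRing) (V := AbsRing_NormedModule C_AbsRing) f (locally z).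

(* [C_NormedModule] and [AbsRing_NormedModule C_AbsRing] differ only in their uniform structure,
   which the definition of [filterdiff] does not inspect on the target. *)
Lemma ex_filterdiff_C2 (f : C2 -> C) z :
  ex_filterdiff (K := C_AbsRing) (V := C_NormedModule) f (locally z) <-> holomorphic_at f z.
Proof. split; intros (l & [L1 L2 L3] & H); exists l; split; [now split|exact H|now split|exact H]. Qed.

Lemma holomorphic_at_continuous f z : holomorphic_at f z ->
  forall eps, 0 < eps -> exists r, 0 < r /\ forall w, bidisc z r w -> Cmod (f w - f z) < eps.
Proof.
  intros H eps He. apply filterdiff_continuous in H.
  apply (locally_C2 z (fun w => Cmod (f w - f z) < eps)).
  exact (proj1 (filterlim_locally (U := AbsRing_NormedModule C_AbsRing) f (f z)) H (mkposreal eps He)).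
Qed.

Lemma holomorphic_at_const c z : holomorphic_at (fun _ => c) z.
Proof. apply ex_filterdiff_const. Qed.

Lemma fst_holomorphic z : holomorphic_at (fun w : C2 => fst w) z.
Proof.
  apply ex_filterdiff_C2. exists (fun w : C2 => fst w). apply filterdiff_linear.
  exact (is_linear_fst (U := C_NormedModule) (V := C_NormedModule)).
Qed.

Lemma snd_holomorphic z : holomorphic_at (fun w : C2 => snd w) z.
Proof.
  apply ex_filterdiff_C2. exists (fun w : C2 => snd w). apply filterdiff_linear.
  exact (is_linear_snd (U := C_NormedModule) (V := C_NormedModule)).
Qed.

Lemma holomorphic_at_minus f g z : holomorphic_at f z -> holomorphic_at g z ->
  holomorphic_at (fun w => f w - g w)%C z.
Proof. exact (ex_filterdiff_minus_fct (V := AbsRing_NormedModule C_AbsRing) f g). Qed.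

Lemma holomorphic_at_mult f g z : holomorphic_at f z -> holomorphic_at g z ->
  holomorphic_at (fun w => f w * g w)%C z.
Proof. exact (ex_filterdiff_mult_fct (K := C_AbsRing) f g z Cmult_comm). Qed.

Lemma cdiff_ex_filterdiff f z :
  cdiff f z <-> @ex_filterdiff C_AbsRing (AbsRing_NormedModule C_AbsRing) (AbsRing_NormedModule C_AbsRing) f
    (@locally (AbsRing_UniformSpace C_AbsRing) z).
Proof.
  destruct (ex_derive_filterdiff (K := C_AbsRing) (V := AbsRing_NormedModule C_AbsRing) f z) as [H1 H2]. split.
  - intros [d D]. apply H1. exists d. now apply cder_is_derive.
  - intros H. destruct (H2 H) as [d D]. exists d. now apply cder_is_derive.
Qed.

Lemma holomorphic_at_comp (h : C -> C) f z : holomorphic_at f z -> cdiff h (f z) ->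
  holomorphic_at (fun w => h (f w)) z.
Proof.
  intros F H. apply cdiff_ex_filterdiff in H.
  exact (ex_filterdiff_comp' (V := AbsRing_NormedModule C_AbsRing) (W := AbsRing_NormedModule C_AbsRing) f h z F H).
Qed.

Lemma affine_disc_derive (p v : C2) (l : C) :
  ex_derive (K := C_AbsRing) (V := C2) (fun l : C => plus p (scal (l : C_AbsRing) v)) l.
Proof.
  apply (ex_derive_plus (K := C_AbsRing) (V := C2) (fun _ => p) (fun l : C_AbsRing => scal l v)).
  - apply ex_derive_const.
  - exists (scal (one : C_AbsRing) v). apply (is_derive_scal_l (K := C_AbsRing) (V := C2) (fun l => l)).
    apply is_derive_id.
Qed.

Lemma holomorphic_at_line f z w l : holomorphic_at f (plus z (scal (l : C_AbsRing) w)) ->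
  cdiff (fun l : C => f (plus z (scal (l : C_AbsRing) w))) l.
Proof.
  intros H. apply cdiff_ex_filterdiff.
  refine (ex_filterdiff_comp' (U := AbsRing_NormedModule C_AbsRing) (V := C2) (W := AbsRing_NormedModule C_AbsRing)
    (fun l : C => plus z (scal (l : C_AbsRing) w)) f l _ H).
  apply ex_derive_filterdiff, affine_disc_derive.
Qed.

Lemma open_C2 (U : C2 -> Prop) : open U <->
  forall z, U z -> exists r, 0 < r /\ forall w, bidisc z r w -> U w.
Proof.
  split; intros H z Hz; [apply locally_C2; now apply H|apply locally_C2; now apply H].
Qed.

(** * Compactness and connectedness in C^2 *)

Definition of_coordinates (x : Compactness.Tn 4 R) : C2 :=
  let '(a, (b, (c, (d, _)))) := x in ((a, b), (c, d)).

(** Heine-Borel by a gauge on a cube of R^4: each point gets a radius whose ball lies in one set of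
    the cover or misses [K]. A finite gauge-fine family of centers covers the cube, and the centers
    of the first kind name the subcover. *)
Lemma compact_C2 (K : C2 -> Prop) M :
  (forall z, ~ K z -> exists r, 0 < r /\ forall w, bidisc z r w -> ~ K w) ->
  (forall z, K z -> Cmod (fst z) <= M /\ Cmod (snd z) <= M) -> set_compact K.
Proof.
  intros HC HB I U HU Hcov.
  assert (D : forall z : C2, exists d : posreal,
     (exists i, forall w, ball z d w -> U i w) \/ (forall w, ball z d w -> ~ K w)).
  { intros z. destruct (classic (K z)) as [Hz|Hz].
    - destruct (Hcov z Hz) as [i Hi]. destruct (HU i z Hi) as [d Hd]. exists d. left. now exists i.
    - destruct (HC z Hz) as (r & Hr & H). assert (Hr2 : 0 < r / 2) by lra.
      exists (mkposreal _ Hr2). right. intros w Hw. apply H, ball_bidisc. exact Hw. }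
  pose (delta := fun x : Compactness.Tn 4 R => proj1_sig (constructive_indefinite_description _ (D (of_coordinates x)))).
  destruct (NNPP _ (compactness_list 4 (- M, (- M, (- M, (- M, tt)))) (M, (M, (M, (M, tt)))) delta)) as [l Hl].
  pose (pick := fun x : Compactness.Tn 4 R => match excluded_middle_informative
     (exists i, forall w, ball (of_coordinates x) (delta x) w -> U i w) with
     left H => Some (proj1_sig (constructive_indefinite_description _ H)) | right _ => None end).
  exists (flat_map (fun x => match pick x with Some i => i :: nil | None => nil end) l).
  intros z Kz. destruct (HB z Kz) as [B1 B2].
  destruct z as [[a b] [c d]]. simpl in B1, B2.
  assert (L1 := Rabs_fst_le (a, b)). assert (L2 := Rabs_snd_le (a, b)).
  assert (L3 := Rabs_fst_le (c, d)). assert (L4 := Rabs_snd_le (c, d)). simpl in L1, L2, L3, L4.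
  destruct (Hl (a, (b, (c, (d, tt))))) as (t & It & _ & Ct).
  { assert (Q : forall x, Rabs x <= M -> - M <= x <= M) by (intros x; apply Rabs_le_between).
    simpl. repeat split; apply Q; lra. }
  assert (Bt : ball (of_coordinates t) (delta t) (((a, b), (c, d)) : C2)).
  { destruct t as [a' [b' [c' [d' []]]]]. simpl in Ct. destruct Ct as (C1 & C2 & C3 & C4 & _).
    repeat split; assumption. }
  assert (Ex : exists i, forall w, ball (of_coordinates t) (delta t) w -> U i w).
  { unfold delta in *. destruct (constructive_indefinite_description _ (D (of_coordinates t))) as [dd [E|E]]; [exact E|].
    exfalso. exact (E _ Bt Kz). }
  destruct (pick t) as [i|] eqn:Ep.
  - exists i. split.
    + apply in_flat_map. exists t. split; [exact It|]. rewrite Ep. now left.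
    + unfold pick in Ep. destruct (excluded_middle_informative _) as [H|H]; [|discriminate].
      injection Ep as <-. apply (proj2_sig (constructive_indefinite_description _ H)). exact Bt.
  - unfold pick in Ep. destruct (excluded_middle_informative _) as [H|H]; [discriminate|contradiction].
Qed.

Lemma not_bidisc_open (p : C2) r : 
  open (fun w : C2 => exists s, r < s /\ (s < Cmod (fst w - fst p) \/ s < Cmod (snd w - snd p))).
Proof.
  apply open_C2. intros z (s & Hs & Hz). set (m := (r + s) / 2).
  exists (s - m). split; [unfold m; lra|]. intros w [W1 W2]. exists m. split; [unfold m; lra|].
  destruct Hz as [Hz|Hz]; [left|right].
  - assert (T := Cmod_minus_triangle (fst z) (fst w) (fst p)). rewrite (Cmod_minus_sym (fst z) (fst w)) in T. lra.
  - assert (T := Cmod_minus_triangle (snd z) (snd w) (snd p)). rewrite (Cmod_minus_sym (snd z) (snd w)) in T. lra.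
Qed.

(** Compact sets are closed: were [p] outside [K], the complements of the closed bidiscs of radius
    [1 / (n + 1)] about [p] would cover [K], and a finite subcover would keep [K] away from [p]. *)
Lemma compact_adherent (K : C2 -> Prop) p : set_compact K ->
  (forall e, 0 < e -> exists w, K w /\ bidisc p e w) -> K p.
Proof.
  intros HK H. apply NNPP. intros N.
  destruct (HK nat (fun n (w : C2) => exists s, / (INR n + 1) < s /\ (s < Cmod (fst w - fst p) \/ s < Cmod (snd w - snd p)))) as [l Hl].
  - intros n. apply not_bidisc_open.
  - intros z Kz.
    assert (Q : 0 < Cmod (fst z - fst p) \/ 0 < Cmod (snd z - snd p)).
    { apply NNPP. intros Q. apply N. replace p with z; [exact Kz|].
      assert (X : Cmod (fst z - fst p) = 0) by (pose proof (Cmod_ge_0 (fst z - fst p)); apply Rle_antisym; [apply Rnot_lt_le; tauto|lra]).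
      assert (Y : Cmod (snd z - snd p) = 0) by (pose proof (Cmod_ge_0 (snd z - snd p)); apply Rle_antisym; [apply Rnot_lt_le; tauto|lra]).
      apply Cmod_eq_0 in X. apply Cmod_eq_0 in Y.
      assert (SUB : forall a b : C, (a - b = 0)%C -> a = b).
      { intros a b E. replace a with ((a - b) + b)%C by ring. rewrite E. ring. }
      apply injective_projections; now apply SUB. }
    assert (G : forall x, 0 < x -> exists n, / (INR n + 1) < x / 2 < x).
    { intros x Hx. destruct (archimed_cor1 (x / 2)) as (n & Hn & Hn0); [lra|]. exists n.
      assert (0 < INR n) by now apply lt_0_INR.
      assert (/ (INR n + 1) < / INR n) by (apply Rinv_lt_contravar; nra). lra. }
    destruct Q as [Q|Q]; destruct (G _ Q) as (n & n1 & n2); exists n; eexists; split; eauto.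
  - assert (G : exists e, 0 < e /\ forall n, In n l -> e <= / (INR n + 1)).
    { clear. induction l as [|n l (e & He & IH)].
      - exists 1. split; [lra|]. intros n [].
      - exists (Rmin e (/ (INR n + 1))). split.
        + apply Rmin_pos; [exact He|]. apply Rinv_0_lt_compat. pose proof (pos_INR n). lra.
        + intros m [<-|Hm]; [apply Rmin_r|]. eapply Rle_trans; [apply Rmin_l|]. now apply IH. }
    destruct G as (e & He & G). destruct (H e He) as (w & Kw & [B1 B2]).
    destruct (Hl w Kw) as (n & In_n & s & Hs & Hw). specialize (G n In_n). destruct Hw; lra.
Qed.

Lemma interval_connected (U W : R -> Prop) : 
  (forall t, U t -> exists e, 0 < e /\ forall s, Rabs (s - t) < e -> U s) ->
  (forall t, W t -> exists e, 0 < e /\ forall s, Rabs (s - t) < e -> W s) ->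
  (forall t, 0 <= t <= 1 -> U t \/ W t) -> U 0 -> W 1 -> exists t, 0 <= t <= 1 /\ U t /\ W t.
Proof.
  intros HU HW Hc U0 W1. apply NNPP. intros N.
  pose (E := fun t => 0 <= t <= 1 /\ forall s, 0 <= s <= t -> U s).
  destruct (completeness E) as (m & Hub & Hlub).
  - exists 1. intros t [Ht _]. lra.
  - exists 0. split; [lra|]. intros s Hs. replace s with 0 by lra. exact U0.
  - assert (M0 : 0 <= m). { apply Hub. split; [lra|]. intros s Hs. replace s with 0 by lra. exact U0. }
    assert (M1 : m <= 1). { apply Hlub. intros t [Ht _]. lra. }
    assert (Near : forall e, 0 < e -> exists t, E t /\ m - e < t).
    { intros e He. apply NNPP. intros N2. assert (m <= m - e); [|lra].
      apply Hlub. intros t Et. apply Rnot_lt_le. intros L. apply N2. now exists t. }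
    destruct (Hc m (conj M0 M1)) as [Um|Wm].
    + destruct (HU m Um) as (e & He & H).
      destruct (Req_dec m 1) as [->|N1]; [apply N; exists 1; repeat split; auto; lra|].
      set (x := Rmin 1 (m + e / 2)).
      assert (Hx : m < x) by (apply Rmin_glb_lt; lra).
      assert (X1 := Rmin_l 1 (m + e / 2)). assert (X2 := Rmin_r 1 (m + e / 2)). fold x in X1, X2.
      assert (x <= m); [|lra]. apply Hub. split; [lra|]. intros s Hs.
      destruct (Rlt_le_dec (m - e) s) as [L|L]; [apply H; apply Rabs_def1; lra|].
      destruct (Near e He) as (t & Et & Ht). apply Et. lra.
    + destruct (HW m Wm) as (e & He & H). destruct (Near e He) as (t & [Et1 Et2] & Ht).
      apply N. exists t. repeat split; try lra; [apply Et2; lra|].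
      apply H. assert (t <= m) by (apply Hub; now split). apply Rabs_def1; lra.
Qed.

Definition seg (z w : C2) (t : R) : C2 := plus z (scal (RtoC t : C_AbsRing) w).

Lemma seg_coordinates z w t : fst (seg z w t) = (fst z + RtoC t * fst w)%C /\ snd (seg z w t) = (snd z + RtoC t * snd w)%C.
Proof. now split. Qed.

Lemma seg_continuous z w t r : 0 < r -> exists e, 0 < e /\ forall s, Rabs (s - t) < e -> bidisc (seg z w t) r (seg z w s).
Proof.
  intros Hr. set (K := Cmod (fst w) + Cmod (snd w) + 1).
  pose proof (Cmod_ge_0 (fst w)). pose proof (Cmod_ge_0 (snd w)).
  exists (r / K). split; [apply Rdiv_lt_0_compat; unfold K; lra|].
  intros s Hs. assert (KP : 0 < K) by (unfold K; lra).
  apply Rmult_lt_compat_r with (r := K) in Hs; [|exact KP].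
  unfold Rdiv in Hs. rewrite Rmult_assoc, Rinv_l in Hs by lra. unfold K in Hs.
  pose proof (Rabs_pos (s - t)).
  assert (E : forall a b : C, (a + RtoC s * b - (a + RtoC t * b) = RtoC (s - t) * b)%C).
  { intros. rewrite RtoC_minus. ring. }
  split.
  - rewrite (proj1 (seg_coordinates z w s)), (proj1 (seg_coordinates z w t)), E, Cmod_mult, Cmod_R. nra.
  - rewrite (proj2 (seg_coordinates z w s)), (proj2 (seg_coordinates z w t)), E, Cmod_mult, Cmod_R. nra.
Qed.

Lemma seg_crossing (U W : C2 -> Prop) z w : open U -> open W ->
  (forall t, 0 <= t <= 1 -> U (seg z w t) \/ W (seg z w t)) -> U (seg z w 0) -> W (seg z w 1) ->
  exists t, 0 <= t <= 1 /\ U (seg z w t) /\ W (seg z w t).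
Proof.
  intros HU HW Hc U0 W1.
  apply (interval_connected (fun t => U (seg z w t)) (fun t => W (seg z w t))); try assumption.
  - intros t Ht. destruct (proj1 (open_C2 U) HU _ Ht) as (r & Hr & H).
    destruct (seg_continuous z w t r Hr) as (e & He & F). exists e. split; [exact He|]. intros s Hs. now apply H, F.
  - intros t Ht. destruct (proj1 (open_C2 W) HW _ Ht) as (r & Hr & H).
    destruct (seg_continuous z w t r Hr) as (e & He & F). exists e. split; [exact He|]. intros s Hs. now apply H, F.
Qed.

Lemma C2_ext (z w : C2) : (fst z : C) = fst w -> (snd z : C) = snd w -> z = w.
Proof. apply injective_projections. Qed.

Lemma plus_scal_0 (z w : C2) : plus z (scal (RtoC 0 : C_AbsRing) w) = z.
Proof.
  assert (Q : forall a b : C, (a + 0 * b = a)%C) by (intros; ring).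
  apply C2_ext; [exact (Q (fst z) (fst w))|exact (Q (snd z) (snd w))].
Qed.

Lemma seg_0 z w : seg z w 0 = z.
Proof. apply plus_scal_0. Qed.

Lemma seg_difference z w : seg z (minus w z) 1 = w.
Proof.
  assert (Q : forall a b : C, (a + 1 * (b - a) = b)%C) by (intros; ring).
  apply C2_ext; [exact (Q (fst z) (fst w))|exact (Q (snd z) (snd w))].
Qed.

Definition origin : C2 := (RtoC 0, RtoC 0).

Lemma seg_origin z t : seg origin z t = scal (RtoC t : C_AbsRing) z.
Proof.
  assert (Q : forall a : C, (0 + a = a)%C) by (intros; ring).
  apply C2_ext; [exact (Q (RtoC t * fst z)%C)|exact (Q (RtoC t * snd z)%C)].
Qed.

(** Balanced sets are star-shaped about the origin. Whichever open set contains the origin, the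
    segment from there to a point of the other one meets both. *)
Lemma balanced_connected (G : C2 -> Prop) : balanced G -> set_connected G.
Proof.
  intros HG U W HU HW Hc (z & Gz & Uz) (w & Gw & Ww).
  assert (S : forall z t, G z -> 0 <= t <= 1 -> G (seg origin z t)).
  { intros x t Gx Ht. rewrite seg_origin. apply HG; [|exact Gx]. rewrite Cmod_R, Rabs_pos_eq; lra. }
  assert (S1 : forall x, seg origin x 1 = x).
  { intros x. rewrite seg_origin. apply (scal_one (K := C_AbsRing)). }
  destruct (Hc (seg origin z 0)) as [U0|W0]; [apply S; [exact Gz|lra]| |].
  - rewrite seg_0 in U0. destruct (seg_crossing U W origin w) as (t & Ht & A & B); auto.
    + now rewrite seg_0.
    + now rewrite S1.
    + exists (seg origin w t). auto.
  - rewrite seg_0 in W0. destruct (seg_crossing W U origin z) as (t & Ht & A & B); auto.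
    + intros t Ht. destruct (Hc (seg origin z t)); auto.
    + now rewrite seg_0.
    + now rewrite S1.
    + exists (seg origin z t). auto.
Qed.

Lemma seg_connected z w : set_connected (fun y => exists t, 0 <= t <= 1 /\ y = seg z w t).
Proof.
  intros U W HU HW Hc (y1 & (t1 & Ht1 & ->) & U1) (y2 & (t2 & Ht2 & ->) & W2).
  set (p := seg z w t1). set (v := scal (RtoC (t2 - t1) : C_AbsRing) w).
  assert (E : forall t, seg p v t = seg z w (t1 + t * (t2 - t1))).
  { intros t.
    assert (Q : forall a b : C, ((a + RtoC t1 * b) + RtoC t * (RtoC (t2 - t1) * b) = a + RtoC (t1 + t * (t2 - t1)) * b)%C).
    { intros. rewrite RtoC_plus, RtoC_mult, RtoC_minus. ring. }
    apply C2_ext; [exact (Q (fst z) (fst w))|exact (Q (snd z) (snd w))]. }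
  assert (I : forall t, 0 <= t <= 1 -> 0 <= t1 + t * (t2 - t1) <= 1).
  { intros t Ht. nra. }
  destruct (seg_crossing U W p v HU HW) as (t & Ht & A & B).
  - intros t Ht. rewrite E. apply Hc. eauto.
  - rewrite seg_0. exact U1.
  - rewrite E. replace (t1 + 1 * (t2 - t1)) with t2 by ring. exact W2.
  - exists (seg p v t). split; [|auto]. rewrite E. eauto.
Qed.

(** Otherwise [O] and the interior of its complement would separate [S]. It produces the point at
    which a continuation leaves the set where it is known to agree. *)
Lemma connected_escape (S O : C2 -> Prop) : set_connected S -> open O ->
  (exists z, S z /\ O z) -> (exists z, S z /\ ~ O z) ->
  exists p, S p /\ ~ O p /\ forall r, 0 < r -> exists w, O w /\ bidisc p r w.
Proof.
  intros HS HO H1 (z & Sz & Oz). apply NNPP. intros N.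
  pose (X := fun p : C2 => exists r, 0 < r /\ forall w, bidisc p r w -> ~ O w).
  assert (HX : open X).
  { apply open_C2. intros p (r & Hr & H). exists (r / 2). split; [lra|]. intros w Hw.
    exists (r / 2). split; [lra|]. intros v Hv. apply H.
    replace r with (r / 2 + r / 2) by field. eapply bidisc_triangle; eauto. }
  assert (D : forall p, S p -> O p \/ X p).
  { intros p Sp. destruct (classic (O p)) as [|NO]; [now left|right].
    apply NNPP. intros NX. apply N. exists p. split; [exact Sp|split; [exact NO|]].
    intros r Hr. apply NNPP. intros M. apply NX. exists r. split; [exact Hr|]. intros w Hw Ow. apply M. now exists w. }
  destruct (HS O X HO HX D H1) as (p & Sp & Op & r & Hr & Xp).
  - exists z. split; [exact Sz|]. destruct (D z Sz); tauto.
  - apply (Xp p); [now apply bidisc_center|exact Op].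
Qed.

(** * Domains defined by families of homogeneous polynomials *)

(** For the polynomials used below, the first clause cuts the axis only down to the closed unit
    disc, since [|P|] at [(u, 0)] is [scale N * |u| ^ m N]. The second clause removes the unit
    circle, without which the set would not be open. *)
Definition hull (P : nat -> C2 -> C) (z : C2) : Prop :=
  (forall n, Cmod (P n z) < 1) /\ (snd z = RtoC 0 -> Cmod (fst z) < 1).

(* [wt n] is a weight making [wt n * Cmod (P n)] large on the part of the axis
   [snd z = 0] outside the unit disc, but locally small on the hull. *)
Record defining_family (P : nat -> C2 -> C) (deg : nat -> nat) (wt : nat -> R) : Prop := {
  family_holomorphic : forall n z, holomorphic_at (P n) z;
  family_homogeneous : forall n (l : C) z, P n (scal (l : C_AbsRing) z) = (Cpow l (deg n) * P n z)%C;
  family_degree : forall n, (1 <= deg n)%nat;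
  family_weight : forall n, 1 <= wt n;
  family_locally_small : forall z, hull P z -> exists r N, 0 < r /\
    forall w n, bidisc z r w -> (N <= n)%nat -> wt n * Cmod (P n w) <= (1 / 2) ^ n;
  family_bounded : exists M, forall z, hull P z -> Cmod (fst z) <= M /\ Cmod (snd z) <= M;
  family_axis_outside : forall x, 1 < Cmod x -> exists n, 1 < Cmod (P n ((x, RtoC 0) : C2));
  family_axis_unbounded : forall x c, 1 <= Cmod x -> exists n, c < wt n * Cmod (P n ((x, RtoC 0) : C2)) }.

Lemma bidisc_scal (l : C) z w r : 0 < r -> bidisc z (r / (Cmod l + 1)) w ->
  bidisc (scal (l : C_AbsRing) z) r (scal (l : C_AbsRing) w).
Proof.
  intros Hr [A B]. pose proof (Cmod_ge_0 l).
  assert (Q : forall a b : C, Cmod (b - a) < r / (Cmod l + 1) -> Cmod (l * b - l * a) < r).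
  { intros a b Hab. replace (l * b - l * a)%C with (l * (b - a))%C by ring. rewrite Cmod_mult.
    apply Rlt_div_r in Hab; [|lra].
    pose proof (Cmod_ge_0 (b - a)). nra. }
  split; [exact (Q (fst z) (fst w) A)|exact (Q (snd z) (snd w) B)].
Qed.

Section Hull.
Variables (P : nat -> C2 -> C) (deg : nat -> nat) (wt : nat -> R).
Hypothesis HP : defining_family P deg wt.
Let G := hull P.

Lemma hull_origin : G origin.
Proof.
  split.
  - intros n. replace origin with (scal (RtoC 0 : C_AbsRing) origin : C2).
    + rewrite (family_homogeneous _ _ _ HP), Cmod_mult, Cmod_pow, Cmod_0.
      rewrite pow_i; [lra|]. exact (family_degree _ _ _ HP n).
    + assert (Q : (0 * 0 = RtoC 0)%C) by ring. apply C2_ext; exact Q.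
  - intros _. simpl. rewrite Cmod_0. lra.
Qed.

Lemma hull_finite_part z N : G z -> exists r, 0 < r /\
  forall w, bidisc z r w -> forall n, (n < N)%nat -> Cmod (P n w) < 1.
Proof.
  intros [Hz _]. induction N as [|N (r & Hr & IH)].
  - exists 1. split; [lra|]. intros; lia.
  - destruct (holomorphic_at_continuous _ z (family_holomorphic _ _ _ HP N z) (1 - Cmod (P N z))) as (s & Hs & D).
    { specialize (Hz N). lra. }
    exists (Rmin r s). split; [now apply Rmin_pos|]. intros w Hw n Hn.
    destruct (Nat.eq_dec n N) as [->|Ne].
    + specialize (D w (bidisc_le _ _ _ _ (Rmin_r _ _) Hw)).
      assert (T := Cmod_le_near (P N w) (P N z)). lra.
    + apply (IH w (bidisc_le _ _ _ _ (Rmin_l _ _) Hw)). lia.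
Qed.

Lemma Cmod_pos_of_neq (z : C) : z <> RtoC 0 -> 0 < Cmod z.
Proof. apply Cmod_gt_0. Qed.

Lemma hull_open : open G.
Proof.
  apply open_C2. intros z Gz.
  destruct (family_locally_small _ _ _ HP z Gz) as (r1 & N & Hr1 & H1).
  destruct (hull_finite_part z (S N) Gz) as (r2 & Hr2 & H2).
  assert (H3 : exists r3, 0 < r3 /\ forall w, bidisc z r3 w -> snd w = RtoC 0 -> Cmod (fst w) < 1).
  { destruct (Ceq_dec (snd z) 0) as [E|NE].
    - assert (L := proj2 Gz E). exists (1 - Cmod (fst z)). split; [lra|]. intros w [W _] _.
      assert (T := Cmod_le_near (fst w) (fst z)). lra.
    - exists (Cmod (snd z)). split; [now apply Cmod_pos_of_neq|]. intros w [_ W] E.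
      rewrite E in W.
      assert (Q : forall a : C, (0 - a = - a)%C) by (intros; ring).
      rewrite Q, Cmod_opp in W. lra. }
  destruct H3 as (r3 & Hr3 & H3).
  exists (Rmin r1 (Rmin r2 r3)). split; [repeat apply Rmin_pos; assumption|]. intros w Hw.
  assert (W1 := bidisc_le _ _ _ _ (Rmin_l _ _) Hw). assert (W2 := bidisc_le _ _ _ _ (Rmin_r _ _) Hw).
  split; [|apply H3; exact (bidisc_le _ _ _ _ (Rmin_r _ _) W2)].
  intros n. destruct (Compare_dec.le_lt_dec (S N) n) as [L|L].
  - specialize (H1 w n W1 ltac:(lia)). assert (A := family_weight _ _ _ HP n).
    assert (Q : (1 / 2) ^ n < 1). { apply pow_lt_1_compat; [lra|lia]. }
    pose proof (Cmod_ge_0 (P n w)). nra.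
  - apply (H2 w (bidisc_le _ _ _ _ (Rmin_l _ _) W2)). exact L.
Qed.

Lemma hull_balanced : balanced G.
Proof.
  intros l z Hl [H1 H2]. split.
  - intros n. rewrite (family_homogeneous _ _ _ HP), Cmod_mult, Cmod_pow.
    specialize (H1 n). pose proof (Cmod_ge_0 (P n z)). pose proof (Cmod_ge_0 l).
    assert (Cmod l ^ deg n <= 1) by (rewrite <- (pow1 (deg n)); apply pow_incr; lra).
    assert (0 <= Cmod l ^ deg n) by (apply pow_le; lra). nra.
  - intros E. change ((l * snd z)%C = RtoC 0) in E. change (Cmod (l * fst z) < 1). rewrite Cmod_mult.
    destruct (Ceq_dec (snd z) 0) as [Z|Z].
    + specialize (H2 Z). pose proof (Cmod_ge_0 l). pose proof (Cmod_ge_0 (fst z)). nra.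
    + assert (L : l = RtoC 0).
      { apply NNPP. intros NL. now apply (Cmult_neq_0 l (snd z)). }
      rewrite L, Cmod_0. lra.
Qed.

Lemma hull_domain : is_domain G.
Proof.
  split; [exists origin; apply hull_origin|split; [apply hull_open|]].
  apply balanced_connected, hull_balanced.
Qed.

Lemma hull_bounded : bounded_set G.
Proof.
  destruct (family_bounded _ _ _ HP) as [M HM]. exists (M + M). intros z Gz.
  destruct (HM z Gz). eapply Rle_trans; [apply prod_norm_le|]. lra.
Qed.

(** A point can lie outside the hull without a neighborhood outside it, for instance by failing only
    the axis clause. Any dilation by more than 1 turns this into one strict polynomial inequality,
    which is an open condition; lower semicontinuity of the Minkowski function depends on it. *)
Lemma hull_dilate_exterior z t : ~ G z -> 1 < t -> exists n, 1 < Cmod (P n (scal (RtoC t : C_AbsRing) z)).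
Proof.
  intros NG Ht. destruct (classic (exists n, 1 <= Cmod (P n z))) as [[n Hn]|N].
  - exists n. rewrite (family_homogeneous _ _ _ HP), Cmod_mult, Cmod_pow, Cmod_R, Rabs_pos_eq by lra.
    assert (1 < t ^ deg n).
    { apply Rlt_pow_R1; [exact Ht|]. exact (family_degree _ _ _ HP n). }
    nra.
  - assert (E : snd z = RtoC 0 /\ 1 <= Cmod (fst z)).
    { apply NNPP. intros M. apply NG. split.
      - intros n. apply Rnot_le_lt. intros L. apply N. now exists n.
      - intros E. apply Rnot_le_lt. intros L. now apply M. }
    destruct E as [E1 E2].
    destruct (family_axis_outside _ _ _ HP (RtoC t * fst z)%C) as [n Hn].
    { rewrite Cmod_mult, Cmod_R, Rabs_pos_eq by lra. nra. }
    exists n. replace (scal (RtoC t : C_AbsRing) z) with (((RtoC t * fst z)%C, RtoC 0) : C2); [exact Hn|].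
    assert (Q : (RtoC 0 = RtoC t * snd z)%C) by (rewrite E1; ring).
    apply C2_ext; [reflexivity|exact Q].
Qed.

Lemma hull_exterior_open n z : 1 < Cmod (P n z) -> exists r, 0 < r /\ forall w, bidisc z r w -> ~ G w.
Proof.
  intros H. destruct (holomorphic_at_continuous _ z (family_holomorphic _ _ _ HP n z) (Cmod (P n z) - 1)) as (s & Hs & D); [lra|].
  exists s. split; [exact Hs|]. intros w Hw [Gw _]. specialize (D w Hw). specialize (Gw n).
  assert (T := Cmod_ge_near (P n w) (P n z)). lra.
Qed.

Definition dilations (z : C2) (t : R) : Prop := 0 < t /\ G (scal (RtoC (/ t) : C_AbsRing) z).

Lemma dilations_up z s t : dilations z s -> s <= t -> dilations z t.
Proof.
  intros [Hs Gs] L. split; [lra|].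
  replace (scal (RtoC (/ t) : C_AbsRing) z) with (scal (RtoC (s / t) : C_AbsRing) (scal (RtoC (/ s) : C_AbsRing) z)).
  - apply hull_balanced; [|exact Gs].
    assert (0 <= s / t <= 1).
    { split; [apply Rdiv_le_0_compat; lra|]. apply Rle_div_l; [lra|]. lra. }
    rewrite Cmod_R, Rabs_pos_eq; lra.
  - rewrite scal_assoc. f_equal. change (RtoC (s / t) * RtoC (/ s) = RtoC (/ t))%C.
    rewrite <- RtoC_mult. f_equal. field. lra.
Qed.

Lemma dilations_exist z : exists t, dilations z t.
Proof.
  destruct (proj1 (open_C2 G) hull_open origin hull_origin) as (r & Hr & H).
  set (K := Cmod (fst z) + Cmod (snd z) + 1).
  pose proof (Cmod_ge_0 (fst z)). pose proof (Cmod_ge_0 (snd z)).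
  assert (KP : 0 < K) by (unfold K; lra).
  exists (K / r). assert (TP : 0 < K / r) by now apply Rdiv_lt_0_compat. split; [exact TP|].
  apply H. assert (E : / (K / r) = r / K) by (field; lra). rewrite E.
  assert (Q : forall a : C, Cmod a < K -> Cmod (RtoC (r / K) * a - 0) < r).
  { intros a Ha. replace (RtoC (r / K) * a - 0)%C with (RtoC (r / K) * a)%C by ring.
    rewrite Cmod_mult, Cmod_R, Rabs_pos_eq by (apply Rdiv_le_0_compat; lra).
    apply Rlt_le_trans with (r / K * K).
    - apply Rmult_lt_compat_l; [now apply Rdiv_lt_0_compat|exact Ha].
    - right; field; lra. }
  split; [refine (Q (fst z) _)|refine (Q (snd z) _)]; unfold K; lra.
Qed.

Lemma minkowski_glb z : is_glb_Rbar (dilations z) (Finite (minkowski G z)).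
Proof.
  unfold minkowski. destruct (Glb_Rbar_correct (dilations z)) as [H1 H2].
  assert (E : Glb_Rbar (dilations z) = Finite (real (Glb_Rbar (dilations z)))).
  { destruct (Glb_Rbar (dilations z)) as [x| |]; [reflexivity| |].
    - destruct (dilations_exist z) as [t Ht]. destruct (H1 t Ht).
    - assert (B : is_lb_Rbar (dilations z) (Finite 0)) by (intros t [Ht _]; simpl; lra).
      destruct (H2 _ B). }
  change (is_glb_Rbar (dilations z) (Finite (real (Glb_Rbar (dilations z))))).
  rewrite <- E. split; assumption.
Qed.

Lemma minkowski_continuous z : continuous (minkowski G) z.
Proof.
  apply continuous_C2. intros eps He.
  destruct (minkowski_glb z) as [Z1 Z2]. set (h := minkowski G z) in *.
  assert (Up : exists r, 0 < r /\ forall w, bidisc z r w -> minkowski G w < h + eps).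
  { assert (X : exists t, dilations z t /\ t < h + eps).
    { apply NNPP. intros N. assert (B : is_lb_Rbar (dilations z) (Finite (h + eps))).
      { intros t Ht. simpl. apply Rnot_lt_le. intros L. apply N. now exists t. }
      specialize (Z2 _ B). simpl in Z2. lra. }
    destruct X as (t & [T0 Gt] & Lt).
    destruct (proj1 (open_C2 G) hull_open _ Gt) as (r & Hr & H).
    pose proof (Cmod_ge_0 (RtoC (/ t))).
    exists (r / (Cmod (RtoC (/ t)) + 1)). split; [apply Rdiv_lt_0_compat; lra|].
    intros w Hw. destruct (minkowski_glb w) as [W1 _].
    assert (D : dilations w t) by (split; [exact T0|apply H; now apply bidisc_scal]).
    specialize (W1 t D). simpl in W1. lra. }
  assert (Low : exists r, 0 < r /\ forall w, bidisc z r w -> h - eps < minkowski G w).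
  { destruct (Rlt_le_dec (h - eps) 0) as [L|L].
    - exists 1. split; [lra|]. intros w _. destruct (minkowski_glb w) as [_ W2].
      assert (B : is_lb_Rbar (dilations w) (Finite 0)) by (intros t [Ht _]; simpl; lra).
      specialize (W2 _ B). simpl in W2. lra.
    (* Two levels [c2 < c1 < h]: [z / c1] is outside [G], so its dilation [z / c2] is outside
       together with a neighborhood, and nearby points have Minkowski value at least
       [c2 > h - eps]. *)
    - set (c1 := h - eps / 3). set (c2 := h - eps / 2).
      assert (N1 : ~ G (scal (RtoC (/ c1) : C_AbsRing) z)).
      { intros Gc. assert (D : dilations z c1) by (split; [unfold c1; lra|exact Gc]).
        specialize (Z1 c1 D). simpl in Z1. unfold c1 in Z1. lra. }
      destruct (hull_dilate_exterior _ (c1 / c2) N1) as [n Hn].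
      { apply Rlt_div_r; [unfold c2; lra|]. unfold c1, c2; lra. }
      rewrite scal_assoc in Hn.
      assert (E : mult (RtoC (c1 / c2) : C_AbsRing) (RtoC (/ c1) : C_AbsRing) = RtoC (/ c2)).
      { change (RtoC (c1 / c2) * RtoC (/ c1) = RtoC (/ c2))%C. rewrite <- RtoC_mult. f_equal.
        field. unfold c1, c2. lra. }
      rewrite E in Hn. destruct (hull_exterior_open n _ Hn) as (r & Hr & H).
      pose proof (Cmod_ge_0 (RtoC (/ c2))).
      exists (r / (Cmod (RtoC (/ c2)) + 1)). split; [apply Rdiv_lt_0_compat; lra|].
      intros w Hw. destruct (minkowski_glb w) as [_ W2].
      assert (B : is_lb_Rbar (dilations w) (Finite c2)).
      { intros t Dt. simpl. apply Rnot_lt_le. intros Lt.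
        apply (H (scal (RtoC (/ c2) : C_AbsRing) w)); [now apply bidisc_scal|].
        apply (dilations_up w t c2 Dt). lra. }
      specialize (W2 _ B). simpl in W2. unfold c2 in W2. lra. }
  destruct Up as (r1 & Hr1 & U). destruct Low as (r2 & Hr2 & L).
  exists (Rmin r1 r2). split; [now apply Rmin_pos|]. intros w Hw.
  specialize (U w (bidisc_le _ _ _ _ (Rmin_l _ _) Hw)). specialize (L w (bidisc_le _ _ _ _ (Rmin_r _ _) Hw)).
  apply Rabs_def1; lra.
Qed.
End Hull.

(** * Domains of holomorphy *)

(** One-variable identity theorem on the complex line through [z] and [v], parametrized so that [v]
    is reached at a parameter [c < 1] and the whole unit disc still stays in the bidisc. *)
Lemma identity_bidisc (g : C2 -> C) z r e : 0 < e ->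
  (forall w, bidisc z r w -> holomorphic_at g w) ->
  (forall w, bidisc z e w -> g w = RtoC 0) -> forall w, bidisc z r w -> g w = RtoC 0.
Proof.
  intros He Hg H0 v [V1 V2].
  pose proof (Cmod_ge_0 (fst v - fst z)). pose proof (Cmod_ge_0 (snd v - snd z)).
  set (m := Rmax (Cmod (fst v - fst z)) (Cmod (snd v - snd z))).
  assert (M1 : Cmod (fst v - fst z) <= m) by apply Rmax_l.
  assert (M2 : Cmod (snd v - snd z) <= m) by apply Rmax_r.
  assert (Mr : m < r) by now apply Rmax_lub_lt.
  set (c := (r + m) / (2 * r)).
  assert (Hc : 0 < c < 1).
  { unfold c; split; [apply Rdiv_lt_0_compat; lra|]. apply Rlt_div_l; [lra|]. lra. }
  assert (Hcr : m < c * r) by (unfold c; replace ((r + m) / (2 * r) * r) with ((r + m) / 2) by (field; lra); lra).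
  set (dir := scal (RtoC (/ c) : C_AbsRing) (minus v z)).
  assert (Q : forall (l a b : C) , (b + l * (RtoC (/ c) * a) - b = l * RtoC (/ c) * a)%C) by (intros; ring).
  assert (IN : forall l s, Cmod l * m < c * s -> bidisc z s (plus z (scal (l : C_AbsRing) dir))).
  { intros l s Hl. pose proof (Cmod_ge_0 l).
    assert (X : forall a b : C, Cmod a <= m -> Cmod (b + l * (RtoC (/ c) * a) - b) < s).
    { intros a b Ha. rewrite Q, !Cmod_mult, Cmod_R, Rabs_pos_eq by (left; apply Rinv_0_lt_compat; lra).
      apply Rle_lt_trans with (Cmod l * / c * m).
      - apply Rmult_le_compat_l; [|exact Ha]. apply Rmult_le_pos; [lra|left; apply Rinv_0_lt_compat; lra].
      - apply Rmult_lt_reg_l with c; [lra|]. replace (c * (Cmod l * / c * m)) with (Cmod l * m) by (field; lra). exact Hl. }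
    split; [exact (X (fst v - fst z)%C (fst z) M1)|exact (X (snd v - snd z)%C (snd z) M2)]. }
  assert (E := identity_disc (fun l => g (plus z (scal (l : C_AbsRing) dir))) (c * e / (m + 1))).
  assert (m0 : 0 <= m) by lra.
  specialize (E ltac:(apply Rdiv_lt_0_compat; [apply Rmult_lt_0_compat; lra|lra])).
  assert (A1 : forall l : C, Cmod l < 1 -> cdiff (fun l : C => g (plus z (scal (l : C_AbsRing) dir))) l).
  { intros l Hl. apply holomorphic_at_line, Hg, IN. pose proof (Cmod_ge_0 l). nra. }
  assert (A2 : forall l : C, Cmod l < c * e / (m + 1) -> g (plus z (scal (l : C_AbsRing) dir)) = RtoC 0).
  { intros l Hl. apply H0, IN. pose proof (Cmod_ge_0 l).
    apply Rlt_div_r in Hl; [|lra]. lra. }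
  specialize (E A1 A2 (RtoC c)). cbv beta in E.
  rewrite Cmod_R, Rabs_pos_eq in E by lra. specialize (E (proj2 Hc)).
  rewrite <- E. f_equal.
  assert (CN : RtoC c <> RtoC 0) by (intros F; apply RtoC_inj in F; lra).
  assert (Z : forall a b : C, (a = b + RtoC c * (RtoC (/ c) * (a - b)))%C).
  { intros a b. rewrite RtoC_inv by lra. field. exact CN. }
  apply C2_ext; [exact (Z (fst v) (fst z))|exact (Z (snd v) (snd z))].
Qed.

Lemma holomorphic_on_at (U : C2 -> Prop) f z : holomorphic_on U f -> U z -> holomorphic_at f z.
Proof. intros H Hz. apply ex_filterdiff_C2. now apply H. Qed.

Lemma holomorphic_on_intro (U : C2 -> Prop) f : (forall z, U z -> holomorphic_at f z) -> holomorphic_on U f.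
Proof. intros H z Hz. apply ex_filterdiff_C2. now apply H. Qed.

Section DomainOfHolomorphy.
Variables (P : nat -> C2 -> C) (deg : nat -> nat) (wt : nat -> R).
Hypothesis HP : defining_family P deg wt.
Let G := hull P.
Variables (U W : C2 -> Prop).
Hypothesis HU : open U.
Hypothesis HW : open W.
Hypothesis HWUG : forall z, W z -> U z /\ G z.
Hypothesis Hext : forall f : C2 -> C, holomorphic_on G f ->
  exists F : C2 -> C, holomorphic_on U F /\ forall z, W z -> F z = f z.

(** Quantified over all functions and all their extensions at once, because the function that yields
    a contradiction is chosen only after a boundary point of this set has been found. *)
Definition agreement_set (z : C2) : Prop := exists r, 0 < r /\
  (forall v, bidisc z r v -> U v /\ G v) /\
  forall f F, holomorphic_on G f -> holomorphic_on U F -> (forall z, W z -> F z = f z) ->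
    forall v, bidisc z r v -> F v = f v.

Lemma agreement_open : open agreement_set.
Proof.
  apply open_C2. intros z (r & Hr & H1 & H2). exists (r / 2). split; [lra|]. intros w Hw.
  assert (I : forall v, bidisc w (r / 2) v -> bidisc z r v).
  { intros v Hv. replace r with (r / 2 + r / 2) by field. eapply bidisc_triangle; eauto. }
  exists (r / 2). split; [lra|split]; [intros v Hv; now apply H1, I|].
  intros f F Hf HF E v Hv. apply (H2 f F Hf HF E). now apply I.
Qed.

Lemma agreement_contains z : W z -> agreement_set z.
Proof.
  intros Wz. destruct (proj1 (open_C2 W) HW z Wz) as (r & Hr & H).
  exists r. split; [exact Hr|split]; [intros v Hv; now apply HWUG, H|].
  intros f F Hf HF E v Hv. now apply E, H.
Qed.

(** The identity theorem is applied on a bidisc about a nearby point of the agreement set; it is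
    contained in both [U] and [G] and large enough to cover a neighborhood of [p]. *)
Lemma agreement_closed p : U p -> G p ->
  (forall r, 0 < r -> exists w, agreement_set w /\ bidisc p r w) -> agreement_set p.
Proof.
  intros Up Gp Hp.
  destruct (proj1 (open_C2 U) HU p Up) as (r1 & Hr1 & H1).
  destruct (proj1 (open_C2 G) (hull_open P deg wt HP) p Gp) as (r2 & Hr2 & H2).
  set (r := Rmin r1 r2 / 2). assert (Hr : 0 < r) by (unfold r; assert (0 < Rmin r1 r2) by (now apply Rmin_pos); lra).
  assert (I : forall v, bidisc p (r + r) v -> U v /\ G v).
  { intros v Hv. replace (r + r) with (Rmin r1 r2) in Hv by (unfold r; field).
    split; [apply H1; exact (bidisc_le _ _ _ _ (Rmin_l _ _) Hv)|apply H2; exact (bidisc_le _ _ _ _ (Rmin_r _ _) Hv)]. }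
  destruct (Hp (r / 2)) as (w & (s & Hs & S1 & S2) & Hw); [lra|].
  assert (J : forall v, bidisc w r v -> U v /\ G v).
  { intros v Hv. apply I. eapply bidisc_triangle; [|exact Hv]. eapply bidisc_le; [|exact Hw]. lra. }
  exists (r / 2). split; [lra|split].
  - intros v Hv. apply I. eapply bidisc_le; [|exact Hv]. lra.
  - intros f F Hf HF E v Hv.
    assert (Z : (F v - f v = RtoC 0)%C).
    { apply (identity_bidisc (fun v => F v - f v)%C w r s Hs).
      - intros x Hx. destruct (J x Hx) as [Ux Gx].
        apply holomorphic_at_minus; [exact (holomorphic_on_at U F x HF Ux)|exact (holomorphic_on_at G f x Hf Gx)].
      - intros x Hx. rewrite (S2 f F Hf HF E x Hx). ring.
      - replace r with (r / 2 + r / 2) by field. eapply bidisc_triangle; [|exact Hv]. now apply bidisc_sym. }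
    replace (F v) with (F v - f v + f v)%C by ring. rewrite Z. ring.
Qed.

(* [1 / (P n - P n p)] is holomorphic on the hull but unbounded near [p]. *)
Lemma no_singular_boundary_point p n : U p -> 1 <= Cmod (P n p) ->
  ~ (forall r, 0 < r -> exists w, agreement_set w /\ bidisc p r w).
Proof.
  intros Up Hn Hp. set (c := P n p).
  assert (NZ : forall z, G z -> (P n z - c <> 0)%C).
  { intros z [Gz _] E. specialize (Gz n). replace (P n z) with c in Gz; [unfold c in Gz; lra|].
    replace (P n z) with (P n z - c + c)%C by ring. rewrite E. ring. }
  assert (Hf : holomorphic_on G (fun z => / (P n z - c))%C).
  { apply holomorphic_on_intro. intros z Gz.
    apply (holomorphic_at_comp Cinv (fun z => P n z - c)%C).
    - apply holomorphic_at_minus; [apply (family_holomorphic _ _ _ HP)|apply holomorphic_at_const].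
    - apply cdiff_inv. now apply NZ. }
  destruct (Hext _ Hf) as (F & HF & E).
  destruct (holomorphic_at_continuous F p (holomorphic_on_at U F p HF Up) 1 Rlt_0_1) as (r1 & Hr1 & B).
  pose proof (Cmod_ge_0 (F p)).
  destruct (holomorphic_at_continuous (P n) p (family_holomorphic _ _ _ HP n p) (/ (Cmod (F p) + 1))) as (r2 & Hr2 & D).
  { apply Rinv_0_lt_compat. lra. }
  destruct (Hp (Rmin r1 r2)) as (w & (s & Hs & S1 & S2) & Hw); [now apply Rmin_pos|].
  assert (Gw : G w) by (apply S1; now apply bidisc_center).
  assert (Ew := S2 _ F Hf HF E w (bidisc_center w s Hs)). cbv beta in Ew.
  specialize (B w (bidisc_le _ _ _ _ (Rmin_l _ _) Hw)). specialize (D w (bidisc_le _ _ _ _ (Rmin_r _ _) Hw)).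
  fold c in D.
  assert (One : (F w * (P n w - c) = 1)%C).
  { rewrite Ew, Cmult_comm. apply Cinv_r. now apply NZ. }
  assert (L : Cmod (F w) <= Cmod (F p) + 1).
  { assert (T := Cmod_le_near (F w) (F p)). lra. }
  assert (X : Cmod (F w * (P n w - c)) = 1) by (rewrite One; apply Cmod_1).
  rewrite Cmod_mult in X. pose proof (Cmod_ge_0 (F w)). pose proof (Cmod_ge_0 (P n w - c)).
  assert (Y : Cmod (F w) * Cmod (P n w - c) <= (Cmod (F p) + 1) * Cmod (P n w - c)) by (apply Rmult_le_compat_r; lra).
  apply Rmult_lt_compat_l with (r := Cmod (F p) + 1) in D; [|lra]. rewrite Rinv_r in D by lra. lra.
Qed.

(** Points with some [|P n p| >= 1] are excluded by a function singular there. If all polynomial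
    conditions hold, [p] can be outside the hull only through the axis clause, where no such
    singular function is at hand. *)
Lemma boundary_on_axis p : U p -> ~ agreement_set p ->
  (forall r, 0 < r -> exists w, agreement_set w /\ bidisc p r w) -> snd p = RtoC 0 /\ 1 <= Cmod (fst p).
Proof.
  intros Up Np Hp. assert (NG : ~ G p) by (intros Gp; apply Np; now apply agreement_closed).
  apply NNPP. intros M. apply NG. split.
  - intros n. apply Rnot_le_lt. intros L. exact (no_singular_boundary_point p n Up L Hp).
  - intros E. apply Rnot_le_lt. intros L. now apply M.
Qed.

Lemma agreement_off_axis p e : 0 < e -> (forall r, 0 < r -> exists w, agreement_set w /\ bidisc p r w) ->
  exists v, agreement_set v /\ bidisc p e v /\ snd v <> RtoC 0.
Proof.
  intros He Hp. destruct (Hp (e / 2)) as (w & Aw & Bw); [lra|].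
  destruct (Ceq_dec (snd w) 0) as [E|N].
  - destruct (proj1 (open_C2 _) agreement_open w Aw) as (r & Hr & H).
    set (d := Rmin r (e / 2) / 2).
    assert (Hd : 0 < d /\ d < r /\ d < e / 2).
    { unfold d. assert (0 < Rmin r (e / 2)) by (apply Rmin_pos; lra).
      pose proof (Rmin_l r (e / 2)). pose proof (Rmin_r r (e / 2)). lra. }
    pose (v := ((fst w, RtoC d) : C2)).
    assert (Bv : forall s, d < s -> bidisc w s v).
    { intros s Hs. split.
      - replace (fst v - fst w)%C with (RtoC 0) by (unfold v; simpl fst; ring). rewrite Cmod_0. lra.
      - rewrite E. unfold v; simpl snd. replace (RtoC d - RtoC 0)%C with (RtoC d) by ring.
        rewrite Cmod_R, Rabs_pos_eq; lra. }
    exists v. split; [apply H, Bv; lra|split].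
    + replace e with (e / 2 + e / 2) by field. eapply bidisc_triangle; [exact Bw|]. apply Bv. lra.
    + unfold v; simpl. intros F. apply RtoC_inj in F. lra.
  - exists w. split; [exact Aw|split; [|exact N]]. eapply bidisc_le; [|exact Bw]. lra.
Qed.

(** The exceptional axis points are bypassed. If [p = (fst p, 0)] is one, the point [x] slightly
    beyond [fst p] satisfies [|x| > 1], so a neighborhood of [(x, 0)] misses the hull. From an
    agreement point [v] near [p] and off the axis, the horizontal segment to [(x, snd v)] stays in
    [U] and must leave the agreement set. It does so at a point with second coordinate [snd v],
    hence off the axis, contrary to [boundary_on_axis]. *)
Lemma no_extension : set_connected U -> (exists z, W z) -> ~ ~ (forall z, U z -> G z).
Proof.
  intros CU [w0 Ww0] NUG.
  assert (UNG : exists z, U z /\ ~ G z).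
  { apply NNPP. intros N. apply NUG. intros z Uz. apply NNPP. intros NG. apply N. now exists z. }
  destruct UNG as (z & Uz & NGz).
  destruct (connected_escape U agreement_set CU agreement_open) as (p & Up & Np & Hp).
  { exists w0. split; [now apply HWUG|now apply agreement_contains]. }
  { exists z. split; [exact Uz|]. intros (r & Hr & H & _). apply NGz, H. now apply bidisc_center. }
  destruct (boundary_on_axis p Up Np Hp) as [E L].
  destruct (proj1 (open_C2 U) HU p Up) as (rho & Hrho & Hin).
  set (tau := rho / (2 * Cmod (fst p))).
  assert (Ht : 0 < tau) by (apply Rdiv_lt_0_compat; lra).
  set (x := (RtoC (1 + tau) * fst p)%C).
  assert (Xp : Cmod (x - fst p) = rho / 2).
  { unfold x. assert (Q : (RtoC (1 + tau) * fst p - fst p = RtoC tau * fst p)%C) by (rewrite RtoC_plus; ring).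
    rewrite Q, Cmod_mult, Cmod_R, Rabs_pos_eq by lra. unfold tau. field. lra. }
  destruct (family_axis_outside _ _ _ HP x) as [n Hn].
  { unfold x. rewrite Cmod_mult, Cmod_R, Rabs_pos_eq by lra. nra. }
  destruct (hull_exterior_open P deg wt HP n _ Hn) as (s & Hs & Hout).
  destruct (agreement_off_axis p (Rmin rho s)) as (v & Av & Bv & Nv); [now apply Rmin_pos|exact Hp|].
  assert (Bv1 := bidisc_le _ _ _ _ (Rmin_l _ _) Bv). assert (Bv2 := bidisc_le _ _ _ _ (Rmin_r _ _) Bv).
  pose (q := ((x, snd v) : C2)).
  assert (SP : forall t, 0 <= t <= 1 -> U (seg v (minus q v) t) /\ snd (seg v (minus q v) t) = snd v).
  { intros t Ht1.
    assert (E2 : snd (seg v (minus q v) t) = snd v).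
    { assert (Q : forall a : C, (a + RtoC t * (a - a) = a)%C) by (intros; ring). exact (Q (snd v)). }
    split; [|exact E2]. apply Hin. split.
    - assert (Q : forall a b : C, (a + RtoC t * (x - a) - b = RtoC (1 - t) * (a - b) + RtoC t * (x - b))%C).
      { intros. rewrite RtoC_minus. ring. }
      change (Cmod (fst v + RtoC t * (x - fst v) - fst p) < rho). rewrite Q.
      eapply Rle_lt_trans; [apply Cmod_triangle|]. rewrite !Cmod_mult, !Cmod_R, !Rabs_pos_eq, Xp by lra.
      destruct Bv1 as [B1 _].
      destruct (Req_dec t 1) as [->|]; [lra|].
      assert ((1 - t) * Cmod (fst v - fst p) < (1 - t) * rho) by (apply Rmult_lt_compat_l; lra). nra.
    - rewrite E2. apply Bv1. }
  destruct (connected_escape _ agreement_set (seg_connected v (minus q v)) agreement_open) as (y & (t & Ht1 & ->) & Ny & Hy).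
  - exists v. split; [|exact Av]. exists 0. split; [lra|]. symmetry; apply seg_0.
  - exists q. split.
    + exists 1. split; [lra|]. symmetry; apply seg_difference.
    + intros (r & Hr & H & _). apply (Hout q).
      * split; simpl.
        -- replace (x - x)%C with (RtoC 0) by ring. now rewrite Cmod_0.
        -- destruct Bv2 as [_ B2]. rewrite E in B2. exact B2.
      * apply H. now apply bidisc_center.
  - destruct (SP t Ht1) as [Uy E2].
    destruct (boundary_on_axis _ Uy Ny Hy) as [E3 _]. rewrite E2 in E3. contradiction.
Qed.
End DomainOfHolomorphy.

Lemma hull_domain_of_holomorphy P deg wt : defining_family P deg wt -> domain_of_holomorphy (hull P).
Proof.
  intros HP. split; [exact (hull_domain P deg wt HP)|].
  intros (U & W & HU & CU & NUG & HW & EW & HWUG & Hext).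
  exact (no_extension P deg wt HP U W HU HW HWUG Hext CU EW NUG).
Qed.

(** * Pseudoconvexity *)

Lemma circle_path_continuous (v : C2 -> R) z w t :
  continuous v (plus z (scal (cis t : C_AbsRing) w)) ->
  continuous (fun t => v (plus z (scal (cis t : C_AbsRing) w))) t.
Proof.
  intros H. apply continuity_pt_filterlim. intros eps He.
  destruct (proj1 (continuous_C2 v _) H eps He) as (r & Hr & B).
  set (K := Cmod (fst w) + Cmod (snd w) + 1).
  pose proof (Cmod_ge_0 (fst w)). pose proof (Cmod_ge_0 (snd w)).
  assert (KP : 0 < K) by (unfold K; lra).
  assert (RK : 0 < r / (2 * K)) by (apply Rdiv_lt_0_compat; lra).
  destruct (proj1 (continuity_pt_locally _ t) (continuity_cos t) (mkposreal _ RK)) as (d1 & D1).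
  destruct (proj1 (continuity_pt_locally _ t) (continuity_sin t) (mkposreal _ RK)) as (d2 & D2).
  exists (Rmin d1 d2). split; [apply Rmin_pos; apply cond_pos|].
  intros s [_ Hs]. simpl in Hs. unfold R_dist in Hs.
  assert (S1 : Rabs (s - t) < d1) by (eapply Rlt_le_trans; [exact Hs|apply Rmin_l]).
  assert (S2 : Rabs (s - t) < d2) by (eapply Rlt_le_trans; [exact Hs|apply Rmin_r]).
  specialize (D1 s S1). specialize (D2 s S2). simpl in D1, D2.
  apply B.
  assert (E : Cmod (cis s - cis t) < r / K).
  { eapply Rle_lt_trans; [apply Cmod_le_sum|]. simpl.
    replace (r / K) with (r / (2 * K) + r / (2 * K)) by (field; lra). unfold Rminus in *. lra. }
  assert (Q : forall a b : C, Cmod b < K -> Cmod (a + cis s * b - (a + cis t * b)) < r).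
  { intros a b Hb. replace (a + cis s * b - (a + cis t * b))%C with ((cis s - cis t) * b)%C by ring.
    rewrite Cmod_mult. pose proof (Cmod_ge_0 (cis s - cis t)). pose proof (Cmod_ge_0 b).
    apply Rlt_le_trans with (r / K * K); [|right; field; lra].
    apply Rle_lt_trans with (Cmod (cis s - cis t) * K); [apply Rmult_le_compat_l; lra|].
    apply Rmult_lt_compat_r; lra. }
  assert (K1 : Cmod (fst w) < K) by (unfold K; lra). assert (K2 : Cmod (snd w) < K) by (unfold K; lra).
  split; [exact (Q (fst z) (fst w) K1)|exact (Q (snd z) (snd w) K2)].
Qed.

(** The convex function [a x + x / (1 - x)] lies above its tangent at [x]; this is the form of
    Jensen's inequality needed for the sub-mean value property. *)
Lemma exhaustion_tangent a x y : 0 <= x < 1 -> 0 <= y < 1 ->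
  a * x + x / (1 - x) + (a + / ((1 - x) * (1 - x))) * (y - x) <= a * y + y / (1 - y).
Proof.
  intros Hx Hy.
  assert (E : y / (1 - y) = x / (1 - x) + / ((1 - x) * (1 - x)) * (y - x) +
    (y - x) * (y - x) / ((1 - y) * ((1 - x) * (1 - x)))) by (field; lra).
  assert (0 <= (y - x) * (y - x) / ((1 - y) * ((1 - x) * (1 - x)))).
  { apply Rdiv_le_0_compat; [apply (Rle_0_sqr (y - x))|]. apply Rmult_lt_0_compat; [lra|]. apply Rmult_lt_0_compat; lra. }
  lra.
Qed.

Lemma half_pow_le_1 n : (1 / 2) ^ n <= 1.
Proof.
  induction n as [|n IH]; [simpl; lra|]. change ((1 / 2) ^ S n) with (1 / 2 * (1 / 2) ^ n). lra.
Qed.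

Section Pseudoconvex.
Variables (P : nat -> C2 -> C) (deg : nat -> nat) (wt : nat -> R).
Hypothesis HP : defining_family P deg wt.
Let G := hull P.

(** The fraction blows up where [|P n|] approaches 1. The weighted summand is there for the unit
    circle on the axis, where no single [|P n|] need approach 1. *)
Definition exhaustion_term (n : nat) (z : C2) : R :=
  wt n * Cmod (P n z) + Cmod (P n z) / (1 - Cmod (P n z)).

Definition exhaustion (z : C2) : R := real (Lub_Rbar (fun x => exists n, x = exhaustion_term n z)).

Lemma exhaustion_term_nonneg n z : G z -> 0 <= exhaustion_term n z.
Proof.
  intros [Gz _]. specialize (Gz n). pose proof (Cmod_ge_0 (P n z)).
  pose proof (family_weight _ _ _ HP n). unfold exhaustion_term.
  assert (0 <= Cmod (P n z) / (1 - Cmod (P n z))) by (apply Rdiv_le_0_compat; lra). nra.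
Qed.

Lemma exhaustion_term_small z : G z -> exists r N, 0 < r /\ forall w n, bidisc z r w -> (N <= n)%nat ->
  G w /\ exhaustion_term n w <= 3 * (1 / 2) ^ n.
Proof.
  intros Gz. destruct (family_locally_small _ _ _ HP z Gz) as (r & N & Hr & H).
  destruct (proj1 (open_C2 G) (hull_open P deg wt HP) z Gz) as (s & Hs & I).
  (* The successor ensures [n >= 1], so that [x <= 1 / 2] and [x / (1 - x) <= 2 * x]; together with
     the weighted part this gives the factor 3. *)
  exists (Rmin r s), (S N). split; [now apply Rmin_pos|]. intros w n Hw Hn.
  split; [apply I; exact (bidisc_le _ _ _ _ (Rmin_r _ _) Hw)|].
  specialize (H w n (bidisc_le _ _ _ _ (Rmin_l _ _) Hw) ltac:(lia)).
  pose proof (family_weight _ _ _ HP n). pose proof (Cmod_ge_0 (P n w)).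
  assert (Q : (1 / 2) ^ n <= 1 / 2).
  { destruct n as [|n]; [lia|]. change ((1 / 2) ^ S n) with (1 / 2 * (1 / 2) ^ n). assert ((1 / 2) ^ n <= 1) by apply half_pow_le_1. lra. }
  unfold exhaustion_term. set (x := Cmod (P n w)) in *.
  assert (X : x <= (1 / 2) ^ n) by nra.
  assert (x / (1 - x) <= 2 * x); [|lra].
  apply Rle_div_l; [lra|]. nra.
Qed.

(** All but finitely many terms are bounded by 3, so the supremum is finite and [real] returns its
    true value. *)
Lemma exhaustion_lub z : G z -> (forall n, exhaustion_term n z <= exhaustion z) /\
  forall B, (forall n, exhaustion_term n z <= B) -> exhaustion z <= B.
Proof.
  intros Gz. destruct (exhaustion_term_small z Gz) as (r & N & Hr & H).
  assert (Bd : exists B, forall n, exhaustion_term n z <= B).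
  { assert (F : forall M, exists B, forall n, (n < M)%nat -> exhaustion_term n z <= B).
    { induction M as [|M (B & IH)]; [exists 0; intros; lia|].
      exists (Rmax B (exhaustion_term M z)). intros n Hn. destruct (Nat.eq_dec n M) as [->|Ne]; [apply Rmax_r|].
      eapply Rle_trans; [apply IH; lia|apply Rmax_l]. }
    destruct (F N) as [B HB]. exists (Rmax B 3). intros n. destruct (Compare_dec.le_lt_dec N n) as [L|L].
    - eapply Rle_trans; [|apply Rmax_r]. destruct (H z n (bidisc_center z r Hr) L) as [_ E].
      assert ((1 / 2) ^ n <= 1) by apply half_pow_le_1. lra.
    - eapply Rle_trans; [now apply HB|apply Rmax_l]. }
  destruct Bd as [B HB]. unfold exhaustion.
  destruct (Lub_Rbar_correct (fun x => exists n, x = exhaustion_term n z)) as [H1 H2].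
  destruct (Lub_Rbar (fun x => exists n, x = exhaustion_term n z)) as [x| |].
  - split; [intros n; apply (H1 (exhaustion_term n z)); eauto|].
    intros B' HB'. apply (H2 (Finite B')). intros y [n ->]. apply HB'.
  - assert (Q : is_ub_Rbar (fun x => exists n, x = exhaustion_term n z) (Finite B)) by (intros y [n ->]; apply HB).
    destruct (H2 _ Q).
  - destruct (H1 (exhaustion_term 0 z)); eauto.
Qed.

Lemma exhaustion_term_continuous n z : G z -> continuous (exhaustion_term n) z.
Proof.
  intros [Gz _]. specialize (Gz n).
  apply (continuous_comp (fun z : C2 => Cmod (P n z)) (fun x : R => wt n * x + x / (1 - x))).
  - apply continuous_C2. intros eps He.
    destruct (holomorphic_at_continuous _ z (family_holomorphic _ _ _ HP n z) eps He) as (r & Hr & D).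
    exists r. split; [exact Hr|]. intros w Hw. specialize (D w Hw).
    assert (T1 := Cmod_le_near (P n w) (P n z)). assert (T2 := Cmod_ge_near (P n w) (P n z)). apply Rabs_def1; lra.
  - apply (ex_derive_continuous (K := R_AbsRing) (V := R_NormedModule)). auto_derive. lra.
Qed.

(** Near [z] all terms beyond some index are below [eps / 2], while the supremum is nonnegative; up
    to [eps / 2] it is therefore decided by finitely many continuous terms. *)
Lemma exhaustion_continuous z : G z -> continuous exhaustion z.
Proof.
  intros Gz. apply continuous_C2. intros eps He.
  destruct (exhaustion_term_small z Gz) as (r & N & Hr & H).
  assert (Hhalf : exists M, (N <= M)%nat /\ forall n, (M <= n)%nat -> 3 * (1 / 2) ^ n < eps / 2).
  { destruct (pow_lt_1_zero (1 / 2)) with (y := eps / 6) as [M HM].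
    - rewrite Rabs_pos_eq; lra.
    - lra.
    - exists (N + M)%nat. split; [lia|]. intros n Hn. specialize (HM n ltac:(lia)).
      rewrite Rabs_pos_eq in HM by (apply pow_le; lra). lra. }
  destruct Hhalf as (M & HNM & HM).
  assert (F : forall m, exists s, 0 < s /\ forall w, bidisc z s w -> forall n, (n < m)%nat ->
     Rabs (exhaustion_term n w - exhaustion_term n z) < eps / 2).
  { induction m as [|m (s & Hs & IH)]; [exists 1; split; [lra|intros; lia]|].
    destruct (proj1 (continuous_C2 _ _) (exhaustion_term_continuous m z Gz) (eps / 2)) as (s' & Hs' & D); [lra|].
    exists (Rmin s s'). split; [now apply Rmin_pos|]. intros w Hw n Hn.
    destruct (Nat.eq_dec n m) as [->|Ne].
    - apply D. exact (bidisc_le _ _ _ _ (Rmin_r _ _) Hw).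
    - apply (IH w (bidisc_le _ _ _ _ (Rmin_l _ _) Hw)). lia. }
  destruct (F M) as (s & Hs & D).
  exists (Rmin r s). split; [now apply Rmin_pos|]. intros w Hw.
  assert (W1 := bidisc_le _ _ _ _ (Rmin_l _ _) Hw). assert (W2 := bidisc_le _ _ _ _ (Rmin_r _ _) Hw).
  destruct (H w N W1 (Nat.le_refl N)) as [Gw _].
  destruct (exhaustion_lub z Gz) as [Z1 Z2]. destruct (exhaustion_lub w Gw) as [V1 V2].
  assert (Z0 := exhaustion_term_nonneg 0 z Gz). assert (V0 := exhaustion_term_nonneg 0 w Gw).
  assert (Z3 := Z1 O). assert (V3 := V1 O).
  assert (A : exhaustion w <= exhaustion z + eps / 2).
  { apply V2. intros n. destruct (Compare_dec.le_lt_dec M n) as [L|L].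
    - destruct (H w n W1 ltac:(lia)) as [_ E]. specialize (HM n L). lra.
    - specialize (D w W2 n L). apply Rabs_def2 in D. specialize (Z1 n). lra. }
  assert (B : exhaustion z <= exhaustion w + eps / 2).
  { apply Z2. intros n. destruct (Compare_dec.le_lt_dec M n) as [L|L].
    - destruct (H z n (bidisc_center z r Hr) ltac:(lia)) as [_ E]. specialize (HM n L). lra.
    - specialize (D w W2 n L). apply Rabs_def2 in D. specialize (V1 n). lra. }
  apply Rabs_def1; lra.
Qed.

(** Jensen: the tangent at [|P n z|] bounds the term from below on the circle, and since its slope
    [q] is nonnegative the sub-mean value inequality for [|P n|] applies to its linear part. *)
Lemma exhaustion_term_sub_mean n z w :
  (forall l : C, Cmod l <= 1 -> G (plus z (scal (l : C_AbsRing) w))) ->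
  2 * PI * exhaustion_term n z <=
    RInt (fun t => exhaustion_term n (plus z (scal (cis t : C_AbsRing) w))) 0 (2 * PI).
Proof.
  intros HG. assert (PP := PI_RGT_0).
  pose (k := fun l : C => P n (plus z (scal (l : C_AbsRing) w))).
  assert (K0 : k (RtoC 0) = P n z).
  { unfold k. now rewrite plus_scal_0. }
  assert (KD : forall l, cdiff k l) by (intros l; apply holomorphic_at_line, (family_holomorphic _ _ _ HP)).
  assert (S := sub_mean_value k (RtoC 0) 1 Rlt_0_1 (fun l _ => KD l)).
  rewrite K0 in S.
  rewrite (RInt_ext _ (fun t => Cmod (k (cis t)))) in S.
  2:{ intros t _. do 2 f_equal. ring. }
  assert (GC : forall t, G (plus z (scal (cis t : C_AbsRing) w))) by (intros t; apply HG; rewrite Cmod_cis; lra).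
  assert (Gz : G z).
  { assert (X := HG (RtoC 0)). rewrite Cmod_0, plus_scal_0 in X. apply X. lra. }
  set (x := Cmod (P n z)) in *.
  assert (Hx : 0 <= x < 1) by (split; [apply Cmod_ge_0|apply Gz]).
  set (a := wt n). assert (Ha : 1 <= a) by apply (family_weight _ _ _ HP).
  set (q := a + / ((1 - x) * (1 - x))).
  assert (Hq : 0 <= q).
  { unfold q. assert (0 < / ((1 - x) * (1 - x))) by (apply Rinv_0_lt_compat, Rmult_lt_0_compat; lra). lra. }
  assert (EX : ex_RInt (fun t => Cmod (k (cis t))) 0 (2 * PI)).
  { apply ex_RInt_continuous_le; [lra|]. intros t _.
    apply (ccont_Cmod_path k cis).
    - intros s. apply continuity_pt_filterlim, continuity_cos.
    - intros s. apply continuity_pt_filterlim, continuity_sin.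
    - apply cdiff_ccont, KD. }
  assert (EY : ex_RInt (fun t => q * Cmod (k (cis t))) 0 (2 * PI)) by (apply (ex_RInt_scal (V := R_NormedModule)); exact EX).
  apply Rle_trans with (RInt (fun t => (a * x + x / (1 - x) - q * x) + q * Cmod (k (cis t))) 0 (2 * PI)).
  - rewrite (RInt_plus (V := R_CompleteNormedModule)); [|apply ex_RInt_const|exact EY].
    rewrite (RInt_scal (V := R_CompleteNormedModule)) by exact EX.
    rewrite RInt_const. unfold plus, scal; simpl. unfold mult; simpl.
    unfold exhaustion_term. fold a. fold x.
    assert (q * (2 * PI * x) <= q * RInt (fun t => Cmod (k (cis t))) 0 (2 * PI)) by (apply Rmult_le_compat_l; lra).
    lra.
  - apply RInt_le; [lra| | |].
    + apply (ex_RInt_plus (V := R_NormedModule)); [apply ex_RInt_const|exact EY].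
    + apply ex_RInt_continuous_le; [lra|]. intros t _.
      apply circle_path_continuous, exhaustion_term_continuous, GC.
    + intros t _. unfold exhaustion_term. fold a. change (P n (plus z (scal (cis t : C_AbsRing) w))) with (k (cis t)).
      assert (Y : 0 <= Cmod (k (cis t)) < 1) by (split; [apply Cmod_ge_0|apply GC]).
      assert (T := exhaustion_tangent a x (Cmod (k (cis t))) Hx Y). fold q in T. lra.
Qed.

Lemma exhaustion_psh : continuous_psh_on G exhaustion.
Proof.
  split; [exact exhaustion_continuous|]. intros z w HG. assert (PP := PI_RGT_0).
  assert (GC : forall t, G (plus z (scal (cis t : C_AbsRing) w))) by (intros t; apply HG; rewrite Cmod_cis; lra).
  assert (Gz : G z).
  { assert (X := HG (RtoC 0)). rewrite Cmod_0, plus_scal_0 in X. apply X. lra. }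
  apply (exhaustion_lub z Gz). intros n.
  assert (M := exhaustion_term_sub_mean n z w HG).
  apply Rmult_le_reg_l with (2 * PI); [lra|].
  rewrite <- Rmult_assoc, Rinv_r, Rmult_1_l by lra.
  eapply Rle_trans; [exact M|]. apply RInt_le; [lra| | |].
  - apply ex_RInt_continuous_le; [lra|]. intros t _.
    apply circle_path_continuous, exhaustion_term_continuous, GC.
  - apply ex_RInt_continuous_le; [lra|]. intros t _.
    apply (circle_path_continuous exhaustion), exhaustion_continuous, GC.
  - intros t _. apply (exhaustion_lub _ (GC t)).
Qed.

Lemma hull_pseudoconvex : pseudoconvex G.
Proof.
  exists exhaustion. split; [exact exhaustion_psh|]. intros c.
  set (b := Rmax c 1). assert (B1 : c <= b) by apply Rmax_l. assert (B2 : 1 <= b) by apply Rmax_r.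
  (* [x / (1 - x) <= b] means [x <= b / (1 + b)]. Stated as non-strict inequalities on the whole
     space, the conditions define a closed set; the weighted ones keep it off the unit circle of the
     axis. *)
  pose (K := fun z : C2 => forall n, Cmod (P n z) <= b / (1 + b) /\ wt n * Cmod (P n z) <= b).
  assert (Bb : b / (1 + b) < 1).
  { apply Rlt_div_l; [lra|]. lra. }
  assert (KG : forall z, K z -> G z).
  { intros z Kz. split.
    - intros n. destruct (Kz n). lra.
    - intros E. apply Rnot_le_lt. intros L. destruct (family_axis_unbounded _ _ _ HP (fst z) b L) as [n Hn].
      assert (Ez : ((fst z, RtoC 0) : C2) = z) by (apply C2_ext; [reflexivity|symmetry; exact E]).
      assert (X : wt n * Cmod (P n ((fst z, RtoC 0) : C2)) <= b) by (rewrite Ez; apply Kz).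
      exact (Rlt_not_le _ _ Hn X). }
  exists K. split; [|split; [exact KG|]].
  - destruct (family_bounded _ _ _ HP) as [M HM].
    apply (compact_C2 K M); [|intros z Kz; now apply HM, KG].
    intros z NK. apply not_all_ex_not in NK. destruct NK as [n Hn].
    assert (W := family_weight _ _ _ HP n).
    assert (X : exists x, x < Cmod (P n z) /\ forall w, x < Cmod (P n w) -> ~ K w).
    { apply not_and_or in Hn. destruct Hn as [Hn|Hn]; apply Rnot_le_lt in Hn.
      - exists (b / (1 + b)). split; [exact Hn|]. intros w Hw Kw. destruct (Kw n). lra.
      - exists (b / wt n). split.
        + apply Rmult_lt_reg_l with (wt n); [lra|]. replace (wt n * (b / wt n)) with b by (field; lra). exact Hn.
        + intros w Hw Kw. destruct (Kw n) as [_ L].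
          apply Rmult_lt_compat_l with (r := wt n) in Hw; [|lra].
          replace (wt n * (b / wt n)) with b in Hw by (field; lra). lra. }
    destruct X as (x & Hx & Hout).
    destruct (holomorphic_at_continuous _ z (family_holomorphic _ _ _ HP n z) (Cmod (P n z) - x)) as (r & Hr & D); [lra|].
    exists r. split; [exact Hr|]. intros w Hw. apply Hout. specialize (D w Hw).
    assert (T := Cmod_ge_near (P n w) (P n z)). lra.
  - intros z [Gz Hz] n. destruct (exhaustion_lub z Gz) as [L _]. specialize (L n).
    assert (Pz := proj1 Gz n). pose proof (Cmod_ge_0 (P n z)). pose proof (family_weight _ _ _ HP n).
    unfold exhaustion_term in L. set (x := Cmod (P n z)) in *.
    assert (0 <= x / (1 - x)) by (apply Rdiv_le_0_compat; lra).
    assert (0 <= wt n * x) by (apply Rmult_le_pos; lra).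
    split; [|lra].
    assert (Y : x / (1 - x) <= b) by lra.
    apply Rle_div_l in Y; [|lra]. apply Rle_div_r; lra.
Qed.
End Pseudoconvex.

(** * The Kobayashi distance of a bounded domain *)

Lemma ex_derive_coordinates (f : C -> C2) l : ex_derive (K := C_AbsRing) (V := C2) f l ->
  cdiff (fun l => fst (f l)) l /\ cdiff (fun l => snd (f l)) l.
Proof.
  intros H. apply ex_derive_filterdiff in H. split; apply cdiff_ex_filterdiff.
  - exact (ex_filterdiff_comp' (U := AbsRing_NormedModule C_AbsRing) (V := C2)
      (W := AbsRing_NormedModule C_AbsRing) f (fun w => fst w) l H (fst_holomorphic _)).
  - exact (ex_filterdiff_comp' (U := AbsRing_NormedModule C_AbsRing) (V := C2)
      (W := AbsRing_NormedModule C_AbsRing) f (fun w => snd w) l H (snd_holomorphic _)).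
Qed.

Definition joined_by_disc (G : C2 -> Prop) (x y : C2) (r : R) : Prop :=
  exists (f : C -> C2) a b, analytic_disc G f /\ disc a /\ disc b /\ f a = x /\ f b = y /\ poincare_dist a b <= r.

Lemma poincare_dist_nonneg a b : disc a -> disc b -> 0 <= poincare_dist a b.
Proof.
  intros Ha Hb. assert (P := poincare_nonneg a b Ha Hb).
  unfold poincare_dist. pose proof (arctanh_ge _ P). lra.
Qed.

Lemma poincare_dist_sym a b : disc a -> disc b -> poincare_dist a b = poincare_dist b a.
Proof.
  intros Ha Hb. unfold poincare_dist. f_equal.
  rewrite !Cmod_div by now apply disc_denominator.
  assert (E : Cmod (1 - Cconj a * b) = Cmod (1 - Cconj b * a)).
  { rewrite <- (Cmod_conj (1 - Cconj b * a)). f_equal.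
    destruct a, b; unfold Cconj, Cminus, Cplus, Copp, Cmult; simpl; f_equal; ring. }
  rewrite E. f_equal. replace (b - a)%C with (- (a - b))%C by ring. now rewrite Cmod_opp.
Qed.

Section Kobayashi.
Variables (G : C2 -> Prop) (M : R).
Hypothesis G_bounded : forall z, G z -> Cmod (fst z) <= M /\ Cmod (snd z) <= M.

Lemma disc_coordinates_lipschitz f a b : analytic_disc G f -> disc a -> disc b ->
  Cmod (fst (f a) - fst (f b)) <= 8 * M * poincare_dist a b /\
  Cmod (snd (f a) - snd (f b)) <= 8 * M * poincare_dist a b.
Proof.
  intros Hf Ha Hb. split.
  - apply (poincare_lipschitz (fun l => fst (f l))); auto. intros z Hz. destruct (Hf z Hz) as [Gz Dz].
    split; [apply (ex_derive_coordinates f z Dz)|now apply G_bounded].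
  - apply (poincare_lipschitz (fun l => snd (f l))); auto. intros z Hz. destruct (Hf z Hz) as [Gz Dz].
    split; [apply (ex_derive_coordinates f z Dz)|now apply G_bounded].
Qed.

(** Both coordinates of every disc of the chain are bounded by [M], hence Lipschitz for the Poincare
    distance, and the estimates add up along the chain. Nonnegativity of [r] makes the infimum over
    chains finite. *)
Lemma chain_lower_bound x y r : kobayashi_chain G x y r ->
  0 <= r /\ Cmod (fst x - fst y) <= 8 * M * r /\ Cmod (snd x - snd y) <= 8 * M * r.
Proof.
  intros (N & p & f & a & b & HN & P0 & PN & GP & HF & Er).
  destruct N as [|N]; [lia|]. simpl pred in Er. subst x y r.
  assert (K : forall k, (k <= N)%nat ->
    0 <= sum_f_R0 (fun i => poincare_dist (a i) (b i)) k /\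
    Cmod (fst (p O) - fst (p (S k))) <= 8 * M * sum_f_R0 (fun i => poincare_dist (a i) (b i)) k /\
    Cmod (snd (p O) - snd (p (S k))) <= 8 * M * sum_f_R0 (fun i => poincare_dist (a i) (b i)) k).
  { induction k as [|k IH]; intros Hk.
    - destruct (HF O) as (D & A & B & E1 & E2); [lia|]. simpl sum_f_R0.
      rewrite <- E1, <- E2. split; [now apply poincare_dist_nonneg|now apply disc_coordinates_lipschitz].
    - destruct IH as (I0 & I1 & I2); [lia|].
      destruct (HF (S k)) as (D & A & B & E1 & E2); [lia|].
      destruct (disc_coordinates_lipschitz _ _ _ D A B) as [L1 L2]. rewrite E1, E2 in L1, L2.
      pose proof (poincare_dist_nonneg _ _ A B). simpl sum_f_R0.
      assert (T1 := Cmod_minus_triangle (fst (p O)) (fst (p (S k))) (fst (p (S (S k))))).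
      assert (T2 := Cmod_minus_triangle (snd (p O)) (snd (p (S k))) (snd (p (S (S k))))).
      rewrite Rmult_plus_distr_l. split; [lra|split].
      + eapply Rle_trans; [exact T1|]. apply Rplus_le_compat; assumption.
      + eapply Rle_trans; [exact T2|]. apply Rplus_le_compat; assumption. }
  now apply K.
Qed.

Lemma kobayashi_glb x y r0 : kobayashi_chain G x y r0 -> is_glb_Rbar (kobayashi_chain G x y) (Finite (kobayashi G x y)).
Proof.
  intros Hr. unfold kobayashi. destruct (Glb_Rbar_correct (kobayashi_chain G x y)) as [H1 H2].
  assert (E : Glb_Rbar (kobayashi_chain G x y) = Finite (real (Glb_Rbar (kobayashi_chain G x y)))).
  { destruct (Glb_Rbar (kobayashi_chain G x y)) as [z| |]; [reflexivity| |].
    - destruct (H1 r0 Hr).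
    - assert (B : is_lb_Rbar (kobayashi_chain G x y) (Finite 0)) by (intros t Ht; apply (chain_lower_bound _ _ _ Ht)).
      destruct (H2 _ B). }
  rewrite <- E. split; assumption.
Qed.

Lemma kobayashi_le_chain x y r : kobayashi_chain G x y r -> kobayashi G x y <= r.
Proof. intros H. exact (proj1 (kobayashi_glb x y r H) r H). Qed.

Lemma kobayashi_lower_bound x y r0 : 0 <= M -> kobayashi_chain G x y r0 ->
  Cmod (fst x - fst y) <= 8 * M * kobayashi G x y /\ Cmod (snd x - snd y) <= 8 * M * kobayashi G x y.
Proof.
  intros HM H. destruct (kobayashi_glb x y r0 H) as [H1 H2].
  assert (Q : forall u, (forall r, kobayashi_chain G x y r -> u <= 8 * M * r) -> u <= 8 * M * kobayashi G x y).
  { intros u Hu. destruct (Req_dec M 0) as [->|N].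
    - specialize (Hu r0 H). lra.
    - assert (B : is_lb_Rbar (kobayashi_chain G x y) (Finite (u / (8 * M)))).
      { intros r Hr. simpl. apply Rmult_le_reg_l with (8 * M); [lra|].
        replace (8 * M * (u / (8 * M))) with u by (field; lra). now apply Hu. }
      specialize (H2 _ B). simpl in H2. apply Rmult_le_compat_l with (r := 8 * M) in H2; [|lra].
      replace (8 * M * (u / (8 * M))) with u in H2 by (field; lra). exact H2. }
  split; apply Q; intros r Hr; now apply chain_lower_bound.
Qed.

Lemma chain_of_disc x y r : joined_by_disc G x y r ->
  exists r', r' <= r /\ kobayashi_chain G x y r' /\ kobayashi_chain G y x r'.
Proof.
  intros (f & a & b & D & A & B & E1 & E2 & L). exists (poincare_dist a b). split; [exact L|split].
  - exists 1%nat, (fun i => match i with O => x | _ => y end), (fun _ => f), (fun _ => a), (fun _ => b).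
    repeat split; auto.
    + intros [|i] _; [rewrite <- E1|rewrite <- E2]; now apply D.
    + now apply D.
    + now apply D.
    + destruct i; [exact E1|lia].
  - exists 1%nat, (fun i => match i with O => y | _ => x end), (fun _ => f), (fun _ => b), (fun _ => a).
    repeat split; auto.
    + intros [|i] _; [rewrite <- E2|rewrite <- E1]; now apply D.
    + now apply D.
    + now apply D.
    + destruct i; [exact E2|lia].
    + simpl. now apply poincare_dist_sym.
Qed.

Lemma chain_extend x y z r s : kobayashi_chain G x y r -> joined_by_disc G y z s ->
  exists r', r' <= r + s /\ kobayashi_chain G x z r'.
Proof.
  intros (N & p & f & a & b & HN & P0 & PN & GP & HF & Er) (g & c & d & D & A & B & E1 & E2 & L).
  destruct N as [|N]; [lia|]. simpl pred in Er.
  exists (r + poincare_dist c d). split; [lra|].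
  exists (S (S N)), (fun i => if Nat.eq_dec i (S (S N)) then z else p i),
    (fun i => if Nat.eq_dec i (S N) then g else f i),
    (fun i => if Nat.eq_dec i (S N) then c else a i), (fun i => if Nat.eq_dec i (S N) then d else b i).
  split; [lia|]. split; [exact P0|]. split; [destruct (Nat.eq_dec (S (S N)) (S (S N))); congruence|].
  split; [|split].
  - intros i Hi. destruct (Nat.eq_dec i (S (S N))) as [|Ne]; [rewrite <- E2; now apply D|apply GP; lia].
  - intros i Hi. destruct (Nat.eq_dec i (S (S N))) as [|Ne]; [lia|].
    destruct (Nat.eq_dec i (S N)) as [->|Ne2].
    + destruct (Nat.eq_dec (S (S N)) (S (S N))); [|lia]. rewrite PN. auto.
    + destruct (Nat.eq_dec (S i) (S (S N))); [lia|]. apply HF. lia.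
  - change (pred (S (S N))) with (S N). rewrite tech5. destruct (Nat.eq_dec (S N) (S N)); [|lia].
    f_equal. subst r.
    apply sum_eq. intros i Hi. destruct (Nat.eq_dec i (S N)); [lia|reflexivity].
Qed.

Lemma chain_prepend x y z r s : kobayashi_chain G y z r -> joined_by_disc G x y s ->
  exists r', r' <= s + r /\ kobayashi_chain G x z r'.
Proof.
  intros (N & p & f & a & b & HN & P0 & PN & GP & HF & Er) (g & c & d & D & A & B & E1 & E2 & L).
  destruct N as [|N]; [lia|]. simpl pred in Er.
  exists (poincare_dist c d + r). split; [lra|].
  exists (S (S N)), (fun i => match i with O => x | S i => p i end),
    (fun i => match i with O => g | S i => f i end),
    (fun i => match i with O => c | S i => a i end), (fun i => match i with O => d | S i => b i end).
  split; [lia|]. split; [reflexivity|]. split; [exact PN|]. split; [|split].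
  - intros [|i] Hi; [rewrite <- E1; now apply D|apply GP; lia].
  - intros [|i] Hi; [rewrite P0; auto|apply HF; lia].
  - simpl pred. rewrite decomp_sum by lia. simpl pred. now subst r.
Qed.

Lemma joined_by_disc_sym x y r : joined_by_disc G x y r -> joined_by_disc G y x r.
Proof.
  intros (f & a & b & D & A & B & E1 & E2 & L). exists f, b, a.
  repeat split; auto; try now apply D. now rewrite poincare_dist_sym.
Qed.

Section Path.
Variables (s : nat -> C2) (p : C2) (c : R).
Hypothesis M_nonneg : 0 <= M.
Hypothesis s_in : forall n, G (s n).
Hypothesis s_lim : forall e, 0 < e -> exists N, forall n, (N <= n)%nat -> bidisc p e (s n).
Hypothesis p_out : ~ G p.
Hypothesis s_step : forall n, joined_by_disc G (s n) (s (S n)) (c * (1 / 2) ^ n).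

Lemma step_constant_nonneg : 0 <= c.
Proof.
  destruct (s_step 0) as (f & a & b & _ & A & B & _ & _ & L). simpl in L.
  pose proof (poincare_dist_nonneg a b A B). lra.
Qed.

(** The bound is the geometric sum of the step costs. Chains in both directions are carried along,
    so the Cauchy condition needs no symmetry of [kobayashi]. *)
Lemma path_chain n k : exists r r', r <= 2 * c * ((1 / 2) ^ n - (1 / 2) ^ (n + S k)) /\
  r' <= 2 * c * ((1 / 2) ^ n - (1 / 2) ^ (n + S k)) /\
  kobayashi_chain G (s n) (s (n + S k)%nat) r /\ kobayashi_chain G (s (n + S k)%nat) (s n) r'.
Proof.
  induction k as [|k (r & r' & R1 & R2 & C1 & C2)].
  - destruct (chain_of_disc _ _ _ (s_step n)) as (r & R & C1 & C2). exists r, r.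
    replace (n + 1)%nat with (S n) by lia.
    replace (2 * c * ((1 / 2) ^ n - (1 / 2) ^ S n)) with (c * (1 / 2) ^ n) by (simpl; field).
    auto.
  - assert (J := s_step (n + S k)).
    destruct (chain_extend _ _ _ _ _ C1 J) as (q & Q & D1).
    destruct (chain_prepend _ _ _ _ _ C2 (joined_by_disc_sym _ _ _ J)) as (q' & Q' & D2).
    exists q, q'. replace (n + S (S k))%nat with (S (n + S k)) by lia.
    replace (2 * c * ((1 / 2) ^ n - (1 / 2) ^ S (n + S k))) with
      (2 * c * ((1 / 2) ^ n - (1 / 2) ^ (n + S k)) + c * (1 / 2) ^ (n + S k)) by (simpl pow; field).
    repeat split; auto; lra.
Qed.

Lemma trivial_chain x : G x -> kobayashi_chain G x x 0.
Proof.
  intros Gx. exists 1%nat, (fun _ => x), (fun _ _ => x), (fun _ => RtoC 0), (fun _ => RtoC 0).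
  assert (Z : disc (RtoC 0)) by (unfold disc; rewrite Cmod_0; lra).
  repeat split; auto.
  - apply ex_derive_const.
  - simpl. unfold poincare_dist. replace ((0 - 0) / (1 - Cconj 0 * 0))%C with (RtoC 0).
    + rewrite Cmod_0. unfold arctanh. replace ((1 + 0) / (1 - 0)) with 1 by field. rewrite ln_1. ring.
    + unfold Cdiv. ring.
Qed.

Lemma path_chain_any m n : exists r, r <= 2 * c * Rmax ((1 / 2) ^ m) ((1 / 2) ^ n) /\ kobayashi_chain G (s m) (s n) r.
Proof.
  assert (c0 := step_constant_nonneg).
  assert (PP : forall k, 0 <= (1 / 2) ^ k) by (intros; apply pow_le; lra).
  destruct (Compare_dec.lt_eq_lt_dec m n) as [[L|E]|L]; [|subst m|].
  - destruct (path_chain m (n - S m)) as (r & _ & R & _ & C1 & _).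
    replace (m + S (n - S m))%nat with n in * by lia. exists r. split; [|exact C1].
    pose proof (Rmax_l ((1 / 2) ^ m) ((1 / 2) ^ n)). pose proof (PP n).
    eapply Rle_trans; [exact R|]. apply Rmult_le_compat_l; lra.
  - exists 0. split; [|now apply trivial_chain]. apply Rmult_le_pos; [lra|].
    eapply Rle_trans; [apply (PP n)|apply Rmax_l].
  - destruct (path_chain n (m - S n)) as (_ & r & _ & R & _ & C1).
    replace (n + S (m - S n))%nat with m in * by lia. exists r. split; [|exact C1].
    pose proof (Rmax_r ((1 / 2) ^ m) ((1 / 2) ^ n)). pose proof (PP m).
    eapply Rle_trans; [exact R|]. apply Rmult_le_compat_l; lra.
Qed.

Lemma path_cauchy eps : 0 < eps -> exists N, forall m n, (N <= m)%nat -> (N <= n)%nat ->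
  kobayashi G (s m) (s n) < eps.
Proof.
  intros He.
  assert (c0 := step_constant_nonneg).
  destruct (pow_lt_1_zero (1 / 2)) with (y := eps / (2 * c + 1)) as [N HN].
  { rewrite Rabs_pos_eq; lra. } { apply Rdiv_lt_0_compat; lra. }
  exists N. intros m n Hm Hn. destruct (path_chain_any m n) as (r & R & C1).
  eapply Rle_lt_trans; [apply (kobayashi_le_chain _ _ _ C1)|]. eapply Rle_lt_trans; [exact R|].
  assert (A := HN m Hm). assert (B := HN n Hn).
  rewrite Rabs_pos_eq in A by (apply pow_le; lra). rewrite Rabs_pos_eq in B by (apply pow_le; lra).
  assert (X : Rmax ((1 / 2) ^ m) ((1 / 2) ^ n) < eps / (2 * c + 1)) by (now apply Rmax_lub_lt).
  assert (X0 : 0 <= Rmax ((1 / 2) ^ m) ((1 / 2) ^ n)) by (eapply Rle_trans; [|apply Rmax_l]; apply pow_le; lra).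
  apply Rmult_lt_compat_l with (r := 2 * c + 1) in X; [|lra].
  replace ((2 * c + 1) * (eps / (2 * c + 1))) with eps in X by (field; lra). lra.
Qed.

(** Convergence for [kobayashi] forces Euclidean convergence, so the limit could only be [p]. The
    chains from [s n] to [z] are required because the infimum over an empty set of chains would say
    nothing. *)
Lemma path_not_complete : (forall n z, G z -> exists r, kobayashi_chain G (s n) z r) -> ~ kobayashi_complete G.
Proof.
  intros Hch HC. destruct (HC s s_in path_cauchy) as (z & Gz & L).
  apply p_out. replace p with z; [exact Gz|].
  assert (SMALL : forall e, 0 < e -> Cmod (fst p - fst z) <= e /\ Cmod (snd p - snd z) <= e).
  { intros e He.
    assert (E2 : 0 < e / (2 * (8 * M + 1))) by (apply Rdiv_lt_0_compat; lra).
    apply is_lim_seq_spec in L. destruct (L (mkposreal _ E2)) as [N1 H1].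
    destruct (s_lim (e / 2)) as [N2 H2]; [lra|].
    set (n := (N1 + N2)%nat). specialize (H1 n ltac:(unfold n; lia)). destruct (H2 n ltac:(unfold n; lia)) as [B1 B2].
    simpl in H1. rewrite Rminus_0_r in H1. apply Rabs_def2 in H1.
    destruct (Hch n z Gz) as [r Hr]. destruct (kobayashi_lower_bound _ _ _ M_nonneg Hr) as [K1 K2].
    assert (K3 : 8 * M * kobayashi G (s n) z <= e / 2).
    { apply Rle_trans with (8 * M * (e / (2 * (8 * M + 1)))); [apply Rmult_le_compat_l; lra|].
      replace (e / 2) with ((8 * M + 1) * (e / (2 * (8 * M + 1)))) by (field; lra).
      apply Rmult_le_compat_r; lra. }
    assert (T : forall u v w : C, Cmod (u - v) < e / 2 -> Cmod (u - w) <= e / 2 -> Cmod (v - w) <= e).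
    { intros u v w A B. assert (T := Cmod_minus_triangle v u w). rewrite (Cmod_minus_sym v u) in T. lra. }
    split.
    - apply (T (fst (s n))); [exact B1|]. eapply Rle_trans; [exact K1|exact K3].
    - apply (T (snd (s n))); [exact B2|]. eapply Rle_trans; [exact K2|exact K3]. }
  assert (Q : forall a b : C, (forall e, 0 < e -> Cmod (a - b) <= e) -> b = a).
  { intros a b H. assert (E : (a - b = 0)%C).
    { apply Cmod_eq_0. apply Rle_antisym; [|apply Cmod_ge_0]. apply Rnot_lt_le. intros X.
      specialize (H (Cmod (a - b) / 2)). lra. }
    replace a with (a - b + b)%C by ring. rewrite E. ring. }
  apply C2_ext; apply Q; intros e He; now apply SMALL.
Qed.

(** The path has length at most [2 * c], so it stays in one ball about its first point; a compact
    set containing this ball would also contain the limit [p]. *)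
Lemma path_not_finitely_compact : ~ kobayashi_finitely_compact G.
Proof.
  intros HF.
  assert (c0 := step_constant_nonneg).
  destruct (HF (s O) (2 * c + 1) (s_in O)) as (K & HK & KG & HB); [lra|].
  apply p_out, KG. apply compact_adherent; [exact HK|]. intros e He.
  destruct (s_lim e He) as [N HN]. exists (s N). split; [|now apply HN].
  apply HB. split; [apply s_in|]. destruct (path_chain_any O N) as (r & R & C1).
  eapply Rle_lt_trans; [apply (kobayashi_le_chain _ _ _ C1)|].
  assert (X : Rmax ((1 / 2) ^ 0) ((1 / 2) ^ N) <= 1) by (apply Rmax_lub; apply half_pow_le_1).
  assert (2 * c * Rmax ((1 / 2) ^ 0) ((1 / 2) ^ N) <= 2 * c * 1) by (apply Rmult_le_compat_l; lra). lra.
Qed.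
End Path.

(** By openness some [q * x] with [q > 1] is still in [G]; the disc [l * q * x] passes through the
    origin and, at [/ q], through [x]. *)
Lemma balanced_disc x : balanced G -> open G -> G x -> exists r, joined_by_disc G x origin r.
Proof.
  intros HB HO Gx.
  assert (E : exists q, 1 < q /\ G (scal (RtoC q : C_AbsRing) x)).
  { destruct (proj1 (open_C2 G) HO x Gx) as (r & Hr & H).
    set (K := Cmod (fst x) + Cmod (snd x) + 1).
    pose proof (Cmod_ge_0 (fst x)). pose proof (Cmod_ge_0 (snd x)).
    assert (KP : 0 < K) by (unfold K; lra). assert (RK : 0 < r / K) by now apply Rdiv_lt_0_compat.
    exists (1 + r / K). split; [lra|]. apply H.
    assert (Q : forall a : C, Cmod a < K -> Cmod (RtoC (1 + r / K) * a - a) < r).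
    { intros a Ha. replace (RtoC (1 + r / K) * a - a)%C with (RtoC (r / K) * a)%C by (rewrite RtoC_plus; ring).
      rewrite Cmod_mult, Cmod_R, Rabs_pos_eq by lra.
      apply Rlt_le_trans with (r / K * K); [|right; field; lra]. apply Rmult_lt_compat_l; lra. }
    assert (K1 : Cmod (fst x) < K) by (unfold K; lra). assert (K2 : Cmod (snd x) < K) by (unfold K; lra).
    split; [exact (Q (fst x) K1)|exact (Q (snd x) K2)]. }
  destruct E as (q & Hq & Gq).
  exists (poincare_dist (RtoC (/ q)) (RtoC 0)).
  assert (IQ : 0 < / q < 1) by (split; [apply Rinv_0_lt_compat; lra|rewrite <- Rinv_1; apply Rinv_lt_contravar; lra]).
    exists (fun l => plus origin (scal (l : C_AbsRing) (scal (RtoC q : C_AbsRing) x))), (RtoC (/ q)), (RtoC 0).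
    assert (Z : disc (RtoC 0)) by (unfold disc; rewrite Cmod_0; lra).
    assert (Q1 : forall a : C, (0 + RtoC (/ q) * (RtoC q * a) = a)%C).
    { intros a. rewrite RtoC_inv by lra. field. intros F. apply RtoC_inj in F. lra. }
    assert (Q2 : forall a : C, (0 + 0 * a = 0)%C) by (intros; ring).
    assert (Q3 : forall a : C, (0 + a = a)%C) by (intros; ring).
    repeat split.
    - replace (plus origin (scal (l : C_AbsRing) (scal (RtoC q : C_AbsRing) x))) with (scal (l : C_AbsRing) (scal (RtoC q : C_AbsRing) x)).
      + apply HB; [unfold disc in H; lra|exact Gq].
      + apply C2_ext; symmetry; apply Q3.
    - apply affine_disc_derive.
    - unfold disc. rewrite Cmod_R, Rabs_pos_eq; lra.
    - exact Z.
    - apply C2_ext; apply Q1.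
    - apply C2_ext; apply Q2.
    - apply Rle_refl.
Qed.

Lemma balanced_chain x y : balanced G -> open G -> G x -> G y -> exists r, kobayashi_chain G x y r.
Proof.
  intros HB HO Gx Gy.
  destruct (balanced_disc x HB HO Gx) as [r J1]. destruct (balanced_disc y HB HO Gy) as [s J2].
  destruct (chain_of_disc _ _ _ J1) as (r' & _ & C1 & _).
  destruct (chain_extend _ _ _ _ _ C1 (joined_by_disc_sym _ _ _ J2)) as (q & _ & C2). now exists q.
Qed.
End Kobayashi.

(** * The polynomials *)

Lemma holomorphic_at_pow f n z : holomorphic_at f z -> holomorphic_at (fun w => Cpow (f w) n) z.
Proof.
  intros H. induction n as [|n IH]; simpl; [apply holomorphic_at_const|now apply holomorphic_at_mult].
Qed.

Lemma Rpow_S_le_1 a n : 0 <= a <= 1 -> (1 <= n)%nat -> a ^ n <= a.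
Proof.
  intros Ha Hn. destruct n as [|n]; [lia|]. simpl.
  assert (a ^ n <= 1) by (rewrite <- (pow1 n); apply pow_incr; lra).
  assert (0 <= a ^ n) by (apply pow_le; lra). nra.
Qed.

Lemma INR_lt_pow2 n : INR n + 1 <= 2 ^ n.
Proof.
  induction n as [|n IH]; [simpl; lra|]. rewrite S_INR. change (2 ^ S n) with (2 * 2 ^ n).
  pose proof (pos_INR n). lra.
Qed.

Section Family.
Variables (x q m : nat -> nat).
Hypothesis m_0 : m 0 = 2%nat.
Hypothesis m_S : forall N, m (S N) = (m N * (4 * q (S N)))%nat.
Hypothesis x_double : forall N, (2 * x N <= x (S N))%nat.
Hypothesis x_linear : forall N, (2 * N + 1 <= x N)%nat.
Hypothesis q_large : forall N, (x N + N + 2 <= q N)%nat.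
Hypothesis q_dominates : forall N, (2 ^ N * x N <= q N)%nat.
Hypothesis q_mono : forall N, (q N <= q (S N))%nat.

(** In the notation of the overview, [slope N] is [b_N], [scale N] is [c_N], and [n] is
    [4 * q (S N)]. Powers of 2 reduce all size comparisons to natural exponents. *)
Definition slope (N : nat) : R := 2 ^ q N.
Definition scale (N : nat) : R := (/ 2) ^ x N.

Definition line_form (N : nat) (z : C2) : C := (fst z - RtoC (2 ^ q N) * snd z)%C.

(* [root_product N] has degree [m N - 1]. The exponent [4 * q (S N) - 2] of [fst z] leaves room for the two
   new linear forms in [level_poly (S N)], which then has the degree of [level_poly N] to the power [4 * q (S N)]. *)
Fixpoint root_product (N : nat) (z : C2) : C :=
  match N with
  | O => line_form 0 z
  | S N => (Cpow (root_product N z) (4 * q (S N)) *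
      (Cpow (fst z) (4 * q (S N) - 2) * line_form (S N) z))%C
  end.

Definition level_poly (N : nat) (z : C2) : C :=
  (RtoC ((/ 2) ^ x N) * (root_product N z * line_form N z))%C.

(** The coordinate [snd z] bounds the hull in the second direction; it shifts the levels by one
    index. *)
Definition poly_family (n : nat) (z : C2) : C :=
  match n with O => snd z | S N => level_poly N z end.

Definition poly_degree (n : nat) : nat := match n with O => 1%nat | S N => m N end.

(** [2 ^ x N] undoes the constant of [level_poly N], so at [(u, 0)] the weighted modulus is
    [(N + 1) * |u| ^ m N], unbounded in [N] when [|u| >= 1]. *)
Definition poly_weight (n : nat) : R := match n with O => 1 | S N => (INR N + 1) * 2 ^ x N end.

Lemma q_pos N : (2 <= q N)%nat.
Proof. pose proof (q_large N). lia. Qed.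

Lemma m_ge_2 N : (2 <= m N)%nat.
Proof.
  induction N as [|N IH]; [now rewrite m_0|]. rewrite m_S. pose proof (q_pos (S N)). nia.
Qed.

Lemma pred_m_S N : pred (m (S N)) = (pred (m N) * (4 * q (S N)) + ((4 * q (S N) - 2) + 1))%nat.
Proof.
  rewrite m_S. pose proof (m_ge_2 N). pose proof (q_pos (S N)). destruct (m N) as [|r]; [lia|]. simpl pred. nia.
Qed.

Lemma m_ge_q N : (4 * q (S N) <= m (S N))%nat.
Proof. rewrite m_S. pose proof (m_ge_2 N). nia. Qed.

Lemma slope_ge_1 N : 1 <= slope N.
Proof. apply pow_R1_Rle. lra. Qed.

Lemma slope_pos N : 0 < slope N.
Proof. pose proof (slope_ge_1 N). lra. Qed.

Lemma slope_mono N : slope N <= slope (S N).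
Proof. apply Rle_pow; [lra|apply q_mono]. Qed.

Lemma scale_pos N : 0 < scale N.
Proof. apply pow_lt. lra. Qed.

Lemma scale_le_1 N : scale N <= 1.
Proof. unfold scale. rewrite <- (pow1 (x N)). apply pow_incr. lra. Qed.

Lemma scale_inv N : scale N * 2 ^ x N = 1.
Proof. unfold scale. rewrite <- Rpow_mult_distr, Rinv_l by lra. apply pow1. Qed.

Lemma line_form_homogeneous N (l : C) z : line_form N (scal (l : C_AbsRing) z) = (l * line_form N z)%C.
Proof.
  unfold line_form. assert (Q : forall u v : C, (l * u - RtoC (2 ^ q N) * (l * v) = l * (u - RtoC (2 ^ q N) * v))%C) by (intros; ring).
  exact (Q (fst z) (snd z)).
Qed.

Lemma Cpow_mult_l (u v : C) n : Cpow (u * v) n = (Cpow u n * Cpow v n)%C.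
Proof. induction n as [|n IH]; simpl; [ring|]. rewrite IH. ring. Qed.

Lemma Cpow_add (u : C) n k : Cpow u (n + k) = (Cpow u n * Cpow u k)%C.
Proof. induction n as [|n IH]; simpl; [ring|]. rewrite IH. ring. Qed.

Lemma Cpow_mult_r (u : C) n k : Cpow u (n * k) = Cpow (Cpow u n) k.
Proof.
  induction k as [|k IH]; [now rewrite Nat.mul_0_r|].
  rewrite Nat.mul_succ_r, Nat.add_comm, Cpow_add, IH. reflexivity.
Qed.

Lemma root_product_homogeneous N (l : C) z :
  root_product N (scal (l : C_AbsRing) z) = (Cpow l (pred (m N)) * root_product N z)%C.
Proof.
  induction N as [|N IH].
  - rewrite m_0. simpl. rewrite line_form_homogeneous. ring.
  - cbn [root_product]. rewrite IH, line_form_homogeneous.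
    change (fst (scal (l : C_AbsRing) z)) with (l * fst z)%C.
    rewrite !Cpow_mult_l, <- Cpow_mult_r.
    rewrite pred_m_S, !Cpow_add. simpl (Cpow l 1). ring.
Qed.

Lemma level_poly_homogeneous N (l : C) z :
  level_poly N (scal (l : C_AbsRing) z) = (Cpow l (m N) * level_poly N z)%C.
Proof.
  unfold level_poly. rewrite root_product_homogeneous, line_form_homogeneous.
  pose proof (m_ge_2 N). destruct (m N) as [|r]; [lia|]. simpl. ring.
Qed.

Lemma line_form_holomorphic N z : holomorphic_at (line_form N) z.
Proof.
  apply (holomorphic_at_minus (fun w : C2 => fst w)); [apply fst_holomorphic|].
  apply holomorphic_at_mult; [apply holomorphic_at_const|apply snd_holomorphic].
Qed.

Lemma root_product_holomorphic N z : holomorphic_at (root_product N) z.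
Proof.
  induction N as [|N IH]; [apply line_form_holomorphic|]. cbn [root_product].
  apply holomorphic_at_mult; [now apply holomorphic_at_pow|].
  apply holomorphic_at_mult; [|apply line_form_holomorphic].
  apply (holomorphic_at_pow (fun w : C2 => fst w)), fst_holomorphic.
Qed.

Lemma level_poly_holomorphic N z : holomorphic_at (level_poly N) z.
Proof.
  apply holomorphic_at_mult; [apply holomorphic_at_const|].
  apply holomorphic_at_mult; [apply root_product_holomorphic|apply line_form_holomorphic].
Qed.

Lemma Cmod_level_poly N z : Cmod (level_poly N z) = scale N * (Cmod (root_product N z) * Cmod (line_form N z)).
Proof.
  unfold level_poly. rewrite !Cmod_mult, Cmod_R, Rabs_pos_eq; [reflexivity|]. left. apply scale_pos.
Qed.

Lemma Cmod_root_product_S N z : Cmod (root_product (S N) z) =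
  Cmod (root_product N z) ^ (4 * q (S N)) * (Cmod (fst z) ^ (4 * q (S N) - 2) * Cmod (line_form (S N) z)).
Proof. cbn [root_product]. now rewrite !Cmod_mult, !Cmod_pow. Qed.

Lemma axis_level_poly N u : Cmod (level_poly N ((u, RtoC 0) : C2)) = scale N * Cmod u ^ m N.
Proof.
  assert (Q : forall k, line_form k ((RtoC 1, RtoC 0) : C2) = RtoC 1).
  { intros k. assert (Q : forall v c : C, (v - c * RtoC 0 = v)%C) by (intros; ring). apply Q. }
  assert (R1 : Cmod (root_product N ((RtoC 1, RtoC 0) : C2)) = 1).
  { induction N as [|N IH]; [simpl root_product; rewrite Q; apply Cmod_1|].
    rewrite Cmod_root_product_S, IH, Q. simpl fst. rewrite Cmod_1, !pow1. ring. }
  assert (E : ((u, RtoC 0) : C2) = scal (u : C_AbsRing) ((RtoC 1, RtoC 0) : C2)).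
  { assert (Q1 : forall v : C, (v = v * RtoC 1)%C) by (intros; ring).
    assert (Q2 : forall v : C, (RtoC 0 = v * RtoC 0)%C) by (intros; ring). apply C2_ext; [apply Q1|apply Q2]. }
  rewrite E, level_poly_homogeneous, Cmod_mult, Cmod_pow, Cmod_level_poly, R1, Q, Cmod_1. ring.
Qed.

(** Reason for the factor 4 in the exponent [4 * q (S N)]: the power of 3 gained from the small
    first coordinate must absorb the squared bound [3 * slope (S N)] for the new linear form. *)
Lemma q_power_gap n : (2 <= n)%nat -> 9 * (2 ^ n * 2 ^ n) <= 3 ^ (4 * n - 2).
Proof.
  intros Hn. induction n as [|n IH]; [lia|]. destruct (Nat.eq_dec n 1) as [->|Ne].
  - simpl. lra.
  - specialize (IH ltac:(lia)). replace (4 * S n - 2)%nat with (4 + (4 * n - 2))%nat by lia.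
    rewrite pow_add. change (2 ^ S n) with (2 * 2 ^ n).
    assert (0 < 2 ^ n * 2 ^ n) by (apply Rmult_lt_0_compat; apply pow_lt; lra).
    replace (3 ^ 4) with 81 by ring. lra.
Qed.

(** Let [A], [B], [B'] be the moduli of [z1] and of the old and new linear forms. In the region
    considered [slope N * |z2|] dominates, so [A <= scale N * B / 3] and
    [B' <= 3 * slope (S N) * B]. Replacing [n - 2] factors [scale N * B] by [A] gains [3 ^ (n - 2)],
    which pays for the two factors [B']; the two remaining factors [scale N] pay for [scale (S N)],
    as [x] at least doubles. *)
Lemma level_poly_contraction N (z : C2) : Cmod (fst z) <= scale N * slope N / 4 * Cmod (snd z) ->
  Cmod (level_poly (S N) z) <= Cmod (level_poly N z) ^ (4 * q (S N)).
Proof.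
  intros H. rewrite !Cmod_level_poly, Cmod_root_product_S.
  set (A := Cmod (fst z)) in *. set (t := Cmod (snd z)) in *. set (n := (4 * q (S N))%nat).
  set (B := Cmod (line_form N z)). set (B' := Cmod (line_form (S N) z)). set (rho := Cmod (root_product N z)).
  assert (A0 : 0 <= A) by apply Cmod_ge_0. assert (t0 : 0 <= t) by apply Cmod_ge_0.
  assert (B0 : 0 <= B) by apply Cmod_ge_0. assert (B0' : 0 <= B') by apply Cmod_ge_0.
  assert (rho0 : 0 <= rho) by apply Cmod_ge_0.
  assert (k0 := scale_pos N). assert (k1 := scale_le_1 N). assert (b1 := slope_ge_1 N). assert (bm := slope_mono N).
  assert (LB : slope N * t <= B + A).
  { assert (T : Cmod (RtoC (slope N) * snd z) <= Cmod (- line_form N z) + Cmod (fst z)).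
    { replace (RtoC (slope N) * snd z)%C with (- line_form N z + fst z)%C.
      - apply Cmod_triangle.
      - unfold line_form. fold (slope N). assert (Q : forall u v : C, (- (u - RtoC (slope N) * v) + u = RtoC (slope N) * v)%C) by (intros; ring). apply Q. }
    rewrite Cmod_opp, Cmod_mult, Cmod_R, Rabs_pos_eq in T by lra. exact T. }
  assert (UB : B' <= slope (S N) * t + A).
  { assert (T : Cmod (line_form (S N) z) <= Cmod (fst z) + Cmod (- (RtoC (slope (S N)) * snd z))).
    { apply Cmod_triangle. }
    rewrite Cmod_opp, Cmod_mult, Cmod_R, Rabs_pos_eq in T by (left; apply slope_pos). unfold B', t, A. lra. }
  assert (bt : 0 <= slope N * t) by (apply Rmult_le_pos; lra).
  assert (Akb : A <= scale N * (slope N * t) / 4) by lra.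
  assert (kb : scale N * (slope N * t) <= slope N * t) by (rewrite <- (Rmult_1_l (slope N * t)) at 2; apply Rmult_le_compat_r; lra).
  assert (LB2 : 3 / 4 * (slope N * t) <= B) by lra.
  assert (A3 : A <= scale N * B * / 3).
  { assert (scale N * (3 / 4 * (slope N * t)) <= scale N * B) by (apply Rmult_le_compat_l; lra). lra. }
  assert (tB : t <= 4 / 3 * B) by (assert (t <= slope N * t) by (rewrite <- (Rmult_1_l t) at 1; apply Rmult_le_compat_r; lra); lra).
  assert (UB2 : B' <= 3 * slope (S N) * B).
  { assert (At : A <= slope (S N) * t / 4).
    { assert (slope N * t <= slope (S N) * t) by (apply Rmult_le_compat_r; lra). lra. }
    assert (slope (S N) * t <= slope (S N) * (4 / 3 * B)) by (apply Rmult_le_compat_l; lra).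
    assert (0 <= slope (S N) * B) by (apply Rmult_le_pos; lra). lra. }
  assert (nq : (n = 2 + (n - 2))%nat) by (unfold n; pose proof (q_pos (S N)); lia).
  assert (K2 : scale (S N) <= scale N * scale N).
  { unfold scale. rewrite <- pow_add. replace (x (S N)) with ((x N + x N) + (x (S N) - (x N + x N)))%nat by (pose proof (x_double N); lia).
    rewrite (pow_add (/ 2) (x N + x N)). rewrite <- (Rmult_1_r ((/ 2) ^ (x N + x N))) at 2.
    apply Rmult_le_compat_l; [apply pow_le; lra|]. rewrite <- (pow1 (x (S N) - (x N + x N))). apply pow_incr; lra. }
  replace (scale (S N) * (rho ^ n * (A ^ (n - 2) * B') * B')) with (rho ^ n * (scale (S N) * (A ^ (n - 2) * (B' * B')))) by ring.
  rewrite !Rpow_mult_distr. replace (scale N ^ n * (rho ^ n * B ^ n)) with (rho ^ n * (scale N ^ n * B ^ n)) by ring.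
  apply Rmult_le_compat_l; [now apply pow_le|].
  rewrite nq at 2 3. rewrite !pow_add.
  assert (E1 : A ^ (n - 2) <= scale N ^ (n - 2) * B ^ (n - 2) * / 3 ^ (n - 2)).
  { rewrite <- pow_inv, <- !Rpow_mult_distr. apply pow_incr. lra. }
  assert (E2 : B' * B' <= 9 * (slope (S N) * slope (S N)) * (B * B)).
  { replace (9 * (slope (S N) * slope (S N)) * (B * B)) with ((3 * slope (S N) * B) * (3 * slope (S N) * B)) by ring.
    apply Rmult_le_compat; assumption. }
  assert (E3 : 9 * (slope (S N) * slope (S N)) <= 3 ^ (n - 2)) by (apply q_power_gap, q_pos).
  assert (P3 : 0 < 3 ^ (n - 2)) by (apply pow_lt; lra).
  set (X := scale N ^ (n - 2) * B ^ (n - 2)) in *.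
  assert (X0 : 0 <= X) by (apply Rmult_le_pos; apply pow_le; lra).
  assert (E4 : A ^ (n - 2) * (B' * B') <= X * (B * B)).
  { apply Rle_trans with (X * / 3 ^ (n - 2) * (3 ^ (n - 2) * (B * B))).
    - apply Rmult_le_compat; [now apply pow_le|nra|exact E1|].
      eapply Rle_trans; [exact E2|]. apply Rmult_le_compat_r; [nra|exact E3].
    - right. field. lra. }
  replace (scale N ^ 2 * scale N ^ (n - 2) * (B ^ 2 * B ^ (n - 2))) with ((scale N * scale N) * (X * (B * B))) by (unfold X; ring).
  apply Rmult_le_compat; [left; apply scale_pos| |exact K2|exact E4].
  apply Rmult_le_pos; [now apply pow_le|nra].
Qed.

(** * Growth of the polynomials near the axis *)

Fixpoint partial_sum (e : nat -> R) (N : nat) : R :=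
  match N with O => e O | S N => partial_sum e N + e (S N) end.

Lemma partial_sum_ge e N : (forall k, 0 <= e k) -> 0 <= partial_sum e N /\ e N <= partial_sum e N.
Proof.
  intros He. induction N as [|N [I1 I2]]; simpl; [pose proof (He O); lra|]. pose proof (He (S N)). lra.
Qed.

Lemma line_form_growth k r rho (z : C2) : 0 <= r -> Cmod (fst z) <= r -> Cmod (snd z) <= rho * r ->
  Cmod (line_form k z) <= r * (1 + slope k * rho).
Proof.
  intros Hr H1 H2.
  assert (T : Cmod (line_form k z) <= Cmod (fst z) + Cmod (- (RtoC (slope k) * snd z))) by apply Cmod_triangle.
  rewrite Cmod_opp, Cmod_mult, Cmod_R, Rabs_pos_eq in T by (left; apply slope_pos).
  assert (slope k * Cmod (snd z) <= slope k * (rho * r)) by (apply Rmult_le_compat_l; [left; apply slope_pos|exact H2]).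
  lra.
Qed.

Lemma exp_INR_mult n y : exp y ^ n = exp (INR n * y).
Proof.
  induction n as [|n IH]; [simpl; rewrite Rmult_0_l, exp_0; reflexivity|].
  rewrite S_INR, <- tech_pow_Rmult, IH, <- exp_plus. f_equal. ring.
Qed.

(* [m k * e k] bounds the logarithm of the growth factor [1 + slope k * rho] of the [k]-th linear form,
   which occurs [m N / m k] times in [root_product N]. *)
Lemma root_product_growth e r rho (z : C2) N : 0 <= r -> 0 <= rho -> Cmod (fst z) <= r -> Cmod (snd z) <= rho * r ->
  (forall k, 0 <= e k) -> (forall k, (k <= N)%nat -> 1 + slope k * rho <= exp (INR (m k) * e k)) ->
  Cmod (root_product N z) <= r ^ pred (m N) * exp (INR (m N) * partial_sum e N).
Proof.
  intros Hr Hrho H1 H2 He. induction N as [|N IH]; intros HE.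
  - rewrite m_0. simpl pred. rewrite pow_1. simpl root_product. simpl partial_sum.
    eapply Rle_trans; [apply (line_form_growth 0 r rho); assumption|]. apply Rmult_le_compat_l; [exact Hr|].
    rewrite <- m_0. apply HE. lia.
  - rewrite Cmod_root_product_S. specialize (IH ltac:(intros; apply HE; lia)).
    set (n := (4 * q (S N))%nat).
    rewrite pred_m_S. fold n. rewrite !pow_add, pow_1, pow_mult.
    simpl partial_sum. rewrite Rmult_plus_distr_l, exp_plus.
    replace (exp (INR (m (S N)) * partial_sum e N)) with (exp (INR (m N) * partial_sum e N) ^ n).
    2:{ rewrite exp_INR_mult, m_S, mult_INR. fold n. f_equal. ring. }
    replace ((r ^ pred (m N)) ^ n * (r ^ (n - 2) * r) * (exp (INR (m N) * partial_sum e N) ^ n * exp (INR (m (S N)) * e (S N))))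
      with ((r ^ pred (m N) * exp (INR (m N) * partial_sum e N)) ^ n * (r ^ (n - 2) * (r * exp (INR (m (S N)) * e (S N))))).
    2:{ rewrite Rpow_mult_distr. ring. }
    apply Rmult_le_compat.
    + apply pow_le, Cmod_ge_0.
    + apply Rmult_le_pos; [apply pow_le, Cmod_ge_0|apply Cmod_ge_0].
    + apply pow_incr. split; [apply Cmod_ge_0|exact IH].
    + apply Rmult_le_compat; [apply pow_le, Cmod_ge_0|apply Cmod_ge_0| |].
      * apply pow_incr. split; [apply Cmod_ge_0|exact H1].
      * eapply Rle_trans; [apply (line_form_growth (S N) r rho); assumption|].
        apply Rmult_le_compat_l; [exact Hr|]. apply HE. lia.
Qed.

(** The extra linear form in [level_poly N] is charged the same exponent as the whole of
    [root_product N]; hence the factor 2. *)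
Lemma level_poly_growth e r rho (z : C2) N : 0 <= r -> 0 <= rho -> Cmod (fst z) <= r -> Cmod (snd z) <= rho * r ->
  (forall k, 0 <= e k) -> (forall k, (k <= N)%nat -> 1 + slope k * rho <= exp (INR (m k) * e k)) ->
  Cmod (level_poly N z) <= scale N * (r ^ m N * exp (INR (m N) * (2 * partial_sum e N))).
Proof.
  intros Hr Hrho H1 H2 He HE. rewrite Cmod_level_poly. apply Rmult_le_compat_l; [left; apply scale_pos|].
  assert (A := root_product_growth e r rho z N Hr Hrho H1 H2 He HE).
  assert (B := line_form_growth N r rho z Hr H1 H2).
  destruct (partial_sum_ge e N He) as [S0 S1].
  assert (D : 1 + slope N * rho <= exp (INR (m N) * partial_sum e N)).
  { eapply Rle_trans; [apply HE; lia|].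
    assert (L : INR (m N) * e N <= INR (m N) * partial_sum e N) by (apply Rmult_le_compat_l; [apply pos_INR|exact S1]).
    destruct L as [L|L]; [left; now apply exp_increasing|rewrite L; lra]. }
  replace (r ^ m N * exp (INR (m N) * (2 * partial_sum e N))) with
    ((r ^ pred (m N) * exp (INR (m N) * partial_sum e N)) * (r * exp (INR (m N) * partial_sum e N))).
  - apply Rmult_le_compat; try apply Cmod_ge_0; [exact A|]. eapply Rle_trans; [exact B|]. now apply Rmult_le_compat_l.
  - replace (INR (m N) * (2 * partial_sum e N)) with (INR (m N) * partial_sum e N + INR (m N) * partial_sum e N) by ring.
    rewrite exp_plus. pose proof (m_ge_2 N). destruct (m N) as [|k]; [lia|]. simpl pred. rewrite <- tech_pow_Rmult. ring.
Qed.

(** Since [q N >= 2 ^ N * x N], the power is eventually at most [(1 / 4) ^ x N]. One factor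
    [(1 / 2) ^ x N] cancels [2 ^ x N]; the other, by [x N >= 2 * N + 1], absorbs [N + 1] and leaves
    [(1 / 2) ^ S N]. *)
Lemma weighted_power_small th : 0 <= th < 1 -> exists N0, forall N, (N0 <= N)%nat ->
  poly_weight (S N) * th ^ (4 * q N) <= (1 / 2) ^ S N.
Proof.
  intros Ht. destruct (pow_lt_1_zero th) with (y := 1 / 4) as [N0 H0].
  { rewrite Rabs_pos_eq; lra. } { lra. }
  exists N0. intros N HN. simpl poly_weight.
  assert (E1 : th ^ (4 * q N) <= (1 / 4) ^ x N).
  { assert (A : th ^ (4 * 2 ^ N) <= 1 / 4).
    { assert (G : (N <= 2 ^ N)%nat) by (pose proof (Nat.pow_gt_lin_r 2 N); lia).
      specialize (H0 (4 * 2 ^ N)%nat ltac:(lia)). rewrite Rabs_pos_eq in H0 by (apply pow_le; lra). lra. }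
    replace (4 * q N)%nat with ((4 * 2 ^ N) * x N + (4 * q N - (4 * 2 ^ N) * x N))%nat by (pose proof (q_dominates N); nia).
    rewrite pow_add, pow_mult. rewrite <- (Rmult_1_r ((1 / 4) ^ x N)).
    apply Rmult_le_compat; try (apply pow_le; try apply pow_le; lra).
    - apply pow_incr. split; [apply pow_le; lra|exact A].
    - rewrite <- (pow1 (4 * q N - (4 * 2 ^ N) * x N)). apply pow_incr; lra. }
  assert (E2 : (1 / 4) ^ x N = (1 / 2) ^ x N * (1 / 2) ^ x N) by (rewrite <- Rpow_mult_distr; f_equal; field).
  assert (E3 : 2 ^ x N * (1 / 2) ^ x N = 1) by (rewrite <- Rpow_mult_distr; replace (2 * (1 / 2)) with 1 by field; apply pow1).
  assert (E4 : (1 / 2) ^ x N <= (1 / 2) ^ N * (1 / 2) ^ S N).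
  { rewrite <- pow_add. replace (x N) with ((N + S N) + (x N - (N + S N)))%nat by (pose proof (x_linear N); lia).
    rewrite (pow_add _ (N + S N)). rewrite <- (Rmult_1_r ((1 / 2) ^ (N + S N))) at 2.
    apply Rmult_le_compat_l; [apply pow_le; lra|apply half_pow_le_1]. }
  assert (E5 : (INR N + 1) * (1 / 2) ^ N <= 1).
  { apply Rle_trans with (2 ^ N * (1 / 2) ^ N).
    - apply Rmult_le_compat_r; [apply pow_le; lra|apply INR_lt_pow2].
    - rewrite <- Rpow_mult_distr. replace (2 * (1 / 2)) with 1 by field. rewrite pow1. lra. }
  assert (P2 : 0 < 2 ^ x N) by (apply pow_lt; lra). assert (PN := pos_INR N).
  apply Rle_trans with ((INR N + 1) * 2 ^ x N * ((1 / 2) ^ x N * (1 / 2) ^ x N)).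
  { apply Rmult_le_compat_l; [apply Rmult_le_pos; lra|]. rewrite <- E2. exact E1. }
  replace ((INR N + 1) * 2 ^ x N * ((1 / 2) ^ x N * (1 / 2) ^ x N)) with
    ((2 ^ x N * (1 / 2) ^ x N) * ((INR N + 1) * (1 / 2) ^ x N)) by ring.
  rewrite E3, Rmult_1_l.
  apply Rle_trans with ((INR N + 1) * ((1 / 2) ^ N * (1 / 2) ^ S N)); [apply Rmult_le_compat_l; lra|].
  rewrite <- Rmult_assoc. rewrite <- (Rmult_1_l ((1 / 2) ^ S N)) at 2.
  apply Rmult_le_compat_r; [apply pow_le; lra|exact E5].
Qed.

(** Consequently every point off the axis, with a neighborhood, lies in the contraction regions of
    all large levels. *)
Lemma contraction_region N : 2 ^ N <= scale N * slope N / 4.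
Proof.
  unfold slope. replace (q N) with (x N + (N + 2 + (q N - (x N + N + 2))))%nat by (pose proof (q_large N); lia).
  rewrite pow_add, <- Rmult_assoc, scale_inv, Rmult_1_l, !pow_add.
  assert (1 <= 2 ^ (q N - (x N + N + 2))) by (apply pow_R1_Rle; lra).
  assert (0 < 2 ^ N) by (apply pow_lt; lra). replace (2 ^ 2) with 4 by ring. nra.
Qed.

Lemma exp_le_compat u v : u <= v -> exp u <= exp v.
Proof. intros [H| ->]; [left; now apply exp_increasing|lra]. Qed.

Lemma pow2_le_exp n : 2 ^ n <= exp (INR n).
Proof.
  rewrite <- (Rmult_1_r (INR n)), <- exp_INR_mult. apply pow_incr.
  pose proof (exp_ineq1_le 1). lra.
Qed.

Lemma m_double N : 2 * INR (m N) <= INR (m (S N)).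
Proof.
  rewrite m_S, mult_INR. pose proof (pos_INR (m N)). pose proof (q_pos (S N)).
  assert (2 <= INR (4 * q (S N))) by (replace 2 with (INR 2) by reflexivity; apply le_INR; lia). nra.
Qed.

Lemma m_INR_pos N : 2 <= INR (m N).
Proof. replace 2 with (INR 2) by reflexivity. apply le_INR, m_ge_2. Qed.

(** The exponent on the right equals [2 * q (S k)], enough for [1 + 2 ^ q (S k)]. As the degree
    already contains the factor [q], the cost per degree is only [1 / (2 * m k)], however steep the
    line. *)
Lemma tail_growth k rho : 0 <= rho <= 1 -> 1 + slope (S k) * rho <= exp (INR (m (S k)) * / (2 * INR (m k))).
Proof.
  intros Hr. pose proof (m_INR_pos k).
  replace (INR (m (S k)) * / (2 * INR (m k))) with (INR (q (S k)) + INR (q (S k))).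
  2:{ rewrite m_S, !mult_INR. replace (INR 4) with 4 by (simpl; ring). field. lra. }
  rewrite exp_plus. pose proof (pow2_le_exp (q (S k))). fold (slope (S k)) in *.
  assert (B := slope_ge_1 (S k)).
  assert (B2 : 2 <= slope (S k)).
  { unfold slope. pose proof (q_pos (S k)). replace (q (S k)) with (1 + (q (S k) - 1))%nat by lia.
    rewrite pow_add, pow_1. assert (1 <= 2 ^ (q (S k) - 1)) by (apply pow_R1_Rle; lra). lra. }
  nra.
Qed.

Lemma partial_sum_mono e N K : (forall k, 0 <= e k) -> (N <= K)%nat -> partial_sum e N <= partial_sum e K.
Proof.
  intros He L. induction L as [|K L IH]; [lra|]. simpl. pose proof (He (S K)). lra.
Qed.

(** Degrees at least double, so [1 / (2 * m k) <= 1 / m k - 1 / m (S k)] and the tail telescopes. *)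
Lemma partial_sum_tail e K S0 N : (forall k, 0 <= e k) -> partial_sum e K <= S0 ->
  (forall k, (K <= k)%nat -> e (S k) <= / (2 * INR (m k))) -> partial_sum e N <= S0 + / INR (m K).
Proof.
  intros He H0 HT.
  assert (MP : forall k, 0 < / INR (m k)) by (intros k; apply Rinv_0_lt_compat; pose proof (m_INR_pos k); lra).
  destruct (Compare_dec.le_lt_dec N K) as [L|L].
  - assert (A := partial_sum_mono e N K He L). pose proof (MP K). lra.
  - assert (F : forall d, partial_sum e (K + d) <= S0 + / INR (m K) - / INR (m (K + d))).
    { induction d as [|d IH]; [rewrite Nat.add_0_r; lra|]. rewrite Nat.add_succ_r. simpl partial_sum.
      specialize (HT (K + d)%nat ltac:(lia)).
      assert (D := m_double (K + d)). assert (P := m_INR_pos (K + d)).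
      assert (I : / INR (m (S (K + d))) <= / (2 * INR (m (K + d)))) by (apply Rinv_le_contravar; lra).
      assert (J : / INR (m (K + d)) = / (2 * INR (m (K + d))) + / (2 * INR (m (K + d)))) by (field; lra). lra. }
    specialize (F (N - K)%nat). replace (K + (N - K))%nat with N in F by lia. pose proof (MP N). lra.
Qed.

Lemma partial_sum_const e N y : (forall k, (k <= N)%nat -> e k <= y) -> partial_sum e N <= (INR N + 1) * y.
Proof.
  intros H. induction N as [|N IH]; [simpl; specialize (H O (Nat.le_refl 0)); lra|].
  simpl partial_sum. rewrite S_INR. specialize (IH ltac:(intros; apply H; lia)). specialize (H (S N) (Nat.le_refl _)). lra.
Qed.

Lemma slope_mono_le k K : (k <= K)%nat -> slope k <= slope K.
Proof. intros L. induction L as [|K L IH]; [lra|]. pose proof (slope_mono K). lra. Qed.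

Lemma head_growth k K rho : (k <= K)%nat -> 0 <= rho -> 1 + slope k * rho <= exp (INR (m k) * (slope K * rho)).
Proof.
  intros L Hr. eapply Rle_trans; [apply exp_ineq1_le|]. apply exp_le_compat.
  assert (A := m_INR_pos k). assert (B := slope_mono_le k K L). assert (P := slope_ge_1 k).
  assert (slope k * rho <= slope K * rho) by (apply Rmult_le_compat_r; lra).
  assert (0 <= slope K * rho) by (apply Rmult_le_pos; lra). nra.
Qed.

Lemma inv_pow2_unbounded y : exists N, y < 2 ^ N.
Proof.
  destruct (Rle_lt_dec 0 y) as [H|H].
  - destruct (nfloor_ex y H) as [n Hn]. exists n. pose proof (INR_lt_pow2 n). lra.
  - exists O. simpl. lra.
Qed.

Lemma m_ge_pow2 N : 2 ^ N <= INR (m N).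
Proof.
  induction N as [|N IH]; [pose proof (m_INR_pos 0); simpl; lra|]. pose proof (m_double N).
  change (2 ^ S N) with (2 * 2 ^ N). lra.
Qed.

(** Up to level [K] the exponent is free, to exploit a small ratio [rho] of second to first
    coordinate; beyond [K] it is the summable exponent of [tail_growth], valid for every
    [rho <= 1]. *)
Definition growth_exponent (K : nat) (c : nat -> R) (k : nat) : R :=
  if Compare_dec.le_lt_dec k K then c k else / (2 * INR (m (pred k))).

Lemma growth_exponent_head K c k : (k <= K)%nat -> growth_exponent K c k = c k.
Proof. intros L. unfold growth_exponent. destruct (Compare_dec.le_lt_dec k K); [reflexivity|lia]. Qed.

Lemma growth_exponent_tail K c k : (K <= k)%nat -> growth_exponent K c (S k) = / (2 * INR (m k)).
Proof. intros L. unfold growth_exponent. destruct (Compare_dec.le_lt_dec (S k) K); [lia|reflexivity]. Qed.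

Lemma growth_exponent_nonneg K c : (forall k, 0 <= c k) -> forall k, 0 <= growth_exponent K c k.
Proof.
  intros Hc k. unfold growth_exponent. destruct (Compare_dec.le_lt_dec k K); [apply Hc|].
  left. apply Rinv_0_lt_compat. pose proof (m_INR_pos (pred k)). lra.
Qed.

Lemma growth_exponent_bound K c rho : 0 <= rho <= 1 ->
  (forall k, (k <= K)%nat -> 1 + slope k * rho <= exp (INR (m k) * c k)) ->
  forall k, 1 + slope k * rho <= exp (INR (m k) * growth_exponent K c k).
Proof.
  intros Hr Hc k. destruct (Compare_dec.le_lt_dec k K) as [L|L].
  - rewrite growth_exponent_head by exact L. now apply Hc.
  - destruct k as [|k]; [lia|]. rewrite growth_exponent_tail by lia. now apply tail_growth.
Qed.

Lemma scale_weight_le_1 N y : 0 <= y -> scale N * y <= y.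
Proof. intros Hy. rewrite <- (Rmult_1_l y) at 2. apply Rmult_le_compat_r; [exact Hy|apply scale_le_1]. Qed.

(** A neighborhood lies in all contraction regions from a level [N1] on. There
    [|level_poly N1| <= th < 1], contraction propagates the bound [th], and one further step
    improves it to [th ^ (4 * q)], which beats the weight. *)
Lemma locally_small_off_axis (z : C2) : hull poly_family z -> snd z <> RtoC 0 -> exists r N, 0 < r /\
  forall w n, bidisc z r w -> (N <= n)%nat -> poly_weight n * Cmod (poly_family n w) <= (1 / 2) ^ n.
Proof.
  intros [Hz _] Nz. assert (Tp := Cmod_pos_of_neq _ Nz). set (t := Cmod (snd z)) in *.
  assert (A0 := Cmod_ge_0 (fst z)). set (A := Cmod (fst z)) in *.
  destruct (inv_pow2_unbounded ((A + 1) / (t / 2))) as [N1 HN1].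
  assert (Hp := Hz (S N1)). simpl in Hp. assert (Hp0 := Cmod_ge_0 (level_poly N1 z)).
  set (th := (1 + Cmod (level_poly N1 z)) / 2). assert (Hth : 0 <= th < 1) by (unfold th; lra).
  destruct (holomorphic_at_continuous _ z (level_poly_holomorphic N1 z) (th - Cmod (level_poly N1 z))) as (r1 & Hr1 & D).
  { unfold th. lra. }
  destruct (weighted_power_small th Hth) as [N0 H0].
  (* One successor is the index shift of [poly_family], the other leaves a level for the final
     contraction. *)
  exists (Rmin r1 (Rmin 1 (t / 2))), (S (S (N0 + N1))). split; [repeat apply Rmin_pos; lra|].
  intros w n Hw Hn. destruct n as [|[|n]]; [lia|lia|].
  assert (W := bidisc_le _ _ _ _ (Rmin_r _ _) Hw).
  destruct (bidisc_le _ _ _ _ (Rmin_l _ _) W) as [W1 _]. destruct (bidisc_le _ _ _ _ (Rmin_r _ _) W) as [_ W2].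
  specialize (D w (bidisc_le _ _ _ _ (Rmin_l _ _) Hw)).
  assert (D1 : Cmod (level_poly N1 w) <= th).
  { assert (T := Cmod_le_near (level_poly N1 w) (level_poly N1 z)). lra. }
  assert (F1 : Cmod (fst w) <= A + 1).
  { assert (T := Cmod_le_near (fst w) (fst z)). unfold A. lra. }
  assert (F2 : t / 2 <= Cmod (snd w)).
  { assert (T := Cmod_ge_near (snd w) (snd z)). unfold t in *. lra. }
  assert (REG : forall N, (N1 <= N)%nat -> Cmod (fst w) <= scale N * slope N / 4 * Cmod (snd w)).
  { intros N HN. assert (P := Rle_pow 2 N1 N ltac:(lra) HN). assert (R := contraction_region N).
    assert (X : A + 1 <= 2 ^ N * (t / 2)).
    { apply Rmult_lt_compat_r with (r := t / 2) in HN1; [|lra].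
      replace ((A + 1) / (t / 2) * (t / 2)) with (A + 1) in HN1 by (field; lra). nra. }
    assert (0 < 2 ^ N) by (apply pow_lt; lra).
    assert (2 ^ N * (t / 2) <= scale N * slope N / 4 * Cmod (snd w)) by (apply Rmult_le_compat; lra). lra. }
  assert (TH : forall d, Cmod (level_poly (N1 + d) w) <= th).
  { induction d as [|d IH]; [now rewrite Nat.add_0_r|]. rewrite Nat.add_succ_r.
    eapply Rle_trans; [apply level_poly_contraction, REG; lia|].
    apply Rle_trans with (th ^ (4 * q (S (N1 + d)))).
    - apply pow_incr. split; [apply Cmod_ge_0|exact IH].
    - apply Rpow_S_le_1; [lra|]. pose proof (q_pos (S (N1 + d))). lia. }
  assert (THn := TH (n - N1)%nat). replace (N1 + (n - N1))%nat with n in THn by lia.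
  assert (Fin : Cmod (level_poly (S n) w) <= th ^ (4 * q (S n))).
  { eapply Rle_trans; [apply level_poly_contraction, REG; lia|]. apply pow_incr. split; [apply Cmod_ge_0|exact THn]. }
  specialize (H0 (S n) ltac:(lia)).
  eapply Rle_trans; [|exact H0].
  apply Rmult_le_compat_l; [|exact Fin].
  cbn [poly_weight]. apply Rmult_le_pos; [pose proof (pos_INR (S n)); lra|apply pow_le; lra].
Qed.

(** With [|z1| <= r < th < 1] it suffices that the total growth exponent stays below [ln (th / r)].
    First [K] is chosen to make the tail small, and then [rho], depending on [K], to make the
    finitely many head terms small. *)
Lemma locally_small_on_axis (z : C2) : hull poly_family z -> snd z = RtoC 0 -> exists r N, 0 < r /\
  forall w n, bidisc z r w -> (N <= n)%nat -> poly_weight n * Cmod (poly_family n w) <= (1 / 2) ^ n.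
Proof.
  intros [_ Hz] Ez. specialize (Hz Ez). assert (A0 := Cmod_ge_0 (fst z)). set (A := Cmod (fst z)) in *.
  set (r := (1 + A) / 2). set (th := (1 + r) / 2).
  assert (Hr : 0 < r < 1) by (unfold r; lra). assert (Hth : r < th < 1) by (unfold th; lra).
  set (del := ln (th / r)).
  assert (Hdel : 0 < del).
  { unfold del. rewrite <- ln_1. apply ln_increasing; [lra|]. apply Rlt_div_r; [lra|]. lra. }
  destruct (inv_pow2_unbounded (4 / del)) as [K HK].
  assert (MK : / INR (m K) <= del / 4).
  { assert (4 / del < INR (m K)) by (pose proof (m_ge_pow2 K); lra).
    replace (del / 4) with (/ (4 / del)) by (field; lra). apply Rinv_le_contravar; [apply Rdiv_lt_0_compat; lra|lra]. }
  assert (B := slope_ge_1 K). assert (NK := pos_INR K).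
  assert (BK : 0 < (INR K + 1) * slope K) by (apply Rmult_lt_0_compat; lra).
  set (rho := Rmin 1 (del / (4 * ((INR K + 1) * slope K)))).
  assert (Hrho : 0 < rho <= 1) by (unfold rho; split; [apply Rmin_pos; [lra|apply Rdiv_lt_0_compat; lra]|apply Rmin_l]).
  assert (Hrho2 : (INR K + 1) * (slope K * rho) <= del / 4).
  { assert (rho <= del / (4 * ((INR K + 1) * slope K))) by apply Rmin_r.
    rewrite <- Rmult_assoc. apply Rle_trans with ((INR K + 1) * slope K * (del / (4 * ((INR K + 1) * slope K)))).
    - apply Rmult_le_compat_l; lra.
    - right. field. split; lra. }
  set (e := growth_exponent K (fun _ => slope K * rho)).
  assert (e0 : forall k, 0 <= e k) by (apply growth_exponent_nonneg; intros; apply Rmult_le_pos; lra).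
  assert (eS : forall N, partial_sum e N <= del / 2).
  { intros N. replace (del / 2) with (del / 4 + del / 4) by field.
    apply Rle_trans with (del / 4 + / INR (m K)); [|lra].
    apply partial_sum_tail; [exact e0| |].
    - apply Rle_trans with ((INR K + 1) * (slope K * rho)); [|exact Hrho2]. apply partial_sum_const.
      intros k Hk. unfold e. rewrite growth_exponent_head by exact Hk. lra.
    - intros k Hk. unfold e. rewrite growth_exponent_tail by exact Hk. lra. }
  assert (eB : forall k, 1 + slope k * rho <= exp (INR (m k) * e k)).
  { apply growth_exponent_bound; [lra|]. intros k Hk. apply head_growth; [exact Hk|lra]. }
  destruct (weighted_power_small th) as [N0 H0]; [lra|].
  exists (Rmin (r - A) (rho * r)), (S (S N0)). split; [apply Rmin_pos; [unfold r; lra|apply Rmult_lt_0_compat; lra]|].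
  intros w n Hw Hn. destruct n as [|[|n]]; [lia|lia|].
  destruct (bidisc_le _ _ _ _ (Rmin_l _ _) Hw) as [W1 _]. destruct (bidisc_le _ _ _ _ (Rmin_r _ _) Hw) as [_ W2].
  assert (Hn2 : (N0 <= n)%nat) by lia.
  assert (F1 : Cmod (fst w) <= r).
  { assert (T := Cmod_le_near (fst w) (fst z)). unfold A in W1. lra. }
  assert (F2 : Cmod (snd w) <= rho * r).
  { rewrite Ez in W2. assert (Q : forall u : C, (u - 0 = u)%C) by (intros; ring). rewrite Q in W2. lra. }
  assert (L := level_poly_growth e r rho w (S n) ltac:(lra) ltac:(lra) F1 F2 e0 (fun k _ => eB k)).
  assert (Fin : Cmod (level_poly (S n) w) <= th ^ (4 * q (S n))).
  { eapply Rle_trans; [exact L|].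
    assert (X : r ^ m (S n) * exp (INR (m (S n)) * (2 * partial_sum e (S n))) <= th ^ m (S n)).
    { rewrite <- exp_INR_mult, <- Rpow_mult_distr. apply pow_incr.
      split; [apply Rmult_le_pos; [lra|left; apply exp_pos]|].
      apply Rle_trans with (r * exp del).
      - apply Rmult_le_compat_l; [lra|]. apply exp_le_compat. specialize (eS (S n)). lra.
      - unfold del. rewrite exp_ln; [right; field; lra|apply Rdiv_lt_0_compat; lra]. }
    eapply Rle_trans; [apply scale_weight_le_1|].
    - apply Rmult_le_pos; [apply pow_le; lra|left; apply exp_pos].
    - eapply Rle_trans; [exact X|].
      replace (m (S n)) with (4 * q (S n) + (m (S n) - 4 * q (S n)))%nat by (pose proof (m_ge_q n); lia).
      rewrite pow_add. rewrite <- (Rmult_1_r (th ^ (4 * q (S n)))) at 2.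
      apply Rmult_le_compat_l; [apply pow_le; lra|]. rewrite <- (pow1 (m (S n) - 4 * q (S n))). apply pow_incr. lra. }
  specialize (H0 (S n) ltac:(lia)).
  eapply Rle_trans; [|exact H0].
  apply Rmult_le_compat_l; [|exact Fin].
  cbn [poly_weight]. apply Rmult_le_pos; [pose proof (pos_INR (S n)); lra|apply pow_le; lra].
Qed.

Lemma poly_weight_ge_1 n : 1 <= poly_weight n.
Proof.
  destruct n as [|N]; simpl; [lra|]. assert (1 <= 2 ^ x N) by (apply pow_R1_Rle; lra). pose proof (pos_INR N). nra.
Qed.

(** Level 0 is [scale 0] times the square of one linear form, so that form is bounded; together with
    [|z2| < 1] this bounds [z1]. *)
Lemma poly_hull_bounded : exists M, forall z : C2, hull poly_family z -> Cmod (fst z) <= M /\ Cmod (snd z) <= M.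
Proof.
  set (y := 2 ^ x 0). assert (Y : 1 <= y) by (apply pow_R1_Rle; lra). assert (B := slope_ge_1 0).
  exists (y + slope 0). intros z [Hz _]. assert (Z0 := Hz O). assert (Z1 := Hz 1%nat). change (Cmod (snd z) < 1) in Z0.
  change (Cmod (level_poly 0 z) < 1) in Z1. rewrite Cmod_level_poly in Z1.
  change (root_product 0 z) with (line_form 0 z) in Z1.
  assert (L0 := Cmod_ge_0 (line_form 0 z)). set (l := Cmod (line_form 0 z)) in *.
  assert (LY : l * l < y).
  { assert (K := scale_inv 0). fold y in K. apply Rmult_lt_compat_r with (r := y) in Z1; [|lra].
    replace (scale 0 * (l * l) * y) with (l * l * (scale 0 * y)) in Z1 by ring. rewrite K in Z1. lra. }
  assert (Ly : l <= y) by nra.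
  assert (T : Cmod (fst z) <= l + Cmod (RtoC (slope 0) * snd z)).
  { assert (T := Cmod_triangle (line_form 0 z) (RtoC (slope 0) * snd z)).
    assert (Q : forall u v : C, (u - RtoC (slope 0) * v + RtoC (slope 0) * v = u)%C) by (intros; ring).
    unfold line_form in T at 1. fold (slope 0) in T. rewrite Q in T. exact T. }
  rewrite Cmod_mult, Cmod_R, Rabs_pos_eq in T by lra.
  assert (slope 0 * Cmod (snd z) <= slope 0 * 1) by (apply Rmult_le_compat_l; lra). split; lra.
Qed.

(** The degree is at least [2 ^ N * x N] at positive levels, and by Bernoulli [u ^ (2 ^ N)]
    eventually exceeds 2. Thus the axis radii [2 ^ (x N / m N)] come arbitrarily close to 1. *)
Lemma axis_power_large u : 1 < u -> exists N, 2 ^ x N < u ^ m N.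
Proof.
  intros Hu. destruct (inv_pow2_unbounded (1 / (u - 1))) as [N HN].
  exists (S N).
  assert (A : 2 < u ^ (2 ^ S N)).
  { apply Rlt_le_trans with (1 + INR (2 ^ S N) * (u - 1)).
    - rewrite pow_INR. replace (INR 2) with 2 by reflexivity. change (2 ^ S N) with (2 * 2 ^ N).
      apply Rmult_lt_compat_r with (r := u - 1) in HN; [|lra].
      replace (1 / (u - 1) * (u - 1)) with 1 in HN by (field; lra). lra.
    - replace (u ^ (2 ^ S N)) with ((1 + (u - 1)) ^ (2 ^ S N)) by (f_equal; ring). apply poly. lra. }
  assert (X1 : (1 <= x (S N))%nat) by (pose proof (x_linear (S N)); lia).
  apply Rlt_le_trans with ((u ^ (2 ^ S N)) ^ x (S N)).
  - destruct (x (S N)) as [|k]; [lia|]. rewrite <- !tech_pow_Rmult.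
    assert (B : 2 ^ k <= (u ^ 2 ^ S N) ^ k) by (apply pow_incr; lra). assert (0 < 2 ^ k) by (apply pow_lt; lra). nra.
  - rewrite <- pow_mult. apply Rle_pow; [lra|]. pose proof (q_dominates (S N)). pose proof (m_ge_q N). lia.
Qed.

Lemma poly_defining_family : defining_family poly_family poly_degree poly_weight.
Proof.
  split.
  - intros [|N] z; [apply snd_holomorphic|apply level_poly_holomorphic].
  - intros [|N] l z; [|apply level_poly_homogeneous]. simpl.
    assert (Q : forall v : C, (l * v = l * 1 * v)%C) by (intros; ring). exact (Q (snd z)).
  - intros [|N]; simpl; [lia|]. pose proof (m_ge_2 N). lia.
  - exact poly_weight_ge_1.
  - intros z Hz. destruct (Ceq_dec (snd z) 0) as [E|E]; [now apply locally_small_on_axis|now apply locally_small_off_axis].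
  - exact poly_hull_bounded.
  - intros u Hu. destruct (axis_power_large (Cmod u) Hu) as [N HN]. exists (S N). cbn [poly_family].
    rewrite axis_level_poly. rewrite <- (scale_inv N). apply Rmult_lt_compat_l; [apply scale_pos|exact HN].
  - intros u c Hu. destruct (Rle_lt_dec 0 c) as [Hc|Hc].
    + destruct (nfloor_ex c Hc) as [N HN]. exists (S N). cbn [poly_family poly_weight]. rewrite axis_level_poly.
      replace ((INR N + 1) * 2 ^ x N * (scale N * Cmod u ^ m N)) with ((INR N + 1) * Cmod u ^ m N * (scale N * 2 ^ x N)) by ring.
      rewrite scale_inv. assert (1 <= Cmod u ^ m N) by (now apply pow_R1_Rle). pose proof (pos_INR N). nra.
    + exists O. simpl. rewrite Cmod_0. lra.
Qed.

(** * A short path to the boundary *)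

Hypothesis x_large : forall N, (32 * INR N + 48) * 4 ^ N <= INR (x N).
Hypothesis q_jump : forall N, (INR N + 1) * slope N * 4 ^ S N * INR (m (S N)) <= slope (S N).

Lemma poincare_dist_real s t y : 0 <= s <= t -> t < 1 -> t - s <= y * (1 - s * t) -> y <= 1 / 2 ->
  poincare_dist (RtoC s) (RtoC t) <= 2 * y.
Proof.
  intros Hs Ht Hy Hy2. unfold poincare_dist.
  assert (D : 0 < 1 - s * t) by nra.
  assert (E : Cmod ((RtoC s - RtoC t) / (1 - Cconj (RtoC s) * RtoC t)) = (t - s) / (1 - s * t)).
  { replace ((RtoC s - RtoC t) / (1 - Cconj (RtoC s) * RtoC t))%C with (RtoC ((s - t) / (1 - s * t))).
    - rewrite Cmod_R. replace ((s - t) / (1 - s * t)) with (- ((t - s) / (1 - s * t))) by (field; lra).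
      rewrite Rabs_Ropp. apply Rabs_pos_eq, Rdiv_le_0_compat; lra.
    - rewrite RtoC_div, !RtoC_minus, RtoC_mult by lra. f_equal. f_equal. f_equal. f_equal.
      unfold Cconj, RtoC; simpl. f_equal; ring. }
  rewrite E. set (u := (t - s) / (1 - s * t)).
  assert (U0 : 0 <= u) by (apply Rdiv_le_0_compat; lra).
  assert (U1 : u <= y).
  { apply Rmult_le_reg_r with (1 - s * t); [exact D|]. unfold u, Rdiv. rewrite Rmult_assoc, Rinv_l; lra. }
  eapply Rle_trans; [apply arctanh_le; lra|].
  apply Rle_div_l; [lra|]. nra.
Qed.

(* Just small enough to absorb the bound [exp (2 * partial_sum e N)] for the growth of [level_poly N]
   on the vertical disc of [vertical_disc_in_hull]. *)
Definition approach (j : nat) : R := exp (- ((4 * INR j + 6) / INR (m j))).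
(** The point over [approach j] on the zero line of [line_form k]; the path uses only [k = j] and
    [k = S j]. *)
Definition node (j k : nat) : C2 := (RtoC (approach j), RtoC (approach j / 2 ^ q k)).

Lemma approach_pos j : 0 < approach j.
Proof. apply exp_pos. Qed.

Lemma approach_exponent_pos j : 0 < (4 * INR j + 6) / INR (m j).
Proof. pose proof (pos_INR j). pose proof (m_INR_pos j). apply Rdiv_lt_0_compat; lra. Qed.

Lemma approach_lt_1 j : approach j < 1.
Proof. rewrite <- exp_0. apply exp_increasing. pose proof (approach_exponent_pos j). lra. Qed.

Lemma approach_ge j : 1 - (4 * INR j + 6) / INR (m j) <= approach j.
Proof. unfold approach. pose proof (exp_ineq1_le (- ((4 * INR j + 6) / INR (m j)))). lra. Qed.

Lemma approach_mono j : approach j <= approach (S j).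
Proof.
  apply exp_le_compat, Ropp_le_contravar. rewrite S_INR. pose proof (m_double j). pose proof (m_INR_pos j). pose proof (pos_INR j).
  apply Rle_trans with ((4 * (INR j + 1) + 6) / (2 * INR (m j))).
  - apply Rmult_le_compat_l; [lra|]. apply Rinv_le_contravar; lra.
  - apply Rmult_le_reg_r with (2 * INR (m j)); [lra|].
    replace ((4 * (INR j + 1) + 6) / (2 * INR (m j)) * (2 * INR (m j))) with (4 * INR j + 10) by (field; lra).
    replace ((4 * INR j + 6) / INR (m j) * (2 * INR (m j))) with (8 * INR j + 12) by (field; lra). lra.
Qed.

Lemma scale_lt_1 N : scale N < 1.
Proof.
  unfold scale. pose proof (x_linear N). destruct (x N) as [|k]; [lia|]. simpl.
  assert ((/ 2) ^ k <= 1) by (rewrite <- (pow1 k); apply pow_incr; lra). lra.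
Qed.

(** With second to first coordinate ratio [4 ^ S i / slope (S i)], the linear forms of levels at
    most [i] together cost at most [1 / m (S i)] in the exponent. *)
Lemma q_jump_strong i : 4 ^ S i / slope (S i) <= / 2 /\
  (INR i + 1) * (slope i * (4 ^ S i / slope (S i))) <= / INR (m (S i)).
Proof.
  pose proof (q_jump i) as J. pose proof (m_INR_pos (S i)). pose proof (slope_ge_1 i). pose proof (slope_pos (S i)). pose proof (pos_INR i).
  assert (F : 0 < 4 ^ S i) by (apply pow_lt; lra). split.
  - apply Rmult_le_reg_r with (2 * slope (S i)); [lra|].
    replace (4 ^ S i / slope (S i) * (2 * slope (S i))) with (4 ^ S i * 2) by (field; lra).
    replace (/ 2 * (2 * slope (S i))) with (slope (S i)) by field.
    assert (A : 1 <= (INR i + 1) * slope i) by nra.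
    assert (B : 1 * (4 ^ S i * INR (m (S i))) <= (INR i + 1) * slope i * (4 ^ S i * INR (m (S i)))).
    { apply Rmult_le_compat_r; [apply Rmult_le_pos; lra|exact A]. }
    assert (4 ^ S i * 2 <= 4 ^ S i * INR (m (S i))) by (apply Rmult_le_compat_l; lra). lra.
  - apply Rmult_le_reg_r with (slope (S i) * INR (m (S i))); [apply Rmult_lt_0_compat; lra|].
    replace ((INR i + 1) * (slope i * (4 ^ S i / slope (S i))) * (slope (S i) * INR (m (S i)))) with
      ((INR i + 1) * slope i * 4 ^ S i * INR (m (S i))) by (field; lra).
    replace (/ INR (m (S i)) * (slope (S i) * INR (m (S i)))) with (slope (S i)) by (field; lra). exact J.
Qed.

(** Budget for the exponent with [j = S i]: earlier forms cost [1 / m j]; form [j] costs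
    [(2 j + 1) / m j], as [1 + 4 ^ j <= 2 ^ (2 j + 1)]; later forms cost [1 / m j]. Twice the total
    is [(4 j + 6) / m j], exactly what [approach j] provides, and [scale N < 1] makes the inequality
    strict. *)
Lemma vertical_disc_in_hull i (z : C2) : Cmod (fst z) <= approach (S i) ->
  Cmod (snd z) <= 4 ^ S i / slope (S i) * approach (S i) -> hull poly_family z.
Proof.
  intros H1 H2. set (j := S i) in *. set (rho := 4 ^ j / slope j) in *. set (a := approach j) in *.
  assert (a0 : 0 < a) by apply approach_pos. assert (a1 : a < 1) by apply approach_lt_1.
  destruct (q_jump_strong i) as [J1 J2]. fold j in J1, J2. fold rho in J1, J2.
  assert (Hrho : 0 <= rho) by (apply Rdiv_le_0_compat; [apply pow_le; lra|apply slope_pos]).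
  assert (Mj := m_INR_pos j).
  split; [|intros _; lra]. intros [|N]; [change (Cmod (snd z) < 1); nra|].
  set (c := fun k => if Nat.eq_dec k j then (2 * INR j + 1) / INR (m j) else slope i * rho).
  assert (c0 : forall k, 0 <= c k).
  { intros k. unfold c. pose proof (pos_INR j). pose proof (slope_pos i).
    destruct (Nat.eq_dec k j); [apply Rdiv_le_0_compat; lra|apply Rmult_le_pos; lra]. }
  set (e := growth_exponent j c).
  assert (e0 : forall k, 0 <= e k) by now apply growth_exponent_nonneg.
  assert (eB : forall k, 1 + slope k * rho <= exp (INR (m k) * e k)).
  { apply growth_exponent_bound; [lra|]. intros k Hk. unfold c. destruct (Nat.eq_dec k j) as [->|Ne].
    - replace (INR (m j) * ((2 * INR j + 1) / INR (m j))) with (INR (2 * j + 1)).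
      2:{ rewrite plus_INR, mult_INR. change (INR 1) with 1. replace (INR 2) with 2 by reflexivity. field. lra. }
      eapply Rle_trans; [|apply pow2_le_exp]. rewrite pow_add, pow_mult.
      replace (slope j * rho) with (4 ^ j) by (unfold rho; field; apply Rgt_not_eq, slope_pos).
      replace (2 ^ 2) with 4 by ring. assert (1 <= 4 ^ j) by (apply pow_R1_Rle; lra). lra.
    - apply head_growth; [lia|exact Hrho]. }
  assert (eS : partial_sum e N <= (2 * INR j + 2) / INR (m j) + / INR (m j)).
  { apply partial_sum_tail; [exact e0| |].
    - change (partial_sum e j) with (partial_sum e i + e j).
      assert (Ej : e j = (2 * INR j + 1) / INR (m j)).
      { unfold e. rewrite growth_exponent_head by lia. unfold c. destruct (Nat.eq_dec j j); [reflexivity|lia]. }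
      assert (Ei : partial_sum e i <= (INR i + 1) * (slope i * rho)).
      { apply partial_sum_const. intros k Hk. unfold e. rewrite growth_exponent_head by lia. unfold c.
        destruct (Nat.eq_dec k j); [lia|lra]. }
      rewrite Ej. replace ((2 * INR j + 2) / INR (m j)) with (/ INR (m j) + (2 * INR j + 1) / INR (m j)) by (field; lra). lra.
    - intros k Hk. unfold e. rewrite growth_exponent_tail by exact Hk. lra. }
  assert (L := level_poly_growth e a rho z N ltac:(lra) Hrho H1 H2 e0 (fun k _ => eB k)).
  eapply Rle_lt_trans; [exact L|].
  assert (X : a ^ m N * exp (INR (m N) * (2 * partial_sum e N)) <= 1).
  { unfold a, approach. rewrite exp_INR_mult, <- exp_plus, <- exp_0. apply exp_le_compat.
    assert (Q : 2 * partial_sum e N <= (4 * INR j + 6) / INR (m j)).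
    { replace ((4 * INR j + 6) / INR (m j)) with (2 * ((2 * INR j + 2) / INR (m j) + / INR (m j))) by (field; lra). lra. }
    pose proof (m_INR_pos N). nra. }
  assert (K1 := scale_lt_1 N). assert (K0 := scale_pos N).
  apply Rle_lt_trans with (scale N * 1); [apply Rmult_le_compat_l; lra|lra].
Qed.

(** The vertical disc has radius [4 ^ j] times the height of the first node, so both nodes sit at
    parameters at most [(1 / 4) ^ j], close to its center. *)
Lemma vertical_step i : joined_by_disc (hull poly_family) (node (S i) (S i)) (node (S i) (S (S i))) (2 * (1 / 4) ^ S i).
Proof.
  set (j := S i). set (rho := 4 ^ j / slope j). set (a := approach j).
  assert (a0 : 0 < a) by apply approach_pos.
  destruct (q_jump_strong i) as [J1 _]. fold j in J1. fold rho in J1.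
  assert (F4 : 0 < 4 ^ j) by (apply pow_lt; lra). assert (Bj := slope_pos j). assert (BSj := slope_pos (S j)). assert (BM := slope_mono j).
  assert (Hrho : 0 < rho) by (apply Rdiv_lt_0_compat; lra).
  set (t := / (rho * slope j)). set (s := / (rho * slope (S j))).
  assert (Et : t = (1 / 4) ^ j).
  { unfold t, rho. replace (4 ^ j / slope j * slope j) with (4 ^ j) by (field; lra). unfold Rdiv. rewrite Rmult_1_l. now rewrite pow_inv. }
  assert (Ht : 0 < t <= 1 / 4).
  { split; [unfold t; apply Rinv_0_lt_compat, Rmult_lt_0_compat; lra|]. rewrite Et.
    apply Rpow_S_le_1; [lra|unfold j; lia]. }
  assert (Hs : 0 < s <= t).
  { split; [unfold s; apply Rinv_0_lt_compat, Rmult_lt_0_compat; lra|].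
    apply Rinv_le_contravar; [apply Rmult_lt_0_compat; lra|]. apply Rmult_le_compat_l; lra. }
  assert (Ds : disc (RtoC s)) by (unfold disc; rewrite Cmod_R, Rabs_pos_eq; lra).
  assert (Dt : disc (RtoC t)) by (unfold disc; rewrite Cmod_R, Rabs_pos_eq; lra).
  exists (fun l => plus ((RtoC a, RtoC 0) : C2) (scal (l : C_AbsRing) ((RtoC 0, RtoC (a * rho)) : C2))), (RtoC t), (RtoC s).
  split; [|split; [exact Dt|split; [exact Ds|]]].
  - intros l Hl. split; [|apply affine_disc_derive]. unfold disc in Hl. apply (vertical_disc_in_hull i).
    + change (Cmod (RtoC a + l * RtoC 0) <= a). replace (RtoC a + l * RtoC 0)%C with (RtoC a) by ring.
      rewrite Cmod_R, Rabs_pos_eq; lra.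
    + change (Cmod (RtoC 0 + l * RtoC (a * rho)) <= rho * a). replace (RtoC 0 + l * RtoC (a * rho))%C with (l * RtoC (a * rho))%C by ring.
      rewrite Cmod_mult, Cmod_R, Rabs_pos_eq by (apply Rmult_le_pos; lra).
      assert (0 < a * rho) by (apply Rmult_lt_0_compat; lra). nra.
  - assert (Q1 : forall l : C, (RtoC a + l * RtoC 0 = RtoC a)%C) by (intros; ring).
    assert (Q2 : forall u v, u * (a * rho) = v -> (RtoC 0 + RtoC u * RtoC (a * rho) = RtoC v)%C).
    { intros u v <-. rewrite (RtoC_mult u). ring. }
    split; [|split].
    + apply C2_ext; [apply Q1|]. apply Q2. unfold t. fold j. fold (slope j). fold a. field. lra.
    + apply C2_ext; [apply Q1|]. apply Q2. unfold s. fold j. fold (slope (S j)). fold a. field. lra.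
    + rewrite poincare_dist_sym by assumption. rewrite <- Et.
      apply poincare_dist_real; [lra|lra| |lra].
      assert (tt : t * t <= 1 * 1) by (apply Rmult_le_compat; lra).
      assert (s * (t * t) <= s * (1 * 1)) by (apply Rmult_le_compat_l; lra). lra.
Qed.

Lemma pow2_ge_exp_half n : exp (INR n / 2) <= 2 ^ n.
Proof.
  assert (H : exp (1 / 2) <= 2).
  { assert (E : exp (1 / 2) * exp (1 / 2) <= 3) by (rewrite <- exp_plus; replace (1 / 2 + 1 / 2) with 1 by field; apply exp_le_3).
    pose proof (exp_pos (1 / 2)). nra. }
  replace (INR n / 2) with (INR n * (1 / 2)) by field. rewrite <- exp_INR_mult. apply pow_incr.
  pose proof (exp_pos (1 / 2)). lra.
Qed.

Lemma root_product_vanishes k N z : line_form k z = RtoC 0 -> (k <= N)%nat -> root_product N z = RtoC 0.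
Proof.
  intros H L. induction L as [|N L IH].
  - destruct k as [|k]; [exact H|]. cbn [root_product]. rewrite H. ring.
  - cbn [root_product]. rewrite IH. pose proof (q_pos (S N)). destruct (4 * q (S N))%nat as [|n] eqn:E; [lia|]. simpl. ring.
Qed.

Lemma m_mono N K : (N <= K)%nat -> INR (m N) <= INR (m K).
Proof. intros L. induction L as [|K L IH]; [lra|]. pose proof (m_double K). pose proof (m_INR_pos K). lra. Qed.

(* The disc on the line [z1 = slope (S j) * z2] reaches up to [|z1| = exp (overshoot j)]; this is possible because
   only the levels [N <= j] matter there and [scale N] compensates their growth. *)
Definition overshoot (j : nat) : R := INR (x j) / (4 * INR (m j)).

Lemma x_INR_ge N : 48 <= INR (x N).
Proof.
  eapply Rle_trans; [|apply x_large]. assert (1 <= 4 ^ N) by (apply pow_R1_Rle; lra). pose proof (pos_INR N). nra.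
Qed.

Lemma x_le_m i : INR (x (S i)) <= INR (m (S i)).
Proof. apply le_INR. pose proof (m_ge_q i). pose proof (q_large (S i)). lia. Qed.

Lemma overshoot_bounds i : 0 < overshoot (S i) <= 1.
Proof.
  unfold overshoot. pose proof (x_INR_ge (S i)). pose proof (x_le_m i). split; [apply Rdiv_lt_0_compat; lra|].
  apply Rle_div_l; [lra|]. lra.
Qed.

(** Equality at the top level. Below it, [m (S i) = m i * 4 * q (S i)] and [x (S i) <= q (S i)]
    leave less than 1, while [x N >= 48]. *)
Lemma overshoot_level i N : (N <= S i)%nat -> INR (m N) * overshoot (S i) <= INR (x N) / 4.
Proof.
  intros L. unfold overshoot. pose proof (m_INR_pos (S i)). pose proof (x_INR_ge N). pose proof (x_INR_ge (S i)).
  destruct (Nat.eq_dec N (S i)) as [->|Ne].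
  - right. field. lra.
  - assert (M1 : INR (m N) <= INR (m i)) by (apply m_mono; lia).
    assert (M2 : INR (m (S i)) = INR (m i) * (4 * INR (q (S i)))).
    { rewrite m_S, !mult_INR. replace (INR 4) with 4 by (simpl; ring). ring. }
    assert (Q : INR (x (S i)) <= INR (q (S i))) by (apply le_INR; pose proof (q_large (S i)); lia).
    pose proof (m_INR_pos i). pose proof (m_INR_pos N).
    apply Rle_trans with (1 / 4); [|lra].
    apply Rmult_le_reg_r with (4 * INR (m (S i))); [lra|].
    replace (INR (m N) * (INR (x (S i)) / (4 * INR (m (S i)))) * (4 * INR (m (S i)))) with (INR (m N) * INR (x (S i))) by (field; lra).
    rewrite M2.
    assert (INR (m N) * INR (x (S i)) <= INR (m i) * INR (q (S i))) by (apply Rmult_le_compat; lra).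
    assert (0 <= INR (m i) * INR (q (S i))) by (apply Rmult_le_pos; lra). lra.
Qed.

(** Levels above [j] vanish on this line. At a level [N <= j] the linear forms contribute at most
    [exp 2] and the radius at most [exp (x N / 4)]; the product is below [exp (x N / 2) <= 2 ^ x N],
    the inverse of [scale N]. *)
Lemma radial_disc_in_hull i (l : C) : Cmod l < 1 ->
  hull poly_family (scal (l : C_AbsRing) ((RtoC (exp (overshoot (S i))), RtoC (exp (overshoot (S i)) / slope (S (S i)))) : C2)).
Proof.
  intros Hl. set (j := S i). set (r := exp (overshoot j)). set (rho := / slope (S j)).
  set (z := scal (l : C_AbsRing) ((RtoC r, RtoC (r / slope (S j))) : C2)).
  assert (Ov := overshoot_bounds i). fold j in Ov.
  assert (r0 : 0 < r) by apply exp_pos.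
  assert (r3 : r <= 3) by (eapply Rle_trans; [apply (exp_le_compat _ 1); lra|apply exp_le_3]).
  assert (Bp := slope_pos (S j)). assert (rho0 : 0 < rho) by now apply Rinv_0_lt_compat.
  assert (L0 := Cmod_ge_0 l).
  assert (Z1 : (fst z : C) = (l * RtoC r)%C) by reflexivity.
  assert (Z2 : (snd z : C) = (l * RtoC (r * rho))%C) by reflexivity.
  assert (A1 : Cmod (fst z) = Cmod l * r) by (rewrite Z1, Cmod_mult, Cmod_R, Rabs_pos_eq; lra).
  assert (rr : 0 < r * rho) by (apply Rmult_lt_0_compat; lra).
  assert (A2 : Cmod (snd z) = Cmod l * (r * rho)) by (rewrite Z2, Cmod_mult, Cmod_R, Rabs_pos_eq; lra).
  destruct (q_jump_strong j) as [J1 J2].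
  assert (R4 : rho <= / 8).
  { replace (4 ^ S j / slope (S j)) with (4 ^ S j * rho) in J1 by reflexivity.
    change (4 ^ S j) with (4 * 4 ^ j) in J1. assert (F : 1 <= 4 ^ j) by (apply pow_R1_Rle; lra).
    assert (rho * 1 <= rho * 4 ^ j) by (apply Rmult_le_compat_l; lra). lra. }
  split.
  2:{ intros E. assert (E2 : Cmod (snd z) = 0) by (rewrite E; apply Cmod_0). rewrite A2 in E2.
      assert (Cmod l = 0) by nra. rewrite A1. nra. }
  intros [|N]; [change (Cmod (snd z) < 1); rewrite A2; nra|]. change (Cmod (level_poly N z) < 1).
  destruct (Compare_dec.le_lt_dec N j) as [L|L].
  - set (e := fun _ : nat => slope j * rho).
    assert (Bj := slope_pos j).
    assert (e0 : forall k, 0 <= e k) by (intros k; apply Rmult_le_pos; lra).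
    assert (G := level_poly_growth e r rho z N ltac:(lra) ltac:(lra) ltac:(rewrite A1; nra) ltac:(rewrite A2; nra) e0
      (fun k Hk => head_growth k j rho (Nat.le_trans _ _ _ Hk L) (Rlt_le _ _ rho0))).
    eapply Rle_lt_trans; [exact G|].
    assert (S1 : INR (m N) * partial_sum e N <= 1).
    { assert (P1 : partial_sum e N <= (INR N + 1) * (slope j * rho)) by (apply partial_sum_const; intros; unfold e; lra).
      assert (P2 : (INR N + 1) * (slope j * rho) <= (INR j + 1) * (slope j * rho)).
      { apply Rmult_le_compat_r; [apply Rmult_le_pos; lra|]. apply Rplus_le_compat_r, le_INR, L. }
      assert (P3 : (INR j + 1) * (slope j * rho) <= / INR (m (S j))).
      { eapply Rle_trans; [|exact J2]. pose proof (pos_INR j). apply Rmult_le_compat_l; [lra|].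
        apply Rmult_le_compat_l; [lra|]. unfold Rdiv. fold rho.
        assert (1 <= 4 ^ S j) by (apply pow_R1_Rle; lra). nra. }
      assert (M1 := m_mono N (S j) ltac:(lia)). assert (M2 := m_INR_pos N).
      apply Rle_trans with (INR (m (S j)) * / INR (m (S j))); [|rewrite Rinv_r; lra].
      assert (PS := proj1 (partial_sum_ge e N e0)).
      apply Rmult_le_compat; lra. }
    assert (O1 := overshoot_level i N L). fold j in O1.
    assert (X : r ^ m N * exp (INR (m N) * (2 * partial_sum e N)) < 2 ^ x N).
    { unfold r. rewrite exp_INR_mult, <- exp_plus.
      eapply Rlt_le_trans; [|apply pow2_ge_exp_half]. apply exp_increasing. pose proof (x_INR_ge N). lra. }
    rewrite <- (scale_inv N). apply Rmult_lt_compat_l; [apply scale_pos|exact X].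
  - assert (LF : line_form (S j) z = RtoC 0).
    { unfold line_form. rewrite Z1, Z2. fold (slope (S j)). unfold rho.
      rewrite (RtoC_mult r), RtoC_inv by lra. field. intros F. apply RtoC_inj in F. lra. }
    unfold level_poly. rewrite (root_product_vanishes (S j) N z LF) by lia.
    replace (RtoC ((/ 2) ^ x N) * (0 * line_form N z))%C with (RtoC 0) by ring. rewrite Cmod_0. lra.
Qed.

(** In the disc parameter both points stay at distance at least [eta / 2] from 1, and they differ by
    at most [1 - approach j <= (4 j + 6) / m j]. With [eta = x j / (4 m j)] the quotient is
    [(32 j + 48) / x j], at most [(1 / 4) ^ j] by [x_large]. *)
Lemma radial_step i : joined_by_disc (hull poly_family) (node (S i) (S (S i))) (node (S (S i)) (S (S i))) (2 * (1 / 4) ^ S i).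
Proof.
  set (j := S i). set (eta := overshoot j). assert (Ov := overshoot_bounds i). fold j in Ov. fold eta in Ov.
  assert (a0 := approach_pos j). assert (a1 := approach_lt_1 (S j)). assert (am := approach_mono j).
  set (d := exp (- eta)).
  assert (d0 : 0 < d) by apply exp_pos.
  assert (ed : exp eta * d = 1) by (unfold d; rewrite <- exp_plus, Rplus_opp_r; apply exp_0).
  assert (d1 : d <= 1 - eta / 2).
  { assert (E := exp_ineq1_le eta).
    assert (X : (1 + eta) * d <= 1) by (rewrite <- ed; apply Rmult_le_compat_r; lra). nra. }
  set (s := approach j * d). set (t := approach (S j) * d).
  assert (Hst : 0 < s <= t) by (unfold s, t; split; [apply Rmult_lt_0_compat; lra|apply Rmult_le_compat_r; lra]).
  assert (Ht : t <= d) by (unfold t; nra).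
  assert (Ds : disc (RtoC s)) by (unfold disc; rewrite Cmod_R, Rabs_pos_eq; lra).
  assert (Dt : disc (RtoC t)) by (unfold disc; rewrite Cmod_R, Rabs_pos_eq; lra).
  assert (Bp := slope_pos (S j)).
  exists (fun l => plus origin (scal (l : C_AbsRing) ((RtoC (exp eta), RtoC (exp eta / slope (S j))) : C2))), (RtoC s), (RtoC t).
  split; [|split; [exact Ds|split; [exact Dt|]]].
  - intros l Hl. split; [|apply affine_disc_derive].
    replace (plus origin (scal (l : C_AbsRing) ((RtoC (exp eta), RtoC (exp eta / slope (S j))) : C2))) with
      (scal (l : C_AbsRing) ((RtoC (exp eta), RtoC (exp eta / slope (S j))) : C2)).
    + apply (radial_disc_in_hull i l Hl).
    + assert (Q : forall u : C, (u = 0 + u)%C) by (intros; ring). apply C2_ext; apply Q.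
  - assert (Q : forall u v w, u * v = w -> (RtoC 0 + RtoC u * RtoC v = RtoC w)%C).
    { intros u v w <-. rewrite RtoC_mult. ring. }
    assert (E1 : forall y, y * d * exp eta = y) by (intros y; rewrite Rmult_assoc, (Rmult_comm d), ed; ring).
    split; [|split].
    + apply C2_ext; apply Q; [apply E1|]. unfold s, Rdiv. rewrite <- Rmult_assoc, E1. reflexivity.
    + apply C2_ext; apply Q; [apply E1|]. unfold t, Rdiv. rewrite <- Rmult_assoc, E1. reflexivity.
    + assert (y1 : (1 / 4) ^ j <= 1 / 4) by (apply Rpow_S_le_1; [lra|unfold j; lia]).
      apply poincare_dist_real; [lra|lra| |lra].
      assert (y0 : 0 < (1 / 4) ^ j) by (apply pow_lt; lra).
      assert (W : t - s <= (4 * INR j + 6) / INR (m j)).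
      { assert (AG := approach_ge j). unfold t, s. assert (approach (S j) * d - approach j * d <= 1 - approach j) by nra. lra. }
      assert (V : eta / 2 <= 1 - s * t) by nra.
      apply Rle_trans with ((1 / 4) ^ j * (eta / 2)); [|apply Rmult_le_compat_l; lra].
      eapply Rle_trans; [exact W|]. unfold eta, overshoot. assert (Mj := m_INR_pos j). assert (XL := x_large j).
      assert (P4 : (1 / 4) ^ j * 4 ^ j = 1) by (rewrite <- Rpow_mult_distr; replace (1 / 4 * 4) with 1 by field; apply pow1).
      apply Rmult_le_reg_r with (8 * INR (m j)); [lra|].
      replace ((4 * INR j + 6) / INR (m j) * (8 * INR (m j))) with (32 * INR j + 48) by (field; lra).
      replace ((1 / 4) ^ j * (INR (x j) / (4 * INR (m j)) / 2) * (8 * INR (m j))) with ((1 / 4) ^ j * INR (x j)) by (field; lra).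
      apply Rle_trans with ((1 / 4) ^ j * ((32 * INR j + 48) * 4 ^ j)).
      * replace ((1 / 4) ^ j * ((32 * INR j + 48) * 4 ^ j)) with ((1 / 4) ^ j * 4 ^ j * (32 * INR j + 48)) by ring. rewrite P4. lra.
      * apply Rmult_le_compat_l; lra.
Qed.

(** Even indices start a vertical step, odd ones a radial step. Levels begin at 1 because the
    estimates for level [j] use level [j - 1]. *)
Definition zigzag (n : nat) : C2 :=
  let j := S (Nat.div2 n) in if Nat.even n then node j j else node j (S j).

Lemma zigzag_step n : joined_by_disc (hull poly_family) (zigzag n) (zigzag (S n)) (1 * (1 / 2) ^ n).
Proof.
  assert (W : forall y z r s, r <= s -> joined_by_disc (hull poly_family) y z r -> joined_by_disc (hull poly_family) y z s).
  { intros y z r s L (f & u & v & A & B & C0 & D & E & F). exists f, u, v. repeat split; auto; try now apply A. lra. }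
  assert (H4 : forall i, (1 / 4) ^ i = (1 / 2) ^ (2 * i)) by (intros; rewrite pow_mult; f_equal; simpl; field).
  destruct (Nat.Even_or_Odd n) as [[i ->]|[i ->]]; unfold zigzag.
  - rewrite Nat.even_succ, <- Nat.negb_even.
    replace (Nat.even (2 * i)) with true by (symmetry; apply Nat.even_spec; now exists i).
    rewrite Nat.div2_succ_double, Nat.div2_double. cbn [negb].
    apply (W _ _ (2 * (1 / 4) ^ S i)); [|apply vertical_step].
    rewrite H4. replace (2 * S i)%nat with (2 + 2 * i)%nat by lia. rewrite pow_add.
    assert (0 <= (1 / 2) ^ (2 * i)) by (apply pow_le; lra). replace ((1 / 2) ^ 2) with (1 / 4) by field. lra.
  - replace (2 * i + 1)%nat with (S (2 * i)) by lia.
    rewrite Nat.even_succ, <- Nat.negb_even. replace (Nat.even (2 * i)) with true by (symmetry; apply Nat.even_spec; now exists i).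
    replace (S (S (2 * i))) with (2 * S i)%nat by lia.
    replace (Nat.even (2 * S i)) with true by (symmetry; apply Nat.even_spec; now exists (S i)).
    rewrite Nat.div2_succ_double, Nat.div2_double. cbn [negb].
    apply (W _ _ (2 * (1 / 4) ^ S i)); [|apply radial_step].
    rewrite H4. replace (2 * S i)%nat with (1 + S (2 * i))%nat by lia. rewrite pow_add, pow_1.
    assert (0 <= (1 / 2) ^ S (2 * i)) by (apply pow_le; lra). lra.
Qed.

Lemma zigzag_in n : hull poly_family (zigzag n).
Proof.
  destruct (zigzag_step n) as (f & u & v & A & B & _ & E & _). rewrite <- E. now apply A.
Qed.

Lemma approach_exponent_small i : (4 * INR (S i) + 6) / INR (m (S i)) <= 2 * (1 / 2) ^ S i.
Proof.
  set (j := S i). pose proof (m_INR_pos j).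
  assert (A : 4 * (2 ^ j * (2 * INR j + 1)) <= INR (m j)).
  { apply Rle_trans with (INR (4 * (2 ^ j * (2 * j + 1)))).
    - rewrite !mult_INR, pow_INR, plus_INR, mult_INR. replace (INR 4) with 4 by (simpl; ring).
      change (INR 1) with 1. replace (INR 2) with 2 by reflexivity. lra.
    - apply le_INR. pose proof (m_ge_q i). pose proof (q_dominates j). pose proof (x_linear j). fold j in H0.
      assert (2 ^ j * (2 * j + 1) <= 2 ^ j * x j)%nat by (apply Nat.mul_le_mono_l; lia). lia. }
  assert (P2 : (1 / 2) ^ j * 2 ^ j = 1) by (rewrite <- Rpow_mult_distr; replace (1 / 2 * 2) with 1 by field; apply pow1).
  assert (P0 : 0 < (1 / 2) ^ j) by (apply pow_lt; lra). pose proof (pos_INR j).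
  apply Rmult_le_reg_r with (INR (m j)); [lra|]. unfold Rdiv at 1. rewrite Rmult_assoc, Rinv_l by lra.
  apply Rle_trans with (2 * (1 / 2) ^ j * (4 * (2 ^ j * (2 * INR j + 1)))).
  - replace (2 * (1 / 2) ^ j * (4 * (2 ^ j * (2 * INR j + 1)))) with (8 * ((1 / 2) ^ j * 2 ^ j) * (2 * INR j + 1)) by ring.
    rewrite P2. lra.
  - apply Rmult_le_compat_l; lra.
Qed.

Lemma node_limit e : 0 < e -> exists J, forall j k, (J <= j)%nat -> (1 <= j <= k)%nat ->
  bidisc ((RtoC 1, RtoC 0) : C2) e (node j k).
Proof.
  intros He. destruct (pow_lt_1_zero (1 / 2)) with (y := e / 2) as [J HJ]; [rewrite Rabs_pos_eq; lra|lra|].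
  exists J. intros j k Hj Hk. specialize (HJ j Hj). rewrite Rabs_pos_eq in HJ by (apply pow_le; lra).
  assert (a0 := approach_pos j). assert (a1 := approach_lt_1 j). assert (AG := approach_ge j).
  assert (B : 2 ^ j <= 2 ^ q k) by (apply Rle_pow; [lra|]; pose proof (q_large k); lia).
  assert (P : 0 < 2 ^ j) by (apply pow_lt; lra).
  split.
  - change (Cmod (RtoC (approach j) - RtoC 1) < e). rewrite <- RtoC_minus, Cmod_R.
    destruct j as [|i]; [lia|]. pose proof (approach_exponent_small i).
    apply Rabs_def1; lra.
  - change (Cmod (RtoC (approach j / 2 ^ q k) - RtoC 0) < e). rewrite <- RtoC_minus, Cmod_R, Rminus_0_r.
    rewrite Rabs_pos_eq by (apply Rdiv_le_0_compat; lra).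
    apply Rle_lt_trans with ((1 / 2) ^ j); [|lra].
    unfold Rdiv at 2. rewrite Rmult_1_l, pow_inv.
    apply Rle_trans with (1 * / 2 ^ q k).
    + apply Rmult_le_compat_r; [left; apply Rinv_0_lt_compat; lra|lra].
    + rewrite Rmult_1_l. apply Rinv_le_contravar; lra.
Qed.

Lemma zigzag_limit e : 0 < e -> exists N, forall n, (N <= n)%nat -> bidisc ((RtoC 1, RtoC 0) : C2) e (zigzag n).
Proof.
  intros He. destruct (node_limit e He) as [J HJ]. exists (2 * J)%nat. intros n Hn.
  assert (D : (J <= S (Nat.div2 n))%nat).
  { assert (Q := Nat.div2_odd n). destruct (Nat.odd n); cbn [Nat.b2n] in Q; lia. }
  unfold zigzag. cbv zeta. clear Hn. revert D. generalize (Nat.div2 n). intros i D.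
  destruct (Nat.even n); apply HJ; try exact D; split; auto with arith.
Qed.

(** Only the axis clause excludes this point, where each level polynomial has modulus [scale N]. *)
Lemma limit_outside : ~ hull poly_family ((RtoC 1, RtoC 0) : C2).
Proof. intros [_ H]. specialize (H eq_refl). simpl in H. rewrite Cmod_1 in H. lra. Qed.
End Family.

(** * An explicit choice of the exponents *)

Definition scale_exponent (N : nat) : nat := (16 ^ (N + 2))%nat.
Definition slope_exponent (N : nat) : nat := (32 ^ (N + 2))%nat.
Fixpoint level_degree (N : nat) : nat :=
  match N with O => 2%nat | S N => (level_degree N * (4 * slope_exponent (S N)))%nat end.

Lemma scale_exponent_S N : scale_exponent (S N) = (16 * scale_exponent N)%nat.
Proof. reflexivity. Qed.

Lemma slope_exponent_S N : slope_exponent (S N) = (32 * slope_exponent N)%nat.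
Proof. reflexivity. Qed.

Lemma scale_exponent_ge N : (2 * N + 2 <= scale_exponent N)%nat.
Proof.
  induction N as [|N IH]; [unfold scale_exponent; simpl; lia|]. rewrite scale_exponent_S. lia.
Qed.

Lemma slope_scale N : slope_exponent N = (2 ^ (N + 2) * scale_exponent N)%nat.
Proof. unfold slope_exponent, scale_exponent. now rewrite <- Nat.pow_mul_l. Qed.

Lemma slope_exponent_large N : (scale_exponent N + N + 2 <= slope_exponent N)%nat.
Proof.
  rewrite slope_scale. pose proof (scale_exponent_ge N).
  assert (4 <= 2 ^ (N + 2))%nat by (rewrite Nat.pow_add_r; pose proof (Nat.pow_nonzero 2 N); simpl (2 ^ 2)%nat; lia). nia.
Qed.

Lemma slope_exponent_dominates N : (2 ^ N * scale_exponent N <= slope_exponent N)%nat.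
Proof. rewrite slope_scale. apply Nat.mul_le_mono_r, Nat.pow_le_mono_r; lia. Qed.

(** Base 16 leaves a factor [4 ^ N] beyond the required one, more than enough for the linear
    factor. *)
Lemma scale_exponent_large N : (32 * INR N + 48) * 4 ^ N <= INR (scale_exponent N).
Proof.
  unfold scale_exponent. rewrite pow_INR. replace (INR 16) with (4 * 4) by (simpl; ring).
  rewrite pow_add, Rpow_mult_distr. pose proof (INR_lt_pow2 N). pose proof (pos_INR N).
  assert (2 ^ N <= 4 ^ N) by (apply pow_incr; lra).
  assert (0 < 4 ^ N) by (apply pow_lt; lra). replace ((4 * 4) ^ 2) with 256 by ring.
  assert ((32 * INR N + 48) * 4 ^ N <= (256 * 4 ^ N) * 4 ^ N) by (apply Rmult_le_compat_r; lra). lra.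
Qed.

Lemma level_degree_S_le N : INR (level_degree N) <= 2 ^ slope_exponent N ->
  INR (level_degree (S N)) <= 2 ^ (slope_exponent N + slope_exponent N + 7).
Proof.
  intros H. cbn [level_degree]. rewrite slope_exponent_S, !mult_INR.
  replace (INR 4) with 4 by (simpl; ring). replace (INR 32) with 32 by (simpl; ring).
  pose proof (INR_lt_pow2 (slope_exponent N)). pose proof (pos_INR (slope_exponent N)). pose proof (pos_INR (level_degree N)).
  rewrite !pow_add. replace (2 ^ 7) with 128 by ring.
  assert (INR (level_degree N) * INR (slope_exponent N) <= 2 ^ slope_exponent N * 2 ^ slope_exponent N)
    by (apply Rmult_le_compat; lra). lra.
Qed.

Lemma level_degree_le N : INR (level_degree N) <= 2 ^ slope_exponent N.
Proof.
  induction N as [|N IH].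
  - cbn [level_degree]. replace (INR 2) with (2 ^ 1) by (simpl; ring). apply Rle_pow; [lra|].
    pose proof (slope_exponent_large 0). lia.
  - eapply Rle_trans; [now apply level_degree_S_le|]. apply Rle_pow; [lra|].
    rewrite slope_exponent_S. pose proof (slope_exponent_large N). pose proof (scale_exponent_ge N). lia.
Qed.

(** The logarithm of the degree at level [S N] is at most [2 s + 7], where [s = slope_exponent N];
    in total the left side has exponent [3 s + 3 N + 9], well below [32 s]. *)
Lemma slope_jump N : (INR N + 1) * 2 ^ slope_exponent N * 4 ^ S N * INR (level_degree (S N)) <= 2 ^ slope_exponent (S N).
Proof.
  assert (A := level_degree_S_le N (level_degree_le N)). set (s := slope_exponent N) in *.
  assert (P : forall k, 0 < 2 ^ k) by (intros; apply pow_lt; lra).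
  replace (4 ^ S N) with (2 ^ (2 * S N)) by (rewrite pow_mult; f_equal; ring).
  apply Rle_trans with (2 ^ N * 2 ^ s * 2 ^ (2 * S N) * 2 ^ (s + s + 7)).
  - pose proof (pos_INR N). pose proof (INR_lt_pow2 N). pose proof (P s). pose proof (P (2 * S N)%nat).
    apply Rmult_le_compat; [|apply pos_INR| |exact A].
    + apply Rmult_le_pos; [apply Rmult_le_pos|]; lra.
    + apply Rmult_le_compat_r; [lra|]. apply Rmult_le_compat_r; lra.
  - rewrite <- !pow_add. apply Rle_pow; [lra|]. rewrite slope_exponent_S. fold s.
    pose proof (slope_exponent_large N). pose proof (scale_exponent_ge N). fold s in H. lia.
Qed.

Theorem theorem1p1 :
  exists G : C2 -> Prop,
    is_domain G /\ bounded_set G /\ balanced G /\ pseudoconvex G /\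
    (forall z : C2, continuous (minkowski G) z) /\
    ~ kobayashi_complete G /\
    domain_of_holomorphy G /\
    ~ kobayashi_finitely_compact G.
Proof.
  set (x := scale_exponent). set (q := slope_exponent). set (m := level_degree).
  assert (x_double : forall N, (2 * x N <= x (S N))%nat).
  { intros N. unfold x. rewrite scale_exponent_S. lia. }
  assert (x_linear : forall N, (2 * N + 1 <= x N)%nat) by (intros N; pose proof (scale_exponent_ge N); unfold x; lia).
  assert (q_mono : forall N, (q N <= q (S N))%nat) by (intros N; unfold q; rewrite slope_exponent_S; lia).
  assert (F : defining_family (poly_family x q) (poly_degree m) (poly_weight x)).
  { apply poly_defining_family; auto using slope_exponent_large, slope_exponent_dominates. }
  destruct (family_bounded _ _ _ F) as [M HM].
  assert (M0 : 0 <= M).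
  { destruct (HM origin (hull_origin _ _ _ F)) as [A _]. simpl in A. rewrite Cmod_0 in A. exact A. }
  assert (step : forall n, joined_by_disc (hull (poly_family x q)) (zigzag q m n) (zigzag q m (S n)) (1 * (1 / 2) ^ n)).
  { apply zigzag_step; auto using slope_exponent_large, slope_exponent_dominates, scale_exponent_large, slope_jump. }
  assert (lim : forall e, 0 < e -> exists N, forall n, (N <= n)%nat -> bidisc ((RtoC 1, RtoC 0) : C2) e (zigzag q m n)).
  { apply (zigzag_limit x); auto using slope_exponent_large, slope_exponent_dominates. }
  assert (inside : forall n, hull (poly_family x q) (zigzag q m n)).
  { apply zigzag_in; auto using slope_exponent_large, slope_exponent_dominates, scale_exponent_large, slope_jump. }
  exists (hull (poly_family x q)).
  split; [exact (hull_domain _ _ _ F)|].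
  split; [exact (hull_bounded _ _ _ F)|].
  split; [exact (hull_balanced _ _ _ F)|].
  split; [exact (hull_pseudoconvex _ _ _ F)|].
  split; [exact (minkowski_continuous _ _ _ F)|].
  split; [|split; [exact (hull_domain_of_holomorphy _ _ _ F)|]].
  - apply (path_not_complete _ M HM _ _ 1 M0 inside lim (limit_outside x q) step).
    intros n z Gz. apply balanced_chain; auto.
    + exact (hull_balanced _ _ _ F).
    + exact (hull_open _ _ _ F).
  - exact (path_not_finitely_compact _ M HM _ _ 1 inside lim (limit_outside x q) step).
Qed.
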